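(* Let $k\ge2$ and let $H$ be a real-analytic Hamiltonian on $(\mathbb{R}^2,\omega)$, with $\omega$ a real-analytic symplectic structure, having an $A_{k-1}$ singularity at the origin $O$. Then the pair $(H,\omega)$ has the following local symplectic normal form near $O$ for the group of $H$-preserving real-analytic diffeomorphism germs: $$\Big(H=\xi^2\pm x^k,\ \ \omega=\sum_{i=0}^{k-2}x^i\,\tilde c_i(H)\,d\xi\wedge dx\Big)$$ for some real-analytic function germs $\tilde c_i$ of one variable at $0$ with $\tilde c_0(0)\ne0$, defined uniquely up to simultaneously changing the sign of the functions $\tilde c_{2i+1}(H)$, $i=0,\dots,\ell-2$, when $k=2\ell$ is even. In other words, among normal forms inducing the same orientation (i.e. with the same sign of $\tilde c_0(0)$): - if $k$ is odd, then (the Taylor series at $0$ of) $\tilde c_i$, $i=0,\dots,k-2$, form a complete and minimal set of symplectic invariants; - if $k=2\ell$ is even, then (the Taylor series at $0$ of) $\tilde c_i$, $i=0,\dots,k-2$, form a complete set of symplectic invariants with the only relation given by changing the sign of $\sum_{i=0}^{\ell-2}x^{2i+1}\tilde c_{2i+1}(H)$.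
   Context: All objects are real-analytic germs at the origin of $\mathbb{R}^2$. $H$ has an $A_{k-1}$ singularity at the origin if in some real-analytic (generally non-canonical) local coordinates $(x,\xi)$ it has the form $\xi^2\pm x^k$ (additive constant normalized to $0$); the sign is fixed throughout. $\mathrm{Diff}(\mathbb{R}^2,0)$, the group of real-analytic diffeomorphism germs fixing the origin, acts on pairs by $(H,\omega)\mapsto(\psi^*H,\psi^*\omega)$; two pairs are equivalent ($H$-preserving equivalence) if they lie in the same orbit. ''$(H,\omega)$ has the given normal form'' means that it is equivalent to that pair. ''Complete set of invariants, with uniqueness modulo a relation'' means: two normal forms (with the same $k$, the same sign in $H$, and inducing the same orientation) given by $(\tilde c_i)$ and $(\tilde c_i')$ are equivalent if and only if $(\tilde c_i)$ and $(\tilde c_i')$ coincide modulo the stated relation. When comparing two symplectic forms $\omega_0,\omega_1$ one assumes $\omega_1/\omega_0>0$ (same orientation). *)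

(* Defs.v *)
From HB Require Import structures.
From mathcomp Require Import all_boot all_order all_algebra.
From mathcomp Require Import all_classical all_reals all_analysis.

Set Implicit Arguments.
Unset Strict Implicit.
Unset Printing Implicit Defensive.

Import Order.TTheory GRing.Theory Num.Theory.
Import numFieldNormedType.Exports.

Local Open Scope classical_set_scope.
Local Open Scope ring_scope.

(* A germ at the origin is represented by a globally defined function, of which
   only the restriction to some neighbourhood of 0 matters.
   A point p of the plane R * R has coordinates x = p.1 and xi = p.2; its norm
   `|p| is the maximum of `|x| and `|xi|. *)

Section Analytic.
Variable R : realType.
Implicit Types (f g : R -> R) (F : R * R -> R) (psi : R * R -> R * R).

Definition eq_germ f g := \forall t \near (0 : R), f t = g t.

Definition analytic1 f :=
  exists (a : nat -> R) (r : R), 0 < r /\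
    forall t, `|t| < r -> pseries a t @ \oo --> f t.

Definition taylor_coef f (n : nat) : R := derive1n n f 0 / n`!%:R.

Definition monomial_term (a : nat -> nat -> R) (p : R * R) (ij : nat * nat) :=
  a ij.1 ij.2 * p.1 ^+ ij.1 * p.2 ^+ ij.2.

(* Since the double series converges absolutely, its sum may be computed along
   the square partial sums. *)
Definition analytic2 F :=
  exists (a : nat -> nat -> R) (r : R), 0 < r /\
    forall p, `|p| < r ->
      summable [set: nat * nat] (fun ij => (monomial_term a p ij)%:E) /\
      (\sum_(i < n) \sum_(j < n) monomial_term a p (val i, val j))
        @[n --> \oo] --> F p.

Definition analytic_map psi :=
  analytic2 (fun p => (psi p).1) /\ analytic2 (fun p => (psi p).2).

Definition diffeo_germ psi :=
  [/\ psi 0 = 0, analytic_map psi &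
      exists phi, [/\ phi 0 = 0, analytic_map phi,
        \forall p \near (0 : R * R), phi (psi p) = p &
        \forall p \near (0 : R * R), psi (phi p) = p]].

End Analytic.

Section HamiltonianPairs.
Variable R : realType.

Definition two_form := R * R -> R * R -> R * R -> R.

Implicit Types (H : R * R -> R) (w : two_form) (psi : R * R -> R * R).

(* A 2-form in the plane is automatically closed, and nondegeneracy at the
   origin extends to a neighbourhood by continuity. *)
Definition symplectic_germ w :=
  [/\ \forall p \near (0 : R * R),
        bilinear_for *%R *%R (w p) /\ (forall u, w p u u = 0),
      forall u v, analytic2 (fun p => w p u v) &
      forall u, (forall v, w 0 u v = 0) -> u = 0].

Definition dxi_dx (u v : R * R) : R := u.2 * v.1 - u.1 * v.2.

Definition pullback_fun psi H : R * R -> R := fun p => H (psi p).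

Definition pullback_form psi w : two_form :=
  fun p u v => w (psi p) ('d psi p u) ('d psi p v).

Definition pair_equiv (P Q : (R * R -> R) * two_form) :=
  exists psi, [/\ diffeo_germ psi,
    \forall p \near (0 : R * R), Q.1 p = pullback_fun psi P.1 p &
    \forall p \near (0 : R * R), forall u v,
      Q.2 p u v = pullback_form psi P.2 p u v].

(* The boolean [s] encodes the sign: xi^2 + x^k for [false], xi^2 - x^k for
   [true]. *)
Definition model (k : nat) (s : bool) : R * R -> R :=
  fun p => p.2 ^+ 2 + (-1) ^+ s * p.1 ^+ k.

(* [chi] is the system of local coordinates in which H is the model. *)
Definition A_singularity (k : nat) (s : bool) H :=
  exists chi, diffeo_germ chi /\
    \forall p \near (0 : R * R), H p = pullback_fun chi (model k s) p.

(* Of the sequence [c], only the k-1 functions c_0, ..., c_(k-2) are used. *)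
Definition normal_pair (k : nat) (s : bool) (c : nat -> R -> R) :
    (R * R -> R) * two_form :=
  (model k s,
   fun p u v => (\sum_(i < k.-1) p.1 ^+ i * c i (model k s p)) * dxi_dx u v).

Definition nf_data (k : nat) (c : nat -> R -> R) :=
  (forall i, (i < k.-1)%N -> analytic1 (c i)) /\ c 0%N 0 != 0.

Definition same_orientation (c c' : nat -> R -> R) :=
  Num.sg (c 0%N 0) = Num.sg (c' 0%N 0).

Definition flip_odd (c : nat -> R -> R) : nat -> R -> R :=
  fun i t => if odd i then - c i t else c i t.

Definition all_coefs (k : nat) : set (nat * nat) := [set q | (q.1 < k.-1)%N].

Definition agree_on (S : set (nat * nat)) (c c' : nat -> R -> R) :=
  forall q, S q -> taylor_coef (c q.1) q.2 = taylor_coef (c' q.1) q.2.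

(* The Taylor coefficients of the c_i with index (i, n) in S are invariants
   which separate the equivalence classes of normal forms inducing the same
   orientation. *)
Definition complete_invariants (k : nat) (s : bool) (S : set (nat * nat)) :=
  forall c c', nf_data k c -> nf_data k c' -> same_orientation c c' ->
    pair_equiv (normal_pair k s c) (normal_pair k s c') <-> agree_on S c c'.

End HamiltonianPairs.

(* Main.v *)
Require Import Defs.
From HB Require Import structures.
From mathcomp Require Import all_boot all_order all_algebra.
From mathcomp Require Import all_classical all_reals all_analysis.
From mathcomp Require Import ring lra zify.

(** Write [f = xi^2 + e x^k] with [e = 1] or [e = -1], and [{a, b} = a_x b_xi - a_xi b_x].
In coordinates where the Hamiltonian is [f], the symplectic form is [h dxi /\ dx] for a
density [h] with [h(0) <> 0], and a change of coordinates [(u, v)] which preserves [f],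
that is [v^2 + e u^k = f], replaces [h] by [{u, v} h(u, v)].  So one has to classify
densities under these changes.

Densities of the form [{G, f}] are infinitesimally trivial.  The germs modulo them are a
free module over the functions of [f] with basis [1, x, ..., x^(k-2)]: this is the
Brieskorn module of the singularity ([brieskorn_generated], [brieskorn_free]).  Every germ
is uniquely [a(x, f) + xi b(x, f)], and in these terms [{-, f}] sends [a] to the odd part
[2 a_x], which is onto, and [b] to the even part
[T b = 2 (y - e x^k) b_x - e k x^(k-1) b], where [y] stands for [f].  The equation
[T b = h] modulo the powers [x^0, ..., x^(k-2)] is a recursion on the coefficients of [b]
with the nonzero pivots [2 j + k], and these pivots also absorb the factors produced by
the derivative, so that convergence is preserved.

Existence.  Write [h = c_0(f) + ... + x^(k-2) c_(k-2)(f) + {G, f}].  The Hamiltonian flow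
of [f] for the area [h dxi /\ dx], followed for the time [tau(p)] depending on the
starting point [p], preserves [f] and changes the density from [h] into exactly
[h + {tau, f}] ([lie_area]).  With [tau = - G] the result is the normal form
([straighten]); the flow is constructed as a Lie series.

Uniqueness.  Let [(u, v)] preserve [f] and carry one normal form to another.  The
coordinates have weights 2 and [k], for which [f] is homogeneous; rescaling by a parameter
[l] joins [(u, v)] at [l = 1], through maps preserving [f], to its part [(u0, v0)] of
lowest weight at [l = 0].  Along this family the derivative of [u^i {u, v}] has the form
[{G, f}] ([area_exact]): it is the exterior derivative of the 1-form
[u^i (u' dv - v' du)], which is a multiple of [df] because [f] is preserved.  Hence the
pull-backs by [(u, v)] and by [(u0, v0)] have the same class in the Brieskorn module
([homotopy]).  For [k > 2] the map [(u0, v0)] is [(a x, d xi)] with [a^k = d^2 = 1], and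
for [k = 2] it is linear with Jacobian 1 or -1 while only [c_0] occurs.  Equality of
orientations excludes the sign of the Jacobian, and what remains is [x -> - x] for even
[k], which changes the signs of the [c_i] with [i] odd ([formal_unique]).  The map
[p -> - p] realises this change.

All identities are proved for formal power series in [x] with coefficients in the power
series in [xi].  Convergence is controlled by the norms [sum |a_ij| r^(i + j)], and
convergent series correspond to germs of analytic functions in such a way that products,
derivatives and compositions agree ([germ], [germ_emap], [emap_diff]). *)

Set Implicit Arguments.
Unset Strict Implicit.
Unset Printing Implicit Defensive.

Import Order.TTheory GRing.Theory Num.Theory.
Import numFieldNormedType.Exports.

Local Open Scope classical_set_scope.
Local Open Scope ring_scope.

(** * Formal power series in one variable *)

(** A record, and not the type of sequences itself, so that the ring operations found for
[nat -> K] never compete with the Cauchy product. *)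
Record ps (K : Type) := PS { cf : nat -> K }.

Lemma psP (K : Type) (a b : ps K) : (forall n, cf a n = cf b n) -> a = b.
Proof. by case: a b => [a] [b] /= /funext ->. Qed.

HB.instance Definition _ (K : Type) := gen_eqMixin (ps K).
HB.instance Definition _ (K : Type) := gen_choiceMixin (ps K).

Section PsRing.
Variable K : comNzRingType.
Implicit Types a b c : ps K.

Definition ps_add a b := PS (fun n => cf a n + cf b n).
Definition ps_opp a := PS (fun n => - cf a n).
Definition ps_zero : ps K := PS (fun=> 0).
Definition ps_one : ps K := PS (fun n => (n == 0%N)%:R).
Definition ps_mul a b := PS (fun n => \sum_(i < n.+1) cf a i * cf b (n - i)%N).

Fact ps_addA : associative ps_add.
Proof. by move=> a b c; apply: psP => n /=; rewrite addrA. Qed.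
Fact ps_addC : commutative ps_add.
Proof. by move=> a b; apply: psP => n /=; rewrite addrC. Qed.
Fact ps_add0 : left_id ps_zero ps_add.
Proof. by move=> a; apply: psP => n /=; rewrite add0r. Qed.
Fact ps_addN : left_inverse ps_zero ps_opp ps_add.
Proof. by move=> a; apply: psP => n /=; rewrite addNr. Qed.

HB.instance Definition _ :=
  GRing.isZmodule.Build (ps K) ps_addA ps_addC ps_add0 ps_addN.

(** Up to a given order the Cauchy product is the product of the truncated polynomials;
the ring axioms are inherited from polynomials in this way. *)
Let ps_mul_poly n m a b : (m <= n)%N ->
  cf (ps_mul a b) m = ((\poly_(i < n.+1) cf a i) * (\poly_(i < n.+1) cf b i))`_m.
Proof.
move=> le_mn; rewrite coefM /=; apply: eq_bigr => i _.
rewrite !coef_poly ltnS (leq_trans _ le_mn) ?leq_ord //.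
by rewrite ltnS (leq_trans _ le_mn) // leq_subr.
Qed.

Fact ps_mulC : commutative ps_mul.
Proof. by move=> a b; apply: psP => n; rewrite !(@ps_mul_poly n) // mulrC. Qed.

Fact ps_mulA : associative ps_mul.
Proof.
move=> a b c; apply: psP => n.
have tr d d' (e : {poly K}) : (forall m, (m <= n)%N -> cf d m = e`_m) ->
    cf (ps_mul d d') n = (e * \poly_(i < n.+1) cf d' i)`_n.
  move=> de; rewrite coefM /=; apply: eq_bigr => i _.
  by rewrite de ?leq_ord // coef_poly ltnS leq_subr.
rewrite ps_mulC (tr (ps_mul b c) a _ (fun m => @ps_mul_poly n m b c)).
by rewrite (tr (ps_mul a b) c _ (fun m => @ps_mul_poly n m a b)) mulrC mulrA.
Qed.

Fact ps_mul1 : left_id ps_one ps_mul.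
Proof.
move=> a; apply: psP => n /=; rewrite big_ord_recl /= mul1r subn0 big1 ?addr0 //.
by move=> i _; rewrite /= mul0r.
Qed.

Fact ps_mulDl : left_distributive ps_mul +%R.
Proof.
move=> a b c; apply: psP => n /=; rewrite -big_split /=.
by apply: eq_bigr => i _; rewrite mulrDl.
Qed.

Fact ps_1neq0 : ps_one != 0.
Proof. by apply/eqP => /(congr1 (fun a => cf a 0)) /eqP /=; rewrite oner_eq0. Qed.

HB.instance Definition _ := GRing.Zmodule_isComNzRing.Build (ps K)
  ps_mulA ps_mulC ps_mul1 ps_mulDl ps_1neq0.

Lemma cfD a b n : cf (a + b) n = cf a n + cf b n. Proof. by []. Qed.
Lemma cf0 n : cf (0 : ps K) n = 0. Proof. by []. Qed.
Lemma cf1 n : cf (1 : ps K) n = (n == 0%N)%:R. Proof. by []. Qed.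
Lemma cfM a b n : cf (a * b) n = \sum_(i < n.+1) cf a i * cf b (n - i)%N.
Proof. by []. Qed.
Lemma cfB a b n : cf (a - b) n = cf a n - cf b n. Proof. by []. Qed.
Lemma cf_sum I (r : seq I) (P : pred I) (F : I -> ps K) n :
  cf (\sum_(i <- r | P i) F i) n = \sum_(i <- r | P i) cf (F i) n.
Proof. exact: (big_morph (fun a => cf a n) (fun a b => cfD a b n) (cf0 n)). Qed.

End PsRing.
Arguments cf0 {K} n.

Section Const.
Variable K : comNzRingType.
Definition psC (c : K) : ps K := PS (fun n => if n == 0%N then c else 0).
Lemma cfC c n : cf (psC c) n = if n == 0%N then c else 0. Proof. by []. Qed.

Fact psC_nmod : nmod_morphism psC.
Proof.
split=> [|c d]; apply: psP => n; rewrite ?cfD !cfC; first by case: ifP.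
by case: ifP => // _; rewrite addr0.
Qed.
Lemma cfCM c a n : cf (psC c * a) n = c * cf a n.
Proof.
rewrite cfM big_ord_recl /= subn0 big1 ?addr0 // => i _.
by rewrite /= mul0r.
Qed.
Fact psC_monoid : monoid_morphism psC.
Proof.
split=> [|c d]; first by apply: psP => -[|n].
by apply: psP => n; rewrite cfCM !cfC; case: ifP => //; rewrite mulr0.
Qed.
HB.instance Definition _ := GRing.isNmodMorphism.Build K (ps K) psC psC_nmod.
HB.instance Definition _ := GRing.isMonoidMorphism.Build K (ps K) psC psC_monoid.

Definition psX : ps K := PS (fun n => (n == 1%N)%:R).
Lemma cfX n : cf psX n = (n == 1%N)%:R. Proof. by []. Qed.
Lemma cfXM a n : cf (psX * a) n = if n is m.+1 then cf a m else 0.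
Proof.
rewrite cfM; case: n => [|n]; first by rewrite big_ord1 cfX mul0r.
rewrite big_ord_recl cfX mul0r add0r big_ord_recl cfX mul1r /= subSS subn0.
by rewrite big1 ?addr0 // => i _; rewrite mul0r.
Qed.
Lemma cfXnM a m n : cf (psX ^+ m * a) n = if (m <= n)%N then cf a (n - m) else 0.
Proof.
elim: m n => [|m IH] n; first by rewrite expr0 mul1r subn0.
by rewrite exprS -mulrA cfXM; case: n.
Qed.
End Const.
Arguments psX {K}.

Section Deriv.

(** Derivations are plain functions with a property, since [pderiv], its coefficientwise
extensions and Hamiltonian vector fields all have to be used as derivations of the same
ring. *)
Definition is_deriv (K : comNzRingType) (d : K -> K) :=
  (forall a b, d (a + b) = d a + d b) /\
  (forall a b, d (a * b) = d a * b + a * d b).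

Section Th.
Variables (K : comNzRingType) (d : K -> K) (hd : is_deriv d).
Lemma derD a b : d (a + b) = d a + d b. Proof. exact: hd.1. Qed.
Lemma derM a b : d (a * b) = d a * b + a * d b. Proof. exact: hd.2. Qed.
Lemma der0 : d 0 = 0.
Proof. by apply: (@addrI _ (d 0)); rewrite -derD !addr0. Qed.
Lemma derN a : d (- a) = - d a.
Proof. by apply/eqP; rewrite -addr_eq0 -derD addNr der0. Qed.
Lemma derB a b : d (a - b) = d a - d b. Proof. by rewrite derD derN. Qed.
Lemma der1 : d 1 = 0.
Proof.
by apply: (@addrI _ (d 1)); rewrite addr0 -{3}(mulr1 1) derM mulr1 mul1r.
Qed.
Lemma der_sum I (r : seq I) (P : pred I) (F : I -> K) :
  d (\sum_(i <- r | P i) F i) = \sum_(i <- r | P i) d (F i).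
Proof. exact: (big_morph d derD der0). Qed.
Lemma derX a n : d (a ^+ n) = n%:R * a ^+ n.-1 * d a.
Proof.
elim: n => [|n IH]; first by rewrite expr0 der1 !mul0r.
rewrite exprS derM IH /=; case: n {IH} => [|n] /=; first by rewrite expr0; ring.
by rewrite exprS -[n.+2%:R]natr1; ring.
Qed.
End Th.

Variable K : comNzRingType.

Definition psmap (L : Type) (M : Type) (g : L -> M) (a : ps L) : ps M :=
  PS (fun n => g (cf a n)).

(** A derivation of the coefficients acts on series term by term: this gives the partial
derivative in the inner variable, and vector fields acting on series in the time. *)
Lemma psmap_deriv (d : K -> K) : is_deriv d -> is_deriv (psmap d).
Proof.
move=> hd; split=> a b; apply: psP => n /=; first by rewrite derD.
rewrite (der_sum hd) -big_split; apply: eq_bigr => i _ /=.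
by rewrite (derM hd).
Qed.

Definition pderiv (a : ps K) : ps K := PS (fun n => n.+1%:R * cf a n.+1).

Lemma pderivP : is_deriv pderiv.
Proof.
split=> a b; apply: psP => n; first by rewrite /= mulrDr.
have E : cf (pderiv (a * b)) n = \sum_(i < n.+2) i%:R * cf a i * cf b (n.+1 - i)
   + \sum_(i < n.+2) cf a i * ((n.+1 - i)%:R * cf b (n.+1 - i)).
  rewrite /= mulr_sumr -big_split; apply: eq_bigr => i _ /=.
  have le_in : (i <= n.+1)%N by rewrite leq_ord.
  rewrite -{1}(subnKC le_in) natrD; ring.
rewrite E cfD !cfM; congr (_ + _).
  rewrite big_ord_recl /= !mul0r add0r; apply: eq_bigr => i _.
  by rewrite /bump /= add1n subSS.
rewrite big_ord_recr /= subnn mul0r mulr0 addr0; apply: eq_bigr => i _.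
by rewrite -subSn ?leq_ord.
Qed.

Lemma pderivC (c : K) : pderiv (psC c) = 0.
Proof. by apply: psP => n; rewrite /= mulr0. Qed.
Lemma pderivX : pderiv psX = 1.
Proof.
apply: psP => n; rewrite cf1 /= eqSS.
by case: eqP => [->|_]; rewrite ?mulr1 ?mulr0.
Qed.
Lemma psmapC (d : K -> K) : is_deriv d -> forall c, psmap d (psC c) = psC (d c).
Proof.
by move=> hd c; apply: psP => n; rewrite /= ; case: ifP => //; rewrite (der0 hd).
Qed.
Lemma psmapX (d : K -> K) : is_deriv d -> psmap d psX = 0.
Proof.
move=> hd; apply: psP => n; rewrite /= ; case: eqP => /= _.
  by rewrite (der1 hd).
by rewrite (der0 hd).
Qed.
Lemma psmap_pderiv (d : K -> K) : is_deriv d ->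
  forall a, psmap d (pderiv a) = pderiv (psmap d a).
Proof.
move=> hd a; apply: psP => n /=; rewrite (derM hd).
suff -> : d n.+1%:R = 0 by rewrite mul0r add0r.
by elim: n => [|n IH]; rewrite ?(der1 hd) // -natr1 (derD hd) IH (der1 hd) addr0.
Qed.
End Deriv.

(** * Power series in two variables and the filtration by order *)

Lemma triangle (V : nmodType) (F : nat -> nat -> V) n :
  \sum_(l < n) \sum_(i < l.+1) F i (l - i)%N =
  \sum_(i < n) \sum_(j < n - i) F i j.
Proof.
elim: n => [|n IH]; first by rewrite !big_ord0.
rewrite big_ord_recr IH /= [in RHS]big_ord_recr /= subSnn big_ord1.
rewrite [X in _ + X]big_ord_recr /= subnn addrA -big_split /=; congr (_ + _).
by apply: eq_bigr => i _; rewrite subSn 1?ltnW // big_ord_recr.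
Qed.

(** The constants and the two variables are locked: unfolding them would let unification
compare products of series coefficient by coefficient. *)
HB.lock Definition CC (K : comNzRingType) (c : K) : ps (ps K) := psC (psC c).
Arguments CC {K} c.
HB.lock Definition vx (K : comNzRingType) : ps (ps K) := psX.
HB.lock Definition vy (K : comNzRingType) : ps (ps K) := psC psX.
Arguments vx {K}.
Arguments vy {K}.

Section Filtration.
Variable K : comNzRingType.
Local Notation A := (ps (ps K)).
Implicit Types a b u v w : A.

(** The first index is the power of [x], the second the power of [xi]. *)
Definition cf2 a i j : K := cf (cf a i) j.
Lemma CCE (c : K) : CC c = psC (psC c). Proof. by rewrite CC.unlock. Qed.
Lemma vxE : vx = psX :> A. Proof. by rewrite vx.unlock. Qed.
Lemma vyE : vy = psC psX :> A. Proof. by rewrite vy.unlock. Qed.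
Definition dx : A -> A := @pderiv _.
Definition dy : A -> A := psmap (@pderiv _).
(** The Poisson bracket; [pb u v] is also the Jacobian determinant of the map [(u, v)]. *)
Definition pb a b := dx a * dy b - dy a * dx b.

Lemma cf2P a b : (forall i j, cf2 a i j = cf2 b i j) -> a = b.
Proof. by move=> h; apply: psP => i; apply: psP => j; apply: h. Qed.
Lemma cf2D a b i j : cf2 (a + b) i j = cf2 a i j + cf2 b i j. Proof. by []. Qed.
Lemma cf2N a i j : cf2 (- a) i j = - cf2 a i j. Proof. by []. Qed.
Lemma cf2B a b i j : cf2 (a - b) i j = cf2 a i j - cf2 b i j. Proof. by []. Qed.
Lemma cf20 i j : cf2 0 i j = 0. Proof. by []. Qed.
Lemma cf2_sum I (r : seq I) (P : pred I) (F : I -> A) i j :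
  cf2 (\sum_(k <- r | P k) F k) i j = \sum_(k <- r | P k) cf2 (F k) i j.
Proof.
exact: (big_morph (fun a => cf2 a i j) (fun a b => cf2D a b i j) (cf20 i j)).
Qed.
Lemma cf2M a b p q : cf2 (a * b) p q =
  \sum_(i < p.+1) \sum_(j < q.+1) cf2 a i j * cf2 b (p - i)%N (q - j)%N.
Proof. by rewrite /cf2 cfM cf_sum. Qed.
Lemma cf2CM c a i j : cf2 (CC c * a) i j = c * cf2 a i j.
Proof. by rewrite CCE /cf2 !cfCM. Qed.
Lemma cf2_CC c i j : cf2 (CC c) i j = if (i + j == 0)%N then c else 0.
Proof. by rewrite CCE /cf2 cfC; case: i. Qed.
Lemma cf2_1 i j : cf2 1 i j = ((i == 0%N) && (j == 0%N))%:R.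
Proof. by rewrite /cf2 cf1; case: i. Qed.
Lemma CC_nmod : nmod_morphism (@CC K).
Proof. by split=> [|c d]; rewrite !CCE ?raddf0 ?raddfD. Qed.
Lemma CC_monoid : monoid_morphism (@CC K).
Proof. by split=> [|c d]; rewrite !CCE ?rmorph1 ?rmorphM. Qed.
HB.instance Definition _ := GRing.isNmodMorphism.Build K A (@CC K) CC_nmod.
HB.instance Definition _ := GRing.isMonoidMorphism.Build K A (@CC K) CC_monoid.
Lemma CCM (c d : K) : CC (c * d) = CC c * CC d. Proof. exact: rmorphM. Qed.
Lemma CCD (c d : K) : CC (c + d) = CC c + CC d. Proof. exact: rmorphD. Qed.
Lemma CCN (c : K) : CC (- c) = - CC c. Proof. exact: rmorphN. Qed.
Lemma CCX (c : K) n : CC (c ^+ n) = CC c ^+ n. Proof. exact: rmorphXn. Qed.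
Lemma CCn n : CC n%:R = n%:R :> A. Proof. exact: rmorph_nat. Qed.
Lemma CC1 : CC 1 = 1 :> A. Proof. exact: rmorph1. Qed.
Lemma CC0 : CC 0 = 0 :> A. Proof. exact: rmorph0. Qed.

Lemma cf2_vxM a i j : cf2 (vx * a) i j = if i is k.+1 then cf2 a k j else 0.
Proof. by rewrite vxE /cf2 cfXM; case: i. Qed.
Lemma cf2_vyM a i j : cf2 (vy * a) i j = if j is k.+1 then cf2 a i k else 0.
Proof. by rewrite vyE /cf2 cfCM cfXM. Qed.
Lemma cf2_vxXM m a i j :
  cf2 (vx ^+ m * a) i j = if (m <= i)%N then cf2 a (i - m) j else 0.
Proof. by rewrite vxE /cf2 cfXnM; case: ifP. Qed.
Lemma cf2_vyXM m a i j :
  cf2 (vy ^+ m * a) i j = if (m <= j)%N then cf2 a i (j - m) else 0.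
Proof. by rewrite vyE /cf2 -rmorphXn cfCM cfXnM. Qed.
Lemma cf2_mon c m n i j :
  cf2 (CC c * vx ^+ m * vy ^+ n) i j = if (i == m) && (j == n) then c else 0.
Proof.
rewrite -mulrA cf2CM cf2_vxXM -[vy ^+ n]mulr1.
case: leqP => [le_mi|lt_im]; last first.
  by rewrite mulr0 (ltn_eqF lt_im).
rewrite cf2_vyXM; case: leqP => [le_nj|lt_jn]; last first.
  by rewrite mulr0 (ltn_eqF lt_jn) andbF.
rewrite cf2_1 !subn_eq0 [i == m]eqn_leq [j == n]eqn_leq le_mi le_nj !andbT.
by case: ifP; rewrite ?mulr1 ?mulr0.
Qed.
Lemma cf2_vx i j : cf2 vx i j = ((i == 1%N) && (j == 0%N))%:R.
Proof.
have := cf2_mon 1 1 0 i j; rewrite rmorph1 mul1r expr0 mulr1 expr1 => ->.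
by case: ifP.
Qed.
Lemma cf2_vy i j : cf2 vy i j = ((i == 0%N) && (j == 1%N))%:R.
Proof.
have := cf2_mon 1 0 1 i j; rewrite rmorph1 mul1r expr0 mul1r expr1 => ->.
by case: ifP.
Qed.
Lemma cf2_dx a i j : cf2 (dx a) i j = i.+1%:R * cf2 a i.+1 j.
Proof.
have h m (b : ps K) : cf (m%:R * b) j = m%:R * cf b j.
  elim: m => [|m IH]; first by rewrite !mulr0n !mul0r.
  by rewrite -!natr1 !mulrDl cfD IH !mul1r.
exact: h.
Qed.
Lemma cf2_dy a i j : cf2 (dy a) i j = j.+1%:R * cf2 a i j.+1.
Proof. by []. Qed.
Lemma dxP : is_deriv dx. Proof. exact: pderivP. Qed.
Lemma dyP : is_deriv dy. Proof. exact: psmap_deriv (@pderivP _). Qed.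
Lemma dxvx : dx vx = 1. Proof. by rewrite vxE; exact: pderivX. Qed.
Lemma dyvx : dy vx = 0. Proof. by rewrite vxE; exact: psmapX (@pderivP _). Qed.
Lemma dxvy : dx vy = 0. Proof. by rewrite vyE; exact: pderivC. Qed.
Lemma dyvy : dy vy = 1.
Proof. by rewrite vyE /dy (psmapC (@pderivP _)) pderivX rmorph1. Qed.
Lemma dxC c : dx (CC c) = 0. Proof. by rewrite CCE; exact: pderivC. Qed.
Lemma dyC c : dy (CC c) = 0.
Proof. by rewrite CCE /dy (psmapC (@pderivP _)) pderivC raddf0. Qed.
Lemma dydx a : dy (dx a) = dx (dy a).
Proof. exact: psmap_pderiv (@pderivP _) _. Qed.

Lemma pbBl a b c : pb (a - b) c = pb a c - pb b c.
Proof. by rewrite /pb (derB dxP a b) (derB dyP a b); ring. Qed.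

(** The powers of the maximal ideal.  Membership is a record so that it stays opaque for
unification. *)
Record ord n a : Prop := Ord { ordE : forall i j, (i + j < n)%N -> cf2 a i j = 0 }.

Lemma ord_triv a : ord 0 a. Proof. by split. Qed.
Lemma ordz n : ord n 0. Proof. by split. Qed.
Lemma ord_le m n a : (m <= n)%N -> ord n a -> ord m a.
Proof. by move=> le h; split=> i j lt; apply: (ordE h); apply: leq_trans lt le. Qed.
Lemma ordD n a b : ord n a -> ord n b -> ord n (a + b).
Proof. by move=> ha hb; split=> i j lt; rewrite cf2D (ordE ha) // (ordE hb) // addr0. Qed.
Lemma ordN n a : ord n a -> ord n (- a).
Proof. by move=> ha; split=> i j lt; rewrite cf2N (ordE ha) // oppr0. Qed.
Lemma ordB n a b : ord n a -> ord n b -> ord n (a - b).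
Proof. by move=> ha hb; apply: ordD => //; apply: ordN. Qed.
Lemma ord_sum n I (r : seq I) (P : pred I) (F : I -> A) :
  (forall i, P i -> ord n (F i)) -> ord n (\sum_(i <- r | P i) F i).
Proof. by move=> h; apply: big_ind => [|b c|//]; [exact: ordz | exact: ordD]. Qed.
Lemma ordM m n a b : ord m a -> ord n b -> ord (m + n) (a * b).
Proof.
move=> ha hb; split=> p q lt; rewrite cf2M big1 // => i _; rewrite big1 // => j _.
have [ij|ij] := ltnP (i + j) m; first by rewrite (ordE ha) // mul0r.
rewrite (ordE hb) ?mulr0 //; move: (ltn_ord i) (ltn_ord j); lia.
Qed.
Lemma ordMl n a b : ord n b -> ord n (a * b).
Proof. by move=> hb; rewrite -(add0n n); apply: ordM. Qed.
Lemma ordMr n a b : ord n a -> ord n (a * b).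
Proof. by move=> hb; rewrite mulrC; apply: ordMl. Qed.
Lemma ordX m a : ord 1 a -> ord m (a ^+ m).
Proof.
move=> ha; elim: m => [|m IH]; [exact: ord_triv|]; rewrite exprS -add1n; exact: ordM.
Qed.
Lemma ord_dx n a : ord n.+1 a -> ord n (dx a).
Proof. by move=> ha; split=> i j lt; rewrite cf2_dx (ordE ha) ?mulr0 // addSn. Qed.
Lemma ord_dy n a : ord n.+1 a -> ord n (dy a).
Proof. by move=> ha; split=> i j lt; rewrite cf2_dy (ordE ha) ?mulr0 // addnS. Qed.
(** The filtration is separated, which reduces identities between infinite sums to
congruences between finite ones. *)
Lemma ord_inj a b : (forall n, ord n (a - b)) -> a = b.
Proof.
move=> h; apply: cf2P => i j; apply/eqP; rewrite -subr_eq0 -cf2B.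
by rewrite (ordE (h (i + j).+1)).
Qed.
Lemma ord_vx : ord 1 vx.
Proof. by rewrite vxE; split=> [[|i] [|j]]. Qed.
Lemma ord_vy : ord 1 vy.
Proof. by rewrite vyE; split=> [[|i] [|j]]. Qed.
Lemma ord1P a : cf2 a 0 0 = 0 -> ord 1 a.
Proof. by move=> h; split=> [[|i] [|j]]. Qed.

Definition eqm n a b := ord n (a - b).
Lemma eqm_refl n a : eqm n a a. Proof. by rewrite /eqm subrr; apply: ordz. Qed.
Lemma eqm_sym n a b : eqm n a b -> eqm n b a.
Proof. by move=> /ordN; rewrite opprB. Qed.
Lemma eqm_trans n a b c : eqm n a b -> eqm n b c -> eqm n a c.
Proof. by move=> h1 h2; rewrite /eqm -(subrKA b); apply: ordD. Qed.
Lemma eqmD n a b c d : eqm n a b -> eqm n c d -> eqm n (a + c) (b + d).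
Proof. by move=> h1 h2; rewrite /eqm opprD addrACA; apply: ordD. Qed.
Lemma eqmN n a b : eqm n a b -> eqm n (- a) (- b).
Proof. by move=> h; rewrite /eqm -opprD; apply: ordN. Qed.
Lemma eqmM n a b c d : eqm n a b -> eqm n c d -> eqm n (a * c) (b * d).
Proof.
move=> h1 h2; rewrite /eqm (_ : _ - _ = (a - b) * c + b * (c - d)); last by ring.
by apply: ordD; [apply: ordMr | apply: ordMl].
Qed.
Lemma eqm_le m n a b : (m <= n)%N -> eqm n a b -> eqm m a b.
Proof. by move=> le; apply: ord_le. Qed.
Lemma eqm_sum n I (r : seq I) (P : pred I) (F G : I -> A) :
  (forall i, P i -> eqm n (F i) (G i)) ->
  eqm n (\sum_(i <- r | P i) F i) (\sum_(i <- r | P i) G i).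
Proof. by move=> h; rewrite /eqm -sumrB; apply: ord_sum. Qed.
Lemma eqm_inj a b : (forall n, eqm n a b) -> a = b.
Proof. exact: ord_inj. Qed.
Lemma eqm_ord n a : eqm n a 0 <-> ord n a.
Proof. by rewrite /eqm subr0. Qed.

(** A congruence between elements of the maximal ideal improves by one order with each
additional factor; this is what makes the iteration for the inverse map contract. *)
Lemma eqmX n m u v : ord 1 u -> ord 1 v -> eqm n u v ->
  eqm (n + m) (u ^+ m.+1) (v ^+ m.+1).
Proof.
move=> hu hv huv; rewrite /eqm subrXX; apply: ordM => //.
apply: ord_sum => i _ /=; apply: (@ord_le m (m - i + i)).
  by rewrite subnK ?leq_ord.
by apply: ordM; apply: ordX.
Qed.
End Filtration.

(** * Substitution of power series *)

(** Ring homomorphisms as a property, since the maps in question arise as substitutions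
with hypotheses on their arguments. *)
Definition is_rhom (L M : pzRingType) (g : L -> M) :=
  [/\ {morph g : a b / a + b}, {morph g : a b / a * b} & g 1 = 1].

Section Rhom.
Variables (L M : pzRingType) (g : L -> M) (hg : is_rhom g).
Lemma rhD a b : g (a + b) = g a + g b. Proof. by case: hg. Qed.
Lemma rhM a b : g (a * b) = g a * g b. Proof. by case: hg. Qed.
Lemma rh1 : g 1 = 1. Proof. by case: hg. Qed.
Lemma rh0 : g 0 = 0.
Proof. by apply: (@addrI _ (g 0)); rewrite -rhD !addr0. Qed.
Lemma rhN a : g (- a) = - g a.
Proof. by apply/eqP; rewrite -addr_eq0 -rhD addNr rh0. Qed.
Lemma rhB a b : g (a - b) = g a - g b. Proof. by rewrite rhD rhN. Qed.
Lemma rhX a n : g (a ^+ n) = g a ^+ n.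
Proof. by elim: n => [|n IH]; rewrite ?expr0 ?rh1 // !exprS rhM IH. Qed.
Lemma rhn n : g n%:R = n%:R.
Proof. by elim: n => [|n IH]; rewrite ?mulr0n ?rh0 // -!natr1 rhD IH rh1. Qed.
Lemma rh_sum I (r : seq I) (P : pred I) (F : I -> L) :
  g (\sum_(i <- r | P i) F i) = \sum_(i <- r | P i) g (F i).
Proof. exact: (big_morph g rhD rh0). Qed.
End Rhom.

Lemma rmorph_rhom (L M : pzRingType) (g : {rmorphism L -> M}) : is_rhom g.
Proof. by split=> [a b|a b|]; rewrite ?rmorphD ?rmorphM ?rmorph1. Qed.

(** [psubst g v a] is the sum of the [g (a_l) v^l].  When [v] has no constant term, the
coefficient of bidegree [(i, j)] only depends on the terms with [l <= i + j]. *)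
HB.lock Definition psubst (K : comNzRingType) (L : Type) (g : L -> ps (ps K))
    (v : ps (ps K)) (a : ps L) : ps (ps K) :=
  PS (fun i => PS (fun j => \sum_(l < (i + j).+1) cf2 (g (cf a l) * v ^+ l) i j)).
Arguments psubst {K L} g v a.

Section Subst.
Variable K : comNzRingType.
Local Notation A := (ps (ps K)).

Section Psubst.
Variables (L : Type) (g : L -> A) (v : A) (hv : ord 1 v).

Lemma psubst_coef a n i j : (i + j < n)%N ->
  cf2 (psubst g v a) i j = \sum_(l < n) cf2 (g (cf a l) * v ^+ l) i j.
Proof.
move=> lt; transitivity (\sum_(l < (i + j).+1) cf2 (g (cf a l) * v ^+ l) i j).
  by rewrite psubst.unlock.
rewrite (big_ord_widen n (fun l => cf2 (g (cf a l) * v ^+ l) i j)) //.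
rewrite big_mkcond /=; apply: eq_bigr => l _; case: leqP => // lt_l.
by rewrite (ordE (ordMl _ (ordX l hv))).
Qed.

Lemma psubst_mod a n : eqm n (psubst g v a) (\sum_(l < n) g (cf a l) * v ^+ l).
Proof.
by split=> i j lt; rewrite cf2B cf2_sum (psubst_coef a lt) subrr.
Qed.

Lemma psubstP a b :
  (forall n, eqm n b (\sum_(l < n) g (cf a l) * v ^+ l)) -> psubst g v a = b.
Proof.
move=> h; apply: eqm_inj => n; apply: eqm_trans (psubst_mod a n) _.
exact: eqm_sym.
Qed.

Lemma psubst_ord n a : (forall l, ord n (g (cf a l))) -> ord n (psubst g v a).
Proof.
move=> h; split=> i j lt; rewrite (psubst_coef _ lt) big1 // => l _.
by rewrite (ordE (ordMr _ (h l))).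
Qed.
End Psubst.

Lemma psubst_psmap (L M : Type) (h : L -> M) (g : M -> A) v a :
  psubst g v (psmap h a) = psubst (g \o h) v a.
Proof. by rewrite psubst.unlock. Qed.

Lemma psubstZ (L : Type) (g : L -> A) v w a : ord 1 v ->
  psubst (fun c => w * g c) v a = w * psubst g v a.
Proof.
move=> hv; apply: psubstP => // n.
rewrite -(eq_bigr _ (fun i _ => mulrA _ _ _)) -mulr_sumr.
by apply: eqmM; [apply: eqm_refl | apply: psubst_mod].
Qed.

Section PsubstHom.
Variables (L : comNzRingType) (g : L -> A) (v : A) (hv : ord 1 v).
Hypothesis hg : is_rhom g.

Lemma psubst_C c : psubst g v (psC c) = g c.
Proof.
apply: psubstP => // -[|n]; first by rewrite big_ord0; split.
rewrite big_ord_recl expr0 mulr1 big1 ?addr0; first exact: eqm_refl.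
by move=> i _; rewrite cfC /= (rh0 hg) mul0r.
Qed.

Lemma psubst_X : psubst g v psX = v.
Proof.
apply: psubstP => // -[|[|n]]; first by rewrite big_ord0; split.
  rewrite big_ord1 cfX (rh0 hg) mul0r; exact/eqm_ord.
rewrite !big_ord_recl !cfX (rh0 hg) (rh1 hg) mul0r add0r mul1r expr1.
rewrite big1 ?addr0; first exact: eqm_refl.
by move=> i _; rewrite mul0r.
Qed.

(** Modulo order [n] both sides are finite sums; they differ by the terms [i + j >= n] of
the product, which have order at least [n]. *)
Lemma psubst_hom : is_rhom (psubst g v).
Proof.
split=> [a b|a b|]; last by rewrite -(rmorph1 (@psC L)) psubst_C (rh1 hg).
  apply: psubstP => // n; apply: eqm_trans.
    by apply: eqmD; apply: psubst_mod.
  rewrite -big_split /= -(eq_bigr _ (fun i _ => mulrDl _ _ _)).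
  under eq_bigr do rewrite -(rhD hg).
  exact: eqm_refl.
apply: psubstP => // n; apply: eqm_trans.
  by apply: eqmM; apply: psubst_mod.
set F := fun i j => g (cf a i) * g (cf b j) * v ^+ (i + j).
have -> : (\sum_(l < n) g (cf a l) * v ^+ l) * (\sum_(l < n) g (cf b l) * v ^+ l)
        = \sum_(i < n) \sum_(j < n) F i j.
  rewrite mulr_suml; apply: eq_bigr => i _; rewrite mulr_sumr.
  by apply: eq_bigr => j _; rewrite /F exprD; ring.
have -> : \sum_(l < n) g (cf (a * b) l) * v ^+ l =
          \sum_(i < n) \sum_(j < n - i) F i j.
  rewrite -triangle; apply: eq_bigr => l _.
  rewrite cfM (rh_sum hg) mulr_suml; apply: eq_bigr => i _.
  by rewrite (rhM hg) /F subnKC // leq_ord.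
apply: eqm_sum => i _.
rewrite (@big_ord_widen _ _ _ (n - i) n (fun j => F i j)) ?leq_subr //.
rewrite [X in eqm _ _ X]big_mkcond.
apply: eqm_sum => j _; case: ltnP => [_|le]; first exact: eqm_refl.
apply/eqm_ord/ordMl; apply: (@ord_le _ _ (i + j)); last exact: ordX.
by move: le (ltn_ord i); lia.
Qed.
End PsubstHom.

(** Continuity for the filtration, in the form in which derivations have it. *)
Definition lowers (D : A -> A) := forall n a, ord n.+1 a -> ord n (D a).

(** The chain rule, separated into the contribution of the coefficients and that of the
substituted series; the second is used both for partial derivatives and for Lie series
evaluated at a time depending on the point. *)
Lemma psubst_der (L : comNzRingType) (g : L -> A) v (D : A -> A) a :
  ord 1 v -> {morph g : a b / a + b} -> is_deriv D -> lowers D ->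
  D (psubst g v a) = psubst (D \o g) v a + D v * psubst g v (pderiv a).
Proof.
move=> hv gD hD lD; apply: eqm_inj => n.
have g0 : g 0 = 0 by apply: (@addrI _ (g 0)); rewrite -gD !addr0.
have gn m c : g (m%:R * c) = m%:R * g c.
  elim: m => [|m IH]; first by rewrite !mulr0n !mul0r g0.
  by rewrite -!natr1 !mulrDl gD IH !mul1r.
have h1 : eqm n (D (psubst g v a)) (D (\sum_(l < n.+1) g (cf a l) * v ^+ l)).
  by rewrite /eqm -(derB hD); apply: lD; apply: psubst_mod.
apply: eqm_trans h1 _; rewrite (der_sum hD).
under eq_bigr do rewrite (derM hD).
rewrite big_split /=; apply: eqmD.
  apply/eqm_sym/(eqm_trans (psubst_mod _ hv _ _)); rewrite big_ord_recr /=.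
  rewrite -{1}[\sum_(l < n) _]addr0; apply: eqmD; first exact: eqm_refl.
  by apply/eqm_sym/eqm_ord/ordMl/ordX.
apply/eqm_sym/(eqm_trans (eqmM (eqm_refl _ _) (psubst_mod _ hv _ _))).
rewrite big_ord_recl expr0 (der1 hD) mulr0 add0r mulr_sumr.
apply: eqm_sum => l _; rewrite (derX hD) /= gn /bump /= add1n.
rewrite [X in eqm _ X _](_ : _ = g (cf a l.+1) * (l.+1%:R * v ^+ l * D v)) //;
  [exact: eqm_refl | by ring].
Qed.

(** Composition with the map [(u, v)]: the inner variable is replaced by [v] in the
coefficients, then the outer one by [u]. *)
Definition subst2 (u v : A) (a : A) : A := psubst (psubst (@CC K) v) u a.

Section Comp.
Variables (u v : A) (hu : ord 1 u) (hv : ord 1 v).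
Implicit Types a b : A.

Lemma CC_rhom : is_rhom (@CC K). Proof. exact: rmorph_rhom. Qed.
Lemma subst2_hom : is_rhom (subst2 u v).
Proof. by apply: psubst_hom => //; apply: psubst_hom => //; apply: CC_rhom. Qed.
Lemma subst2_CC c : subst2 u v (CC c) = CC c.
Proof.
have h := psubst_hom hv CC_rhom.
by rewrite /subst2 {1}CCE (psubst_C hu h) (psubst_C hv CC_rhom).
Qed.
Lemma subst2_vx : subst2 u v vx = u.
Proof. by rewrite vxE; exact: psubst_X hu (psubst_hom hv CC_rhom). Qed.
Lemma subst2_vy : subst2 u v vy = v.
Proof.
have h := psubst_hom hv CC_rhom.
by rewrite /subst2 vyE (psubst_C hu h) (psubst_X hv CC_rhom).
Qed.

Lemma subst2_mon c i j :
  subst2 u v (CC c * vx ^+ i * vy ^+ j) = CC c * u ^+ i * v ^+ j.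
Proof.
have hs := subst2_hom.
by rewrite (rhM hs (CC c * vx ^+ i)) (rhM hs (CC c)) (rhX hs vx) (rhX hs vy)
  subst2_CC subst2_vx subst2_vy.
Qed.

Lemma subst2_mod n a : eqm n (subst2 u v a)
  (\sum_(i < n) \sum_(j < n) CC (cf2 a i j) * u ^+ i * v ^+ j).
Proof.
apply: eqm_trans (psubst_mod _ hu _ _) _; apply: eqm_sum => i _.
rewrite (eq_bigr (fun j : 'I_n => CC (cf2 a i j) * v ^+ j * u ^+ i)); last first.
  by move=> j _; rewrite mulrAC.
rewrite -mulr_suml; apply: eqmM; last exact: eqm_refl.
exact: psubst_mod.
Qed.

Lemma subst2_coef n a p q : (p + q < n)%N -> cf2 (subst2 u v a) p q =
  \sum_(i < n) \sum_(j < n) cf2 a i j * cf2 (u ^+ i * v ^+ j) p q.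
Proof.
move=> lt; have := ordE (subst2_mod _ a) lt; rewrite cf2B => /eqP; rewrite subr_eq0.
move=> /eqP ->; rewrite cf2_sum; apply: eq_bigr => i _; rewrite cf2_sum.
by apply: eq_bigr => j _; rewrite -mulrA cf2CM.
Qed.

Lemma subst2_ord n a : ord n a -> ord n (subst2 u v a).
Proof.
move=> ha; apply/eqm_ord/(eqm_trans (subst2_mod n a))/eqm_ord.
apply: ord_sum => i _; apply: ord_sum => j _.
have [lt|le] := ltnP (i + j) n.
  by rewrite (ordE ha) // rmorph0 !mul0r.
rewrite -mulrA; apply/ordMl/(ord_le le); apply: ordM; exact: ordX.
Qed.

Lemma subst2_der (D : A -> A) a : is_deriv D -> lowers D ->
  (forall c, D (CC c) = 0) ->
  D (subst2 u v a) = subst2 u v (dx a) * D u + subst2 u v (dy a) * D v.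
Proof.
move=> hD lD DC.
have h := psubst_hom hv CC_rhom.
rewrite /subst2 (psubst_der _ hu _ hD lD); last by case: h.
rewrite addrC [D u * _]mulrC; congr (_ + _).
rewrite mulrC /dy psubst_psmap -psubstZ //.
congr (psubst _ u a); apply/funext => b /=.
rewrite (psubst_der _ hv _ hD lD); last by case: CC_rhom.
rewrite [X in X + _](_ : _ = 0) ?add0r //; apply: psubstP => // n.
by rewrite big1 => [|k _]; [exact: eqm_refl | rewrite /= DC mul0r].
Qed.
End Comp.

Lemma mon_mod n (a : A) : eqm n a
  (\sum_(i < n) \sum_(j < n) CC (cf2 a i j) * vx ^+ i * vy ^+ j).
Proof.
split=> p q lt; rewrite cf2B cf2_sum; apply/eqP; rewrite subr_eq0; apply/eqP.
have hp : (p < n)%N by apply: leq_ltn_trans lt; apply: leq_addr.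
have hq : (q < n)%N by apply: leq_ltn_trans lt; apply: leq_addl.
rewrite (bigD1 (Ordinal hp)) //= cf2_sum (bigD1 (Ordinal hq)) //= cf2_mon !eqxx.
rewrite big1 ?addr0; last first.
  move=> j /eqP hj; rewrite cf2_mon; case: eqP => //= _; case: eqP => // E.
  by case: hj; apply: val_inj.
rewrite big1 ?addr0 // => i /eqP hi.
rewrite cf2_sum big1 // => j _; rewrite cf2_mon; case: eqP => //= E.
by case: hi; apply: val_inj.
Qed.

(** A homomorphism that respects the filtration is determined by its values on the two
variables; both the associativity of composition and the fact that a Lie series is a
change of variables follow from this. *)
Lemma hom_subst2 (th : A -> A) : is_rhom th -> (forall c, th (CC c) = CC c) ->
  (forall n a, ord n a -> ord n (th a)) ->
  forall a, th a = subst2 (th vx) (th vy) a.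
Proof.
move=> h hC ho a.
have hx : ord 1 (th vx) := ho _ _ (@ord_vx K).
have hy : ord 1 (th vy) := ho _ _ (@ord_vy K).
apply: eqm_inj => n; apply/eqm_sym/(eqm_trans (subst2_mod hx hy n a))/eqm_sym.
have : eqm n (th a)
    (th (\sum_(i < n) \sum_(j < n) CC (cf2 a i j) * vx ^+ i * vy ^+ j)).
  by rewrite /eqm -(rhB h); apply: ho; apply: mon_mod.
move=> /eqm_trans; apply.
rewrite (rh_sum h); under eq_bigr => i _ do rewrite (rh_sum h).
under eq_bigr => i _ do under eq_bigr => j _ do rewrite !(rhM h) hC !(rhX h).
exact: eqm_refl.
Qed.

Lemma subst2_id a : subst2 vx vy a = a.
Proof.
rewrite -(@hom_subst2 id) //; by split.
Qed.

Lemma subst2_comp u v u' v' a : ord 1 u -> ord 1 v -> ord 1 u' -> ord 1 v' ->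
  subst2 u' v' (subst2 u v a) = subst2 (subst2 u' v' u) (subst2 u' v' v) a.
Proof.
move=> hu hv hu' hv'.
have h := subst2_hom hu hv; have h' := subst2_hom hu' hv'.
rewrite (@hom_subst2 (fun a => subst2 u' v' (subst2 u v a))).
- by rewrite subst2_vx ?subst2_vy.
- by split=> [b c|b c|]; rewrite ?(rhD h) ?(rhD h') ?(rhM h) ?(rhM h') ?(rh1 h) ?(rh1 h').
- by move=> c; rewrite !subst2_CC.
- by move=> n b hb; do 2!apply: subst2_ord => //.
Qed.

(** The error committed on the map is improved by the order of the series in which it is
substituted. *)
Lemma subst2_eqm n m u v u' v' a : ord 1 u -> ord 1 v -> ord 1 u' -> ord 1 v' ->
  eqm n u u' -> eqm n v v' -> ord m.+1 a -> (0 < n)%N ->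
  eqm (n + m) (subst2 u v a) (subst2 u' v' a).
Proof.
move=> hu hv hu' hv' eu ev ha n_gt0.
apply: eqm_trans (subst2_mod hu hv _ _) _.
apply/eqm_sym/(eqm_trans (subst2_mod hu' hv' _ _))/eqm_sym.
apply: eqm_sum => i _; apply: eqm_sum => j _.
have [lt|le] := ltnP (i + j) m.+1.
  by rewrite (ordE ha) // rmorph0 !mul0r; exact: eqm_refl.
rewrite /eqm (_ : _ - _ = CC (cf2 a i j) * ((u ^+ i - u' ^+ i) * v ^+ j +
   u' ^+ i * (v ^+ j - v' ^+ j))); last by ring.
apply: ordMl; apply: ordD.
  case: (nat_of_ord i) le => [|p] le; first by rewrite subrr mul0r; apply: ordz.
  apply: (@ord_le _ _ ((n + p) + j)); first by move: le; lia.
  by apply: ordM; [apply: eqmX | apply: ordX].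
case: (nat_of_ord j) le => [|p] le; first by rewrite subrr mulr0; apply: ordz.
apply: (@ord_le _ _ (i + (n + p))); first by move: le; lia.
by apply: ordM; [apply: ordX | apply: eqmX].
Qed.
End Subst.

(** * Weighted norms and convergence *)

Section SemiNorm.
Variable R : realType.

(** Submultiplicativity passes from the coefficients to weighted partial sums of power
series, hence by two steps from the absolute value to series in two variables. *)
Definition is_snorm (K : comNzRingType) (nu : K -> R) :=
  [/\ forall a, 0 <= nu a, nu 0 = 0, forall a b, nu (a + b) <= nu a + nu b &
      forall a b, nu (a * b) <= nu a * nu b].

Definition wsum (K : comNzRingType) (nu : K -> R) (r : R) n (a : ps K) : R :=
  \sum_(i < n) nu (cf a i) * r ^+ i.

Lemma snorm_sum (K : comNzRingType) (nu : K -> R) : is_snorm nu ->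
  forall I (s : seq I) (P : pred I) (F : I -> K),
  nu (\sum_(i <- s | P i) F i) <= \sum_(i <- s | P i) nu (F i).
Proof.
move=> [h0 hz hD hM] I s P F.
elim/big_rec2: _ => [|i y x _ le]; first by rewrite hz.
by apply: le_trans (hD _ _) _; rewrite lerD2l.
Qed.

Lemma wsum_snorm (K : comNzRingType) (nu : K -> R) r n : 0 <= r ->
  is_snorm nu -> is_snorm (wsum nu r n).
Proof.
move=> r0 hnu; have [h0 hz hD hM] := hnu; split.
- by move=> a; apply: sumr_ge0 => i _; rewrite mulr_ge0 ?exprn_ge0.
- by rewrite /wsum big1 // => i _; rewrite cf0 hz mul0r.
- move=> a b; rewrite -big_split /=; apply: ler_sum => i _.
  by rewrite -mulrDl ler_wpM2r ?exprn_ge0 ?hD.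
move=> a b.
pose F i j := nu (cf a i) * r ^+ i * (nu (cf b j) * r ^+ j).
have F0 i j : 0 <= F i j by rewrite !mulr_ge0 ?exprn_ge0.
apply: (@le_trans _ _ (\sum_(l < n) \sum_(i < l.+1) F i (l - i)%N)).
  apply: ler_sum => l _; rewrite cfM.
  apply: (@le_trans _ _ ((\sum_(i < l.+1) nu (cf a i * cf b (l - i))) * r ^+ l)).
    by rewrite ler_wpM2r ?exprn_ge0 // snorm_sum.
  rewrite mulr_suml; apply: ler_sum => i _.
  have -> : F i (l - i)%N = nu (cf a i) * nu (cf b (l - i)) * r ^+ l.
    have -> : r ^+ l = r ^+ i * r ^+ (l - i) by rewrite -exprD subnKC ?leq_ord.
    by rewrite /F; ring.
  by rewrite ler_wpM2r ?exprn_ge0 ?hM.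
rewrite triangle mulr_suml; apply: ler_sum => i _; rewrite mulr_sumr.
rewrite (@big_ord_widen _ _ _ (n - i) n (fun j => F i j)) ?leq_subr //.
rewrite big_mkcond; apply: ler_sum => j _; case: ifP => // _; exact: F0.
Qed.

Lemma normr_snorm : is_snorm (fun x : R => `|x|).
Proof.
split=> [a||a b|a b]; rewrite ?normr0 ?normr_ge0 //; first exact: ler_normD.
by rewrite normrM.
Qed.

Local Notation A := (ps (ps R)).
Implicit Types (a b u v : A) (r M : R).

(** Partial sums suffice: a bound on all of them expresses absolute convergence without
mentioning limits. *)
Definition mass r n a : R := \sum_(i < n) \sum_(j < n) `|cf2 a i j| * r ^+ (i + j).

Lemma mass_wsum r n a : mass r n a = wsum (wsum (fun x : R => `|x|) r n) r n a.
Proof.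
apply: eq_bigr => i _; rewrite mulr_suml; apply: eq_bigr => j _.
by rewrite exprD /cf2; ring.
Qed.

Lemma mass_snorm r n : 0 <= r -> is_snorm (mass r n).
Proof.
move=> r0; rewrite (_ : mass r n = wsum (wsum (fun x : R => `|x|) r n) r n).
  by do 2!apply: wsum_snorm => //; exact: normr_snorm.
by apply/funext => a; exact: mass_wsum.
Qed.

Lemma mass_ge0 r n a : 0 <= r -> 0 <= mass r n a.
Proof. by move=> r0; have [] := @mass_snorm r n r0. Qed.
Lemma massD r n a b : 0 <= r -> mass r n (a + b) <= mass r n a + mass r n b.
Proof. by move=> r0; have [] := @mass_snorm r n r0. Qed.
Lemma massM r n a b : 0 <= r -> mass r n (a * b) <= mass r n a * mass r n b.
Proof. by move=> r0; have [] := @mass_snorm r n r0. Qed.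

Lemma mass_le r m n a : 0 <= r -> (m <= n)%N -> mass r m a <= mass r n a.
Proof.
move=> r0 le; rewrite /mass.
rewrite (@big_ord_widen _ _ _ m n
  (fun i => \sum_(j < m) `|cf2 a i j| * r ^+ (i + j))) //.
have h0 i j : 0 <= `|cf2 a i j| * r ^+ (i + j) by rewrite mulr_ge0 ?exprn_ge0.
rewrite big_mkcond; apply: ler_sum => i _; case: ifP => _; last first.
  by apply: sumr_ge0 => j _.
rewrite (@big_ord_widen _ _ _ m n (fun j => `|cf2 a i j| * r ^+ (i + j))) //.
by rewrite big_mkcond; apply: ler_sum => j _; case: ifP.
Qed.

Definition bnd r M a := forall n, mass r n a <= M.

Lemma bnd_ge0 r M a : bnd r M a -> 0 <= M.
Proof. by move=> /(_ 0%N); rewrite /mass big_ord0. Qed.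
Lemma bnd_le r M M' a : bnd r M a -> M <= M' -> bnd r M' a.
Proof. by move=> h le n; apply: le_trans (h n) le. Qed.
Lemma bndD r M M' a b : 0 <= r -> bnd r M a -> bnd r M' b -> bnd r (M + M') (a + b).
Proof. by move=> r0 ha hb n; apply: le_trans (massD _ _ _ r0) _; rewrite lerD. Qed.
Lemma bndN r M a : bnd r M a -> bnd r M (- a).
Proof.
move=> h n; apply: le_trans (h n); rewrite le_eqVlt; apply/orP; left; apply/eqP.
by apply: eq_bigr => i _; apply: eq_bigr => j _; rewrite cf2N normrN.
Qed.
Lemma bndM r M M' a b : 0 <= r -> bnd r M a -> bnd r M' b -> bnd r (M * M') (a * b).
Proof.
move=> r0 ha hb n; apply: le_trans (massM _ _ _ r0) _.
by rewrite ler_pM ?mass_ge0.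
Qed.

Lemma mass_mon r c p q n : 0 <= r ->
  mass r n (CC c * vx ^+ p * vy ^+ q) <= `|c| * r ^+ (p + q).
Proof.
move=> r0; rewrite /mass.
have E0 (i j : nat) : (i, j) <> (p, q) ->
    `|cf2 (CC c * vx ^+ p * vy ^+ q) i j| * r ^+ (i + j) = 0.
  rewrite cf2_mon => h; case: eqP => [Ei|_] /=; last by rewrite normr0 mul0r.
  by case: eqP => [Ej|_]; [case: h; rewrite Ei Ej | rewrite normr0 mul0r].
have rhs0 : 0 <= `|c| * r ^+ (p + q) by rewrite mulr_ge0 ?exprn_ge0.
have [ltp|lep] := ltnP p n; last first.
  rewrite big1 // => i _; rewrite big1 // => j _; rewrite E0 // => -[E _].
  by move: (ltn_ord i); rewrite E ltnNge lep.
have [ltq|leq] := ltnP q n; last first.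
  rewrite big1 // => i _; rewrite big1 // => j _; rewrite E0 // => -[_ E].
  by move: (ltn_ord j); rewrite E ltnNge leq.
rewrite (bigD1 (Ordinal ltp)) //= [X in _ + X]big1 ?addr0; last first.
  move=> i hi; rewrite big1 // => j _; rewrite E0 // => -[E _].
  by case/eqP: hi; apply: val_inj.
rewrite (bigD1 (Ordinal ltq)) //= [X in _ + X]big1 ?addr0; last first.
  move=> j hj; rewrite E0 // => -[E].
  by case/eqP: hj; apply: val_inj.
by rewrite cf2_mon !eqxx.
Qed.

Lemma bnd_mon r c p q : 0 <= r ->
  bnd r (`|c| * r ^+ (p + q)) (CC c * vx ^+ p * vy ^+ q).
Proof. by move=> r0 n; apply: mass_mon. Qed.
Lemma bndC r c : 0 <= r -> bnd r `|c| (CC c).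
Proof. by move=> r0; have := bnd_mon c 0 0 r0; rewrite !expr0 !mulr1. Qed.
Lemma bnd_vx r : 0 <= r -> bnd r r vx.
Proof.
move=> r0; have := bnd_mon 1 1 0 r0.
by rewrite !expr0 !expr1 normr1 rmorph1 !mulr1 !mul1r.
Qed.
Lemma bnd_vy r : 0 <= r -> bnd r r vy.
Proof.
move=> r0; have := bnd_mon 1 0 1 r0.
by rewrite !expr0 !expr1 normr1 rmorph1 !mul1r.
Qed.
Lemma bndX r M a m : 0 <= r -> bnd r M a -> bnd r (M ^+ m) (a ^+ m).
Proof.
move=> r0 ha; elim: m => [|m IH]; last by rewrite !exprS; apply: bndM.
by have := bndC 1 r0; rewrite normr1 rmorph1.
Qed.

Lemma bnd_coef r M a i j : 0 <= r -> bnd r M a -> `|cf2 a i j| * r ^+ (i + j) <= M.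
Proof.
move=> r0 /(_ (i + j).+1); apply: le_trans; rewrite /mass.
have hi : (i < (i + j).+1)%N by rewrite ltnS leq_addr.
have hj : (j < (i + j).+1)%N by rewrite ltnS leq_addl.
have h0 p q : 0 <= `|cf2 a p q| * r ^+ (p + q) by rewrite mulr_ge0 ?exprn_ge0.
rewrite (bigD1 (Ordinal hi)) //= (bigD1 (Ordinal hj)) //= -addrA lerDl addr_ge0 //.
  exact: sumr_ge0.
by apply: sumr_ge0 => p _; apply: sumr_ge0.
Qed.

(** Shrinking the radius by a factor [t] gains [t^m] on a series of order [m]. *)
Lemma bnd_ord r M a m t : 0 <= r -> bnd r M a -> ord m a -> 0 <= t <= 1 ->
  bnd (t * r) (t ^+ m * M) a.
Proof.
move=> r0 ha oa /andP[t0 t1] n; apply: (@le_trans _ _ (t ^+ m * mass r n a)).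
  rewrite mulr_sumr; apply: ler_sum => i _; rewrite mulr_sumr; apply: ler_sum => j _.
  have [lt|le] := ltnP (i + j) m.
    by rewrite (ordE oa) // normr0 !mul0r mulr0.
  rewrite exprMn mulrCA ler_wpM2r //; first by rewrite mulr_ge0 ?exprn_ge0.
  by rewrite ler_wiXn2l.
by rewrite ler_wpM2l ?exprn_ge0.
Qed.

Lemma bnd_rad r r' M a : bnd r M a -> 0 <= r' <= r -> bnd r' M a.
Proof.
move=> h /andP[r'0 le] n; apply: le_trans (h n).
apply: ler_sum => i _; apply: ler_sum => j _; rewrite ler_wpM2l //.
by rewrite lerXn2r ?nnegrE // (le_trans r'0).
Qed.

Lemma geom2 n : \sum_(i < n) (2^-1 : R) ^+ i <= 2.
Proof.
suff -> : \sum_(i < n) (2^-1 : R) ^+ i = 2 - 2 * 2^-1 ^+ n.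
  by rewrite lerBlDr lerDl mulr_ge0 // exprn_ge0.
elim: n => [|n IH]; first by rewrite big_ord0 expr0; ring.
by rewrite big_ord_recr /= IH exprS; set t := _ ^+ n; lra.
Qed.

(** Cauchy's estimate read backwards: at half the radius the coefficients are dominated
by a double geometric series of sum 4. *)
Lemma bnd_of_coef r M a : 0 < r ->
  (forall i j, `|cf2 a i j| * r ^+ (i + j) <= M) -> bnd (r / 2) (4 * M) a.
Proof.
move=> r0 h n.
have M0 : 0 <= M.
  by apply: le_trans (h 0%N 0%N); rewrite mulr_ge0 // exprn_ge0 // ltW.
apply: (@le_trans _ _ (\sum_(i < n) \sum_(j < n) M * 2^-1 ^+ i * 2^-1 ^+ j)).
  apply: ler_sum => i _; apply: ler_sum => j _.
  rewrite exprMn mulrA [2^-1 ^+ (i + j)]exprD mulrA.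
  by rewrite ler_wpM2r ?exprn_ge0 // ler_wpM2r ?exprn_ge0.
under eq_bigr do rewrite -mulr_sumr.
rewrite -mulr_suml -mulr_sumr (_ : 4 * M = M * 2 * 2); last by ring.
have g0 : 0 <= \sum_(i < n) (2^-1 : R) ^+ i by apply: sumr_ge0 => i _; rewrite exprn_ge0.
by apply: ler_pM; rewrite ?mulr_ge0 ?geom2 // ler_wpM2l ?geom2.
Qed.

Lemma expr_cauchy (s s' : R) i : 0 <= s -> s < s' ->
  i.+1%:R * s ^+ i <= s' ^+ i.+1 / (s' - s).
Proof.
move=> s0 lt; rewrite ler_pdivlMr ?subr_gt0 //.
apply: (@le_trans _ _ (s' ^+ i.+1 - s ^+ i.+1)); last first.
  by rewrite lerBlDr lerDl exprn_ge0.
rewrite subrXX mulrC ler_wpM2l //; first by rewrite subr_ge0 ltW.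
rewrite mulr_natl -[i.+1 in leLHS]card_ord -sumr_const; apply: ler_sum => j _ /=.
rewrite -{1}(@subnK j i) ?leq_ord // exprD ler_wpM2r ?exprn_ge0 //.
by rewrite lerXn2r ?nnegrE ?(le_trans s0) // ltW.
Qed.

(** Differentiation costs the inverse of the loss of radius, as [i s^(i-1)] is at most
[s'^i / (s' - s)]. *)
Lemma bnd_dx s s' M a : 0 <= s -> s < s' -> bnd s' M a -> bnd s (M / (s' - s)) (dx a).
Proof.
move=> s0 lt h n; have s'0 : 0 <= s' by rewrite (le_trans s0) ?ltW.
apply: (@le_trans _ _ (mass s' n.+1 a / (s' - s))); last first.
  by rewrite ler_wpM2r // invr_ge0 subr_ge0 ltW.
rewrite {2}/mass mulr_suml big_ord_recl -[leLHS]add0r lerD //.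
  rewrite mulr_ge0 ?invr_ge0 ?subr_ge0 ?(ltW lt) //.
  by apply: sumr_ge0 => j _; rewrite mulr_ge0 ?exprn_ge0.
apply: ler_sum => i _; rewrite mulr_suml big_ord_recr -[leLHS]addr0 lerD //; last first.
  by rewrite !mulr_ge0 ?exprn_ge0 ?invr_ge0 ?subr_ge0 ?(ltW lt).
apply: ler_sum => j _; rewrite cf2_dx normrM ger0_norm // lift0 /=.
rewrite exprD [(i.+1 + j)%N]addnC [s' ^+ _]exprD.
have h1 := expr_cauchy i s0 lt.
have h2 : s ^+ j <= s' ^+ j by rewrite lerXn2r ?nnegrE // ltW.
rewrite (_ : _ * _ * _ = `|cf2 a i.+1 j| * (i.+1%:R * s ^+ i * s ^+ j)); last by ring.
rewrite -[leRHS]mulrA ler_wpM2l // -[leRHS]mulrA [leRHS]mulrC ler_pM //;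
  by rewrite ?mulr_ge0 ?exprn_ge0.
Qed.

Lemma bnd_dy s s' M a : 0 <= s -> s < s' -> bnd s' M a -> bnd s (M / (s' - s)) (dy a).
Proof.
move=> s0 lt h n; have s'0 : 0 <= s' by rewrite (le_trans s0) ?ltW.
apply: (@le_trans _ _ (mass s' n.+1 a / (s' - s))); last first.
  by rewrite ler_wpM2r // invr_ge0 subr_ge0 ltW.
rewrite {2}/mass mulr_suml big_ord_recr -[leLHS]addr0 lerD //; last first.
  rewrite mulr_ge0 ?invr_ge0 ?subr_ge0 ?(ltW lt) //.
  by apply: sumr_ge0 => j _; rewrite mulr_ge0 ?exprn_ge0.
apply: ler_sum => i _; rewrite mulr_suml big_ord_recl -[leLHS]add0r lerD //.
  by rewrite !mulr_ge0 ?exprn_ge0 ?invr_ge0 ?subr_ge0 ?(ltW lt).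
apply: ler_sum => j _; rewrite cf2_dy normrM ger0_norm // lift0 /=.
rewrite exprD [s' ^+ _]exprD.
have h1 := expr_cauchy j s0 lt.
have h2 : s ^+ i <= s' ^+ i by rewrite lerXn2r ?nnegrE // ltW.
rewrite (_ : _ * _ * _ = `|cf2 a i j.+1| * (s ^+ i * (j.+1%:R * s ^+ j))); last by ring.
rewrite -[leRHS]mulrA ler_wpM2l // -[leRHS]mulrA ler_pM //;
  by rewrite ?mulr_ge0 ?exprn_ge0.
Qed.

Lemma bnd_psubst (L : Type) (g : L -> A) v (c : ps L) r M (m : nat -> R) :
  0 <= r -> ord 1 v -> (forall l, bnd r (m l) (g (cf c l) * v ^+ l)) ->
  (forall n, \sum_(l < n) m l <= M) -> bnd r M (psubst g v c).
Proof.
move=> r0 hv hm hM n; apply: le_trans (hM (n + n)%N).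
apply: (@le_trans _ _ (\sum_(l < n + n) mass r n (g (cf c l) * v ^+ l))).
  rewrite /mass [leRHS]exchange_big /=; apply: ler_sum => i _.
  rewrite [leRHS]exchange_big /=; apply: ler_sum => j _.
  rewrite (@psubst_coef _ _ _ _ hv c (n + n)); last by move: (ltn_ord i) (ltn_ord j); lia.
  rewrite -mulr_suml ler_wpM2r ?exprn_ge0 //; exact: ler_norm_sum.
by apply: ler_sum => l _; apply: hm.
Qed.

(** A bound for [a] at radius [rho] is a bound for the composite at every radius where the
map has norm at most [rho]. *)
Lemma bnd_subst2 r rho M a u v : 0 <= r -> ord 1 u -> ord 1 v ->
  bnd r rho u -> bnd r rho v -> bnd rho M a -> bnd r M (subst2 u v a).
Proof.
move=> r0 hu hv bu bv ba n; apply: le_trans (ba (n + n)%N).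
apply: (@le_trans _ _ (\sum_(k < n + n) \sum_(l < n + n)
   mass r n (CC (cf2 a k l) * (u ^+ k * v ^+ l)))).
  rewrite /mass; under [leRHS]eq_bigr => k _.
    rewrite exchange_big /=; under eq_bigr => i _ do rewrite exchange_big /=.
    over.
  rewrite [leRHS]exchange_big /=; apply: ler_sum => i _.
  rewrite [leRHS]exchange_big /=; apply: ler_sum => j _.
  rewrite (@subst2_coef _ _ _ hu hv (n + n)); last by move: (ltn_ord i) (ltn_ord j); lia.
  under [leRHS]eq_bigr => k _ do rewrite -mulr_suml.
  rewrite -mulr_suml ler_wpM2r ?exprn_ge0 //.
  apply: le_trans (ler_norm_sum _ _ _) _; apply: ler_sum => k _.
  apply: le_trans (ler_norm_sum _ _ _) _; apply: ler_sum => l _.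
  by rewrite cf2CM.
apply: ler_sum => k _; apply: ler_sum => l _; rewrite exprD.
by apply: bndM => //; [apply: bndC | apply: bndM => //; apply: bndX].
Qed.

Definition convergent a := exists r, exists2 M, 0 < r & bnd r M a.

Lemma convergentP2 a b : convergent a -> convergent b ->
  exists r, exists2 M, 0 < r & bnd r M a /\ bnd r M b.
Proof.
move=> [r [M r0 ha]] [r' [M' r'0 hb]].
exists (Num.min r r'), (Num.max M M'); first by rewrite lt_min r0.
split.
  apply: (@bnd_le _ M); last by rewrite le_max lexx.
  by apply: bnd_rad ha _; rewrite le_min (ltW r0) (ltW r'0) /= ge_min lexx.
apply: (@bnd_le _ M'); last by rewrite le_max lexx orbT.
by apply: bnd_rad hb _; rewrite le_min (ltW r0) (ltW r'0) /= ge_min lexx orbT.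
Qed.

Lemma convergentD a b : convergent a -> convergent b -> convergent (a + b).
Proof.
move=> ha hb; have [r [M r0 [h1 h2]]] := convergentP2 ha hb.
by exists r, (M + M) => //; apply: bndD => //; apply: ltW.
Qed.
Lemma convergentN a : convergent a -> convergent (- a).
Proof. by move=> [r [M r0 h]]; exists r, M => //; apply: bndN. Qed.
Lemma convergentB a b : convergent a -> convergent b -> convergent (a - b).
Proof. by move=> ha hb; apply: convergentD => //; apply: convergentN. Qed.
Lemma convergentM a b : convergent a -> convergent b -> convergent (a * b).
Proof.
move=> ha hb; have [r [M r0 [h1 h2]]] := convergentP2 ha hb.
by exists r, (M * M) => //; apply: bndM => //; apply: ltW.
Qed.
Lemma convergentC c : convergent (CC c).
Proof. by exists 1, `|c| => //; apply: bndC. Qed.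
Lemma convergent_vx : convergent vx. Proof. by exists 1, 1 => //; apply: bnd_vx. Qed.
Lemma convergent_vy : convergent vy. Proof. by exists 1, 1 => //; apply: bnd_vy. Qed.
Lemma convergent1 : convergent 1. Proof. by rewrite -(rmorph1 (@CC R)); apply: convergentC. Qed.
Lemma convergentX a n : convergent a -> convergent (a ^+ n).
Proof. by move=> [r [M r0 h]]; exists r, (M ^+ n) => //; apply: bndX => //; apply: ltW. Qed.
Lemma convergent_dx a : convergent a -> convergent (dx a).
Proof.
move=> [r [M r0 h]]; exists (r / 2), (M / (r - r / 2)); first by rewrite divr_gt0.
by apply: bnd_dx => //; lra.
Qed.
Lemma convergent_dy a : convergent a -> convergent (dy a).
Proof.
move=> [r [M r0 h]]; exists (r / 2), (M / (r - r / 2)); first by rewrite divr_gt0.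
by apply: bnd_dy => //; lra.
Qed.
Lemma convergent_coef r M a : 0 < r ->
  (forall i j, `|cf2 a i j| * r ^+ (i + j) <= M) -> convergent a.
Proof.
by move=> r0 h; exists (r / 2), (4 * M); [rewrite divr_gt0 | apply: bnd_of_coef].
Qed.

(** A convergent series without constant term is as small as desired on a small
polydisc. *)
Lemma convergent_small u rho : convergent u -> ord 1 u -> 0 < rho ->
  exists2 r, 0 < r & forall r', 0 <= r' <= r -> bnd r' rho u.
Proof.
move=> [r [M r0 hu]] ou rho0.
have M0 := bnd_ge0 hu.
pose t := Num.min 1 (rho / (M + 1)).
have t0 : 0 < t by rewrite lt_min ltr01 divr_gt0 // ltr_wpDl.
exists (t * r); first by rewrite mulr_gt0.
move=> r' hr'; apply: bnd_rad hr'; apply: bnd_le.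
  by apply: (bnd_ord (ltW r0) hu ou); rewrite (ltW t0) ge_min lexx.
rewrite expr1; apply: (@le_trans _ _ (rho / (M + 1) * M)).
  by rewrite ler_wpM2r // ge_min lexx orbT.
by rewrite -mulrA ler_piMr ?(ltW rho0) // ler_pdivrMl ?mulr1 ?lerDl // ltr_wpDl.
Qed.

Lemma convergent_small2 u v rho : convergent u -> ord 1 u -> convergent v -> ord 1 v -> 0 < rho ->
  exists2 r, 0 < r & forall r', 0 <= r' <= r -> bnd r' rho u /\ bnd r' rho v.
Proof.
move=> cu ou cv ov rho0.
have [r r0 hr] := convergent_small cu ou rho0.
have [s s0 hs] := convergent_small cv ov rho0.
exists (Num.min r s); first by rewrite lt_min r0.
by move=> r'; rewrite le_min => /and3P[? ? ?]; split; [apply: hr|apply: hs]; apply/andP.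
Qed.

Lemma convergent_subst2 a u v : ord 1 u -> ord 1 v -> convergent u -> convergent v -> convergent a ->
  convergent (subst2 u v a).
Proof.
move=> ou ov cu cv [rho [M rho0 ha]].
have [r r0 hr] := convergent_small2 cu ou cv ov rho0.
have [hu hv] : bnd r rho u /\ bnd r rho v by apply: hr; rewrite (ltW r0) lexx.
by exists r, M => //; apply: bnd_subst2 ha => //; apply: ltW.
Qed.

(** After division by the constant term, the inverse is a geometric series in an element
without constant term. *)
Lemma convergent_inv a : convergent a -> cf2 a 0 0 != 0 -> exists2 b, convergent b & a * b = 1.
Proof.
move=> ca a0; set a00 := cf2 a 0 0.
pose w := 1 - CC a00^-1 * a.
have cw : convergent w by apply: convergentB; [exact: convergent1 | apply: convergentM => //; exact: convergentC].
have ow : ord 1 w.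
  by apply: ord1P; rewrite cf2B cf2CM cf2_1 /= mulVf // subrr.
(* [a / a00] is [1 - w], with [w] of order one *)
pose geo : ps R := PS (fun=> 1).
have hgeo : geo * (1 - psX) = 1.
  apply: psP => n; rewrite mulrC mulrBl mul1r cfB cfXM cf1.
  by case: n => [|n] /=; rewrite ?subr0 ?subrr.
have hC := CC_rhom R.
have hs := psubst_hom ow hC.
exists (psubst (@CC R) w geo * CC a00^-1).
  apply: convergentM; last exact: convergentC.
  have half0 : 0 < 2^-1 :> R by [].
  have [r r0 hr] := convergent_small cw ow half0.
  exists r, 2 => //; apply: (@bnd_psubst _ _ _ _ _ _ (fun l => 2^-1 ^+ l)) => //;
    first exact: ltW.
    move=> l; rewrite /= rmorph1 mul1r; apply: bndX; first exact: ltW.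
    by apply: hr; rewrite (ltW r0) lexx.
  exact: geom2.
transitivity (psubst (@CC R) w (geo * (1 - psX))).
  by rewrite (rhM hs) (rhB hs) (rh1 hs) (psubst_X ow hC) /w; ring.
by rewrite hgeo (rh1 hs).
Qed.
End SemiNorm.

(** * Values of convergent series *)

(** Square partial sums are those of the definition of analyticity.  Outside the
polydisc of convergence the value is that of [lim] on a divergent sequence. *)
HB.lock Definition pseval (R : realType) (a : ps (ps R)) (p : R * R) : R :=
  limn (fun n => \sum_(i < n) \sum_(j < n) cf2 a i j * p.1 ^+ i * p.2 ^+ j).
Arguments pseval {R} a p.

Section Eval.
Variable R : realType.
Local Notation A := (ps (ps R)).
Implicit Types (a b u v : A) (r M e : R) (p : R * R).

Definition sq a p n : R := \sum_(i < n) \sum_(j < n) cf2 a i j * p.1 ^+ i * p.2 ^+ j.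

Lemma norm_pair_le p r : (`|p| <= r) = (`|p.1| <= r) && (`|p.2| <= r).
Proof. by rewrite prod_normE ge_max. Qed.
Lemma norm_pair_lt p r : (`|p| < r) = (`|p.1| < r) && (`|p.2| < r).
Proof. by rewrite prod_normE gt_max. Qed.

Lemma mon_le r p i j : `|p| <= r -> `|p.1 ^+ i * p.2 ^+ j| <= r ^+ (i + j).
Proof.
rewrite norm_pair_le => /andP[h1 h2].
have r0 : 0 <= r by apply: le_trans h1.
by rewrite normrM !normrX exprD ler_pM ?exprn_ge0 // lerXn2r ?nnegrE.
Qed.

Lemma square_sum_mono (t : nat -> nat -> R) : (forall i j, 0 <= t i j) ->
  nondecreasing_seq (fun n => \sum_(i < n) \sum_(j < n) t i j).
Proof.
move=> h0 m n le.
rewrite (@big_ord_widen _ _ _ m n (fun i => \sum_(j < m) t i j)) //.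
rewrite big_mkcond; apply: ler_sum => i _; case: ifP => _; last exact: sumr_ge0.
rewrite (@big_ord_widen _ _ _ m n (fun j => t i j)) //.
by rewrite big_mkcond; apply: ler_sum => j _; case: ifP.
Qed.

Lemma square_sum_cvg (t : nat -> nat -> R) M : (forall i j, 0 <= t i j) ->
  (forall n, \sum_(i < n) \sum_(j < n) t i j <= M) ->
  cvgn (fun n => \sum_(i < n) \sum_(j < n) t i j).
Proof.
move=> h0 hM; apply: nondecreasing_is_cvgn; first exact: square_sum_mono.
by exists M => _ [n _ <-].
Qed.

Lemma sq_le r a p n : `|p| <= r -> `|sq a p n| <= mass r n a.
Proof.
move=> hp; apply: le_trans (ler_norm_sum _ _ _) _; apply: ler_sum => i _.
apply: le_trans (ler_norm_sum _ _ _) _; apply: ler_sum => j _.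
by rewrite -mulrA normrM ler_wpM2l // mon_le.
Qed.

Lemma eval_cvg r M a p : bnd r M a -> `|p| <= r -> sq a p @ \oo --> pseval a p.
Proof.
move=> ba hp; pose t i j := cf2 a i j * p.1 ^+ i * p.2 ^+ j.
have tle i j : `|t i j| <= `|cf2 a i j| * r ^+ (i + j).
  by rewrite /t -mulrA normrM ler_wpM2l // mon_le.
have c1 : cvgn (fun n => \sum_(i < n) \sum_(j < n) `|t i j|).
  apply: (@square_sum_cvg (fun i j => `|t i j|) M) => // n; apply: le_trans (ba n).
  by apply: ler_sum => i _; apply: ler_sum => j _.
have c2 : cvgn (fun n => \sum_(i < n) \sum_(j < n) (`|t i j| + t i j)).
  apply: (@square_sum_cvg (fun i j => `|t i j| + t i j) (M + M)) => [i j|n].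
    by rewrite -lerBlDr sub0r -normrN ler_norm.
  apply: (@le_trans _ _ (mass r n a + mass r n a)); last exact: lerD.
  rewrite -big_split; apply: ler_sum => i _; rewrite -big_split.
  by apply: ler_sum => j _; apply: lerD => //; apply: le_trans (ler_norm _) _.
suff : cvgn (sq a p) by rewrite pseval.unlock.
have -> : sq a p = (fun n => \sum_(i < n) \sum_(j < n) (`|t i j| + t i j)) -
                   (fun n => \sum_(i < n) \sum_(j < n) `|t i j|).
  apply/funext => n; rewrite /sq !fctE -sumrB; apply: eq_bigr => i _.
  by rewrite -sumrB; apply: eq_bigr => j _; rewrite /t; ring.
exact: is_cvgB.
Qed.

Lemma eval_le r M a p : bnd r M a -> `|p| <= r -> `|pseval a p| <= M.
Proof.
move=> ba hp; have h := eval_cvg ba hp.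
have h' : (fun n => `|sq a p n|) @ \oo --> `|pseval a p| by apply: cvg_norm.
rewrite -(cvg_lim _ h') //; apply: limr_le; first by apply: cvgP h'.
by apply: nearW => n; apply: le_trans (sq_le _ _ hp) (ba n).
Qed.

(** Absolute convergence on the closed polydisc of radius [r]. *)
Definition fin r a := exists M, bnd r M a.

Lemma evalP r a p l : fin r a -> `|p| <= r -> sq a p @ \oo --> l -> pseval a p = l.
Proof. by move=> [M ba] hp h; rewrite pseval.unlock; apply: cvg_lim. Qed.

Section Hom.
Variables (r : R) (p : R * R) (r0 : 0 <= r) (hp : `|p| <= r).

Lemma finD a b : fin r a -> fin r b -> fin r (a + b).
Proof. by move=> [M h] [M' h']; exists (M + M'); apply: bndD. Qed.
Lemma finN a : fin r a -> fin r (- a).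
Proof. by move=> [M h]; exists M; apply: bndN. Qed.
Lemma finB a b : fin r a -> fin r b -> fin r (a - b).
Proof. by move=> ha hb; apply: finD => //; apply: finN. Qed.
Lemma finM a b : fin r a -> fin r b -> fin r (a * b).
Proof. by move=> [M h] [M' h']; exists (M * M'); apply: bndM. Qed.
Lemma finC c : fin r (CC c). Proof. by exists `|c|; apply: bndC. Qed.
Lemma fin_vx : fin r vx. Proof. by exists r; apply: bnd_vx. Qed.
Lemma fin_vy : fin r vy. Proof. by exists r; apply: bnd_vy. Qed.
Lemma fin0 : fin r 0. Proof. by rewrite -(rmorph0 (@CC R)); apply: finC. Qed.
Lemma finX a n : fin r a -> fin r (a ^+ n).
Proof. by move=> [M h]; exists (M ^+ n); apply: bndX. Qed.
Lemma fin_sum I (s : seq I) (P : pred I) (F : I -> A) :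
  (forall i, P i -> fin r (F i)) -> fin r (\sum_(i <- s | P i) F i).
Proof. by move=> h; apply: big_ind => //; [exact: fin0 | exact: finD]. Qed.

Lemma evalD a b : fin r a -> fin r b -> pseval (a + b) p = pseval a p + pseval b p.
Proof.
move=> ha hb; apply: (evalP (finD ha hb) hp).
have -> : sq (a + b) p = sq a p + sq b p.
  apply/funext => n; rewrite /sq fctE -big_split; apply: eq_bigr => i _ /=.
  by rewrite -big_split; apply: eq_bigr => j _ /=; rewrite cf2D; ring.
by case: ha hb => [M ha] [M' hb]; apply: cvgD; apply: eval_cvg; eassumption.
Qed.

Lemma evalCM c a : fin r a -> pseval (CC c * a) p = c * pseval a p.
Proof.
move=> ha; apply: (evalP (finM (finC c) ha) hp).
have -> : sq (CC c * a) p = (fun n => c * sq a p n).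
  apply/funext => n; rewrite /sq mulr_sumr; apply: eq_bigr => i _ /=.
  by rewrite mulr_sumr; apply: eq_bigr => j _ /=; rewrite cf2CM; ring.
by case: ha => [M ha]; apply: cvgMr; apply: eval_cvg; eassumption.
Qed.

Lemma eval_mon c m n : pseval (CC c * vx ^+ m * vy ^+ n) p = c * p.1 ^+ m * p.2 ^+ n.
Proof.
apply: (@evalP r) => //.
  by apply: finM; [apply: finM; [exact: finC|] |]; apply: finX; [exact: fin_vx|exact: fin_vy].
apply: cvg_near_cst; exists (m + n).+1 => // N /= le; apply/eqP; rewrite /sq.
have hm : (m < N)%N by apply: leq_ltn_trans le; apply: leq_addr.
have hn : (n < N)%N by apply: leq_ltn_trans le; apply: leq_addl.
rewrite (bigD1 (Ordinal hm)) //= [X in _ + X]big1 ?addr0; last first.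
  move=> i /eqP hi; rewrite big1 // => j _; rewrite cf2_mon.
  case: eqP => /= [E|_]; last by rewrite !mul0r.
  by case: hi; apply: val_inj.
rewrite (bigD1 (Ordinal hn)) //= [X in _ + X]big1 ?addr0; last first.
  move=> j /eqP hj; rewrite cf2_mon eqxx /=.
  case: eqP => [E|_]; last by rewrite !mul0r.
  by case: hj; apply: val_inj.
by rewrite cf2_mon !eqxx.
Qed.

Lemma evalC c : pseval (CC c) p = c.
Proof. by have := eval_mon c 0 0; rewrite !expr0 !mulr1. Qed.
Lemma eval0 : pseval 0 p = 0.
Proof. by rewrite -(rmorph0 (@CC R)) evalC. Qed.
Lemma eval1 : pseval 1 p = 1.
Proof. by rewrite -(rmorph1 (@CC R)) evalC. Qed.
Lemma eval_vx : pseval vx p = p.1.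
Proof. by have := eval_mon 1 1 0; rewrite !expr0 !mulr1 rmorph1 !mul1r !expr1. Qed.
Lemma eval_vy : pseval vy p = p.2.
Proof. by have := eval_mon 1 0 1; rewrite !expr0 !mulr1 rmorph1 !mul1r !expr1. Qed.

Lemma evalN a : fin r a -> pseval (- a) p = - pseval a p.
Proof.
move=> ha; have := evalCM (-1) ha.
by rewrite rmorphN rmorph1 !mulN1r.
Qed.
Lemma evalB a b : fin r a -> fin r b -> pseval (a - b) p = pseval a p - pseval b p.
Proof. by move=> ha hb; rewrite evalD ?evalN //; exact: finN. Qed.
Lemma eval_sum I (s : seq I) (P : pred I) (F : I -> A) :
  (forall i, P i -> fin r (F i)) ->
  pseval (\sum_(i <- s | P i) F i) p = \sum_(i <- s | P i) pseval (F i) p.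
Proof.
move=> h; elim: s => [|i s IH]; first by rewrite !big_nil eval0.
rewrite !big_cons; case: ifP => Pi //; rewrite evalD ?IH //; first exact: h.
exact: fin_sum.
Qed.

Definition trunc n a : A := \sum_(i < n) \sum_(j < n) CC (cf2 a i j) * vx ^+ i * vy ^+ j.

Lemma cf2_trunc n a i j :
  cf2 (trunc n a) i j = if (i < n)%N && (j < n)%N then cf2 a i j else 0.
Proof.
rewrite /trunc cf2_sum.
have [hi|hi] := ltnP i n => /=; last first.
  rewrite big1 // => k _; rewrite cf2_sum big1 // => l _; rewrite cf2_mon.
  by case: eqP => // E; move: (ltn_ord k); rewrite -E ltnNge hi.
have [hj|hj] := ltnP j n => /=; last first.
  rewrite big1 // => k _; rewrite cf2_sum big1 // => l _; rewrite cf2_mon.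
  by rewrite andbC; case: eqP => // E; move: (ltn_ord l); rewrite -E ltnNge hj.
rewrite (bigD1 (Ordinal hi)) //= cf2_sum (bigD1 (Ordinal hj)) //= cf2_mon !eqxx.
rewrite big1 ?addr0; last first.
  move=> l /eqP hl; rewrite cf2_mon; case: eqP => //= _; case: eqP => // E.
  by case: hl; apply: val_inj.
rewrite big1 ?addr0 // => k /eqP hk.
rewrite cf2_sum big1 // => l _; rewrite cf2_mon; case: eqP => //= E.
by case: hk; apply: val_inj.
Qed.

Lemma fin_trunc n a : fin r (trunc n a).
Proof.
apply: fin_sum => i _; apply: fin_sum => j _; apply: finM; [apply: finM|];
  [exact: finC | apply: finX; exact: fin_vx | apply: finX; exact: fin_vy].
Qed.

Lemma mass_trunc m n a : (n <= m)%N ->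
  mass r m (a - trunc n a) = mass r m a - mass r n a.
Proof.
move=> le; rewrite /mass.
rewrite (@big_ord_widen _ _ _ n m (fun i => \sum_(j < n) `|cf2 a i j| * r ^+ (i + j))) //.
rewrite [X in _ = _ - X]big_mkcond -sumrB; apply: eq_bigr => i _.
case: ifP => hi; last first.
  rewrite subr0; apply: eq_bigr => j _.
  by rewrite cf2B cf2_trunc hi subr0.
rewrite (@big_ord_widen _ _ _ n m (fun j => `|cf2 a i j| * r ^+ (i + j))) //.
rewrite [X in _ = _ - X]big_mkcond -sumrB; apply: eq_bigr => j _.
by rewrite cf2B cf2_trunc hi /=; case: ifP => hj; rewrite ?subrr ?normr0 ?mul0r ?subr0.
Qed.

(** Absolute convergence makes the tails small in norm, so that the algebraic properties of
values need only be checked on polynomials. *)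
Lemma bnd_tail a e : fin r a -> 0 < e -> exists n, bnd r e (a - trunc n a).
Proof.
move=> [M ba] e0.
have h0 i j : 0 <= `|cf2 a i j| * r ^+ (i + j) by rewrite mulr_ge0 ?exprn_ge0.
have cv := square_sum_cvg h0 ba.
have mono := square_sum_mono h0.
have /cvgrPdist_le/(_ e e0) [n _ hn] := cv.
exists n => m.
have hnn := hn n (leqnn n).
apply: (@le_trans _ _ (mass r (maxn n m) (a - trunc n a))).
  by apply: mass_le => //; rewrite leq_maxr.
rewrite mass_trunc ?leq_maxl //.
apply: (le_trans _ hnn); apply: le_trans (ler_norm _); rewrite lerD2r.
exact: nondecreasing_cvgn_le.
Qed.

Lemma small_eq0 (x C : R) : (forall e, 0 < e -> `|x| <= e * C) -> x = 0.
Proof.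
move=> h; apply/eqP; rewrite -normr_eq0; apply/eqP.
have C0 : 0 <= C by have := h 1 ltr01; rewrite mul1r; apply: le_trans.
apply/eqP; rewrite eq_le normr_ge0 andbT; apply/ler_addgt0Pr => e e0.
rewrite add0r; have d0 : 0 < e / (C + 1) by rewrite divr_gt0 // ltr_wpDl.
apply: le_trans (h _ d0) _; rewrite mulrAC ler_pdivrMr ?ltr_wpDl //.
by rewrite ler_wpM2l ?lerDl ?ltW.
Qed.

(** The product with a monomial shifts the square partial sums; the boundary terms tend to
zero. *)
Lemma eval_monM c m n b : fin r b ->
  pseval (CC c * vx ^+ m * vy ^+ n * b) p = c * p.1 ^+ m * p.2 ^+ n * pseval b p.
Proof.
have hx a : fin r a -> pseval (vx * a) p = p.1 * pseval a p.
  move=> fa; apply: (@evalP r) => //; first exact: finM fin_vx fa.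
  case: (fa) => M ba.
  rewrite -(cvg_shiftS (sq (vx * a) p)) /=.
  have E N : sq (vx * a) p N.+1 = p.1 * sq a p N +
      p.1 * (\sum_(i < N) cf2 a i N * p.1 ^+ i * p.2 ^+ N).
    rewrite /sq big_ord_recl big1 ?add0r; last by move=> j _; rewrite cf2_vxM !mul0r.
    rewrite -mulrDr -big_split mulr_sumr; apply: eq_bigr => i _; rewrite lift0.
    rewrite big_ord_recr /= mulrDr mulr_sumr.
    by congr (_ + _); [apply: eq_bigr => j _|]; rewrite cf2_vxM exprS; ring.
  rewrite (_ : (fun N => sq (vx * a) p N.+1) = (fun N => p.1 * sq a p N +
      p.1 * (\sum_(i < N) cf2 a i N * p.1 ^+ i * p.2 ^+ N))); last exact/funext.
  rewrite -[p.1 * pseval a p]addr0 -[X in _ + X](mulr0 p.1).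
  apply: cvgD; first by apply: cvgMr; exact: eval_cvg ba hp.
  apply: cvgMr.
  have h0 i j : 0 <= `|cf2 a i j| * r ^+ (i + j) by rewrite mulr_ge0 ?exprn_ge0.
  have cv := square_sum_cvg h0 ba.
  apply/cvgr0Pnorm_le => e e0.
  have cvS : (fun n => mass r n.+1 a - mass r n a) @ \oo --> 0.
    rewrite -(subrr (limn (fun n => mass r n a))); apply: cvgB => //.
    by rewrite (cvg_shiftS (fun n => mass r n a)).
  have /cvgr0Pnorm_le/(_ e e0) [N _ hN] := cvS.
  exists N => // k /hN; apply: le_trans.
  apply: (le_trans _ (ler_norm _)); rewrite lerBrDr.
  rewrite {2}/mass big_ord_recr -[leLHS]addr0 lerD ?sumr_ge0 //.
  under [leRHS]eq_bigr do rewrite big_ord_recr.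
  rewrite big_split /= [leRHS]addrC; apply: lerD; last exact: lexx.
  apply: le_trans (ler_norm_sum _ _ _) _; apply: ler_sum => i _.
  by rewrite -mulrA normrM ler_wpM2l // mon_le.
have hy a : fin r a -> pseval (vy * a) p = p.2 * pseval a p.
  move=> fa; apply: (@evalP r) => //; first exact: finM fin_vy fa.
  case: (fa) => M ba.
  rewrite -(cvg_shiftS (sq (vy * a) p)) /=.
  have E N : sq (vy * a) p N.+1 = p.2 * sq a p N +
      p.2 * (\sum_(j < N) cf2 a N j * p.1 ^+ N * p.2 ^+ j).
    rewrite /sq big_ord_recr /= mulr_sumr; congr (_ + _).
      apply: eq_bigr => i _; rewrite big_ord_recl cf2_vyM !mul0r add0r mulr_sumr.
      by apply: eq_bigr => j _; rewrite lift0 cf2_vyM exprS; ring.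
    rewrite big_ord_recl cf2_vyM !mul0r add0r mulr_sumr.
    by apply: eq_bigr => j _; rewrite lift0 cf2_vyM exprS; ring.
  rewrite (_ : (fun N => sq (vy * a) p N.+1) = (fun N => p.2 * sq a p N +
      p.2 * (\sum_(j < N) cf2 a N j * p.1 ^+ N * p.2 ^+ j))); last exact/funext.
  rewrite -[p.2 * pseval a p]addr0 -[X in _ + X](mulr0 p.2).
  apply: cvgD; first by apply: cvgMr; exact: eval_cvg ba hp.
  apply: cvgMr.
  have h0 i j : 0 <= `|cf2 a i j| * r ^+ (i + j) by rewrite mulr_ge0 ?exprn_ge0.
  have cv := square_sum_cvg h0 ba.
  apply/cvgr0Pnorm_le => e e0.
  have cvS : (fun n => mass r n.+1 a - mass r n a) @ \oo --> 0.
    rewrite -(subrr (limn (fun n => mass r n a))); apply: cvgB => //.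
    by rewrite (cvg_shiftS (fun n => mass r n a)).
  have /cvgr0Pnorm_le/(_ e e0) [N _ hN] := cvS.
  exists N => // k /hN; apply: le_trans.
  apply: (le_trans _ (ler_norm _)); rewrite lerBrDr.
  rewrite {2}/mass big_ord_recr addrC lerD //; last first.
    rewrite big_ord_recr -[leLHS]addr0 lerD //.
    apply: le_trans (ler_norm_sum _ _ _) _; apply: ler_sum => i _.
    by rewrite -mulrA normrM ler_wpM2l // mon_le.
  by apply: ler_sum => i _; rewrite big_ord_recr lerDl.
move=> fb; rewrite -!mulrA.
have fy : fin r (vy ^+ n * b) by apply: finM => //; apply: finX; exact: fin_vy.
have fxy : fin r (vx ^+ m * (vy ^+ n * b)).
  by apply: finM => //; apply: finX; exact: fin_vx.
rewrite evalCM //; congr (_ * _).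
elim: m fxy => [|m IH] _.
  rewrite !expr0 !mul1r; elim: n fy => [|n IH] _; first by rewrite !expr0 !mul1r.
  rewrite !exprS -!mulrA hy; last by apply: finM => //; apply: finX; exact: fin_vy.
  by rewrite IH //; apply: finM => //; apply: finX; exact: fin_vy.
have fxm : fin r (vx ^+ m * (vy ^+ n * b)).
  by apply: finM => //; apply: finX; exact: fin_vx.
by rewrite !exprS -!mulrA hx // IH.
Qed.

Lemma eval_truncM n a b : fin r b ->
  pseval (trunc n a * b) p = pseval (trunc n a) p * pseval b p.
Proof.
move=> fb.
have fm i j : fin r (CC (cf2 a i j) * vx ^+ i * vy ^+ j).
  apply: finM; [apply: finM|];
  [exact: finC | apply: finX; exact: fin_vx | apply: finX; exact: fin_vy].
rewrite /trunc [in RHS]eval_sum => [|i _]; last by apply: fin_sum.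
rewrite !mulr_suml eval_sum => [|i _]; last first.
  by apply: finM => //; apply: fin_sum.
apply: eq_bigr => i _; rewrite mulr_suml eval_sum => [|j _]; last exact: finM.
rewrite eval_sum => [|j _]; last exact: fm.
rewrite mulr_suml; apply: eq_bigr => j _.
by rewrite eval_monM // eval_mon.
Qed.

Lemma evalM a b : fin r a -> fin r b -> pseval (a * b) p = pseval a p * pseval b p.
Proof.
move=> fa [M bb]; have fb : fin r b by exists M.
apply/eqP; rewrite -subr_eq0; apply/eqP; apply: (@small_eq0 _ (M + M)) => e e0.
have [n hn] := bnd_tail fa e0.
set t := a - trunc n a in hn *; have ft : fin r t by exists e.
have fT := fin_trunc n a.
have -> : a = trunc n a + t by rewrite /t addrC subrK.
rewrite mulrDl (evalD (finM fT fb) (finM ft fb)) (evalD fT ft).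
rewrite eval_truncM // (_ : _ - _ = pseval (t * b) p - pseval t p * pseval b p); last by ring.
apply: le_trans (ler_normB _ _) _; rewrite mulrDr lerD //.
  by apply: eval_le hp; apply: bndM.
rewrite normrM; apply: ler_pM => //; exact: (eval_le _ hp).
Qed.

Lemma evalX a n : fin r a -> pseval (a ^+ n) p = pseval a p ^+ n.
Proof.
move=> fa; elim: n => [|n IH]; first by rewrite !expr0 eval1.
by rewrite !exprS evalM ?IH //; exact: finX.
Qed.

End Hom.

Lemma eval_subst2_trunc r rho n a u v p : 0 <= r -> `|p| <= r ->
  ord 1 u -> ord 1 v -> bnd r rho u -> bnd r rho v ->
  pseval (subst2 u v (trunc n a)) p = pseval (trunc n a) (pseval u p, pseval v p).
Proof.
move=> r0 hp ou ov bu bv.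
have fu : fin r u by exists rho.
have fv : fin r v by exists rho.
have hq : `|(pseval u p, pseval v p)| <= rho.
  by rewrite norm_pair_le /= (eval_le bu hp) (eval_le bv hp).
have rho0 : 0 <= rho by apply: le_trans hq.
have hs := subst2_hom ou ov.
have fX := finX r0.
have fm i j : fin r (CC (cf2 a i j) * u ^+ i * v ^+ j).
  exact: (finM r0 (finM r0 (finC r0 _) (fX _ i fu)) (fX _ j fv)).
have -> : subst2 u v (trunc n a) =
    \sum_(i < n) \sum_(j < n) CC (cf2 a i j) * u ^+ i * v ^+ j.
  rewrite (rh_sum hs); apply: eq_bigr => i _; rewrite (rh_sum hs).
  by apply: eq_bigr => j _; rewrite subst2_mon.
transitivity (\sum_(i < n) \sum_(j < n) cf2 a i j * pseval u p ^+ i * pseval v p ^+ j).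
  rewrite (eval_sum r0 hp) => [|i _]; last exact: fin_sum.
  apply: eq_bigr => i _; rewrite (eval_sum r0 hp) => [|j _]; last exact: fm.
  apply: eq_bigr => j _.
  rewrite (evalM r0 hp (finM r0 (finC r0 _) (fX _ i fu)) (fX _ j fv)).
  rewrite (evalM r0 hp (finC r0 _) (fX _ i fu)).
  by rewrite (evalX r0 hp i fu) (evalX r0 hp j fv) (evalC r0 hp).
have fm' i j : fin rho (CC (cf2 a i j) * vx ^+ i * vy ^+ j).
  exact: (finM rho0 (finM rho0 (finC rho0 _) (finX rho0 i (fin_vx rho0)))
     (finX rho0 j (fin_vy rho0))).
rewrite /trunc (eval_sum rho0 hq) => [|i _]; last exact: fin_sum.
apply: eq_bigr => i _; rewrite (eval_sum rho0 hq) => [|j _]; last exact: fm'.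
by apply: eq_bigr => j _; rewrite (eval_mon rho0 hq).
Qed.

(** By [bnd_tail], composition is reduced to the case of a polynomial: the composite of a
small tail with the map is small as well. *)
Lemma eval_subst2 r rho a u v p : 0 <= r -> `|p| <= r ->
  ord 1 u -> ord 1 v -> bnd r rho u -> bnd r rho v ->
  fin rho a -> pseval (subst2 u v a) p = pseval a (pseval u p, pseval v p).
Proof.
move=> r0 hp ou ov bu bv fa.
have hq : `|(pseval u p, pseval v p)| <= rho.
  by rewrite norm_pair_le /= (eval_le bu hp) (eval_le bv hp).
have rho0 : 0 <= rho by apply: le_trans hq.
apply/eqP; rewrite -subr_eq0; apply/eqP; apply: (@small_eq0 _ 2) => e e0.
have [n hn] := bnd_tail rho0 fa e0.
have ft : fin rho (a - trunc n a) by exists e.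
have fT := fin_trunc rho0 n a.
have hs := subst2_hom ou ov.
have fin_s b : fin rho b -> fin r (subst2 u v b).
  by move=> [M hb]; exists M; apply: bnd_subst2 hb.
have E1 : pseval a (pseval u p, pseval v p) = pseval (trunc n a) (pseval u p, pseval v p) +
    pseval (a - trunc n a) (pseval u p, pseval v p).
  by rewrite -(evalD rho0 hq fT ft) addrC subrK.
have E2 : pseval (subst2 u v a) p = pseval (subst2 u v (trunc n a)) p +
    pseval (subst2 u v (a - trunc n a)) p.
  by rewrite -(evalD r0 hp (fin_s _ fT) (fin_s _ ft)) -(rhD hs) addrC subrK.
have E3 := eval_subst2_trunc n a r0 hp ou ov bu bv.
have aux (x y t t' z w : R) : x = t' + z -> y = t + w -> t' = t -> x - y = z - w.
  by move=> -> -> ->; ring.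
rewrite (aux _ _ _ _ _ _ E2 E1 E3).
apply: le_trans (ler_normB _ _) _; rewrite mulr_natr mulr2n; apply: lerD.
  by apply: eval_le hp; apply: bnd_subst2 hn.
exact: eval_le hq.
Qed.
End Eval.

(** * Analytic functions of two variables and their differentials *)

Section Analytic2.
Variable R : realType.
Local Notation A := (ps (ps R)).
Implicit Types (a b u v : A) (r s M e : R) (p q : R * R) (F : R * R -> R).

Definition has_series r a F := [/\ 0 < r, fin r a & forall p, `|p| < r -> F p = pseval a p].

Lemma has_series_le r s a F : has_series r a F -> 0 < s -> s <= r -> has_series s a F.
Proof.
move=> [r0 [M fa] h] s0 le; split=> //.
  by exists M; apply: bnd_rad fa _; rewrite (ltW s0).
by move=> p hp; apply: h; apply: lt_le_trans le.
Qed.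

Lemma square_seq (T : nmodType) n (f : nat -> nat -> T) :
  \sum_(i < n) \sum_(j < n) f i j =
  \sum_(q <- [seq (i, j) | i <- iota 0 n, j <- iota 0 n]) f q.1 q.2.
Proof.
have -> : iota 0 n = index_iota 0 n by rewrite /index_iota subn0.
rewrite big_allpairs big_mkord.
by apply: eq_bigr => i _; rewrite big_mkord.
Qed.

(** Summability at the corner of a polydisc is a bound on the norm at that radius. *)
Lemma analytic2_has_series F : analytic2 F -> exists r a, has_series r a F.
Proof.
move=> [a0 [r [r0 h]]]; pose a : A := PS (fun i => PS (a0 i)).
have r20 : 0 < r / 2 by rewrite divr_gt0.
have r2r : r / 2 < r by lra.
have fa : fin (r / 2) a.
  have [|+ _] := h (r / 2, r / 2); first by rewrite norm_pair_lt /= !gtr0_norm // r2r.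
  rewrite /summable; set S := esum _ _ => Sfin.
  have S0 : (0 <= S)%E by apply: esum_ge0.
  exists (fine S) => n.
  rewrite -lee_fin fineK; last by rewrite ge0_fin_numE.
  apply: esum_ge; exists [set` [seq (i, j) | i <- iota 0 n, j <- iota 0 n]].
    by split => //; exact: finite_seq.
  rewrite -fsbig_seq; last by rewrite allpairs_uniq ?iota_uniq // => -[? ?] [? ?].
  rewrite /mass (square_seq n (fun i j => `|cf2 a i j| * (r / 2) ^+ (i + j))) -sumEFin /=; apply: lee_sum => -[i j] _ /=.
  rewrite lee_fin /monomial_term /= -mulrA normrM -exprD.
  by rewrite [`|_ ^+ (i + j)|]ger0_norm // exprn_ge0 // ltW.
exists (r / 2), a; split=> // p hp.
have hr : `|p| < r by apply: lt_trans r2r.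
have [_ hF] := h p hr.
by rewrite (evalP fa (ltW hp) hF).
Qed.

Lemma has_series_analytic2 r a F : has_series r a F -> analytic2 F.
Proof.
move=> [r0 [M ba] hF]; exists (fun i j => cf2 a i j), r; split=> // p hp; split.
  apply: (@le_lt_trans _ _ M%:E); last by rewrite ltry.
  apply: ge_ereal_sup => _ [X [finX _] <-].
  have [s sX] := (finite_seqP X).1 finX.
  have [n hn] : exists n, forall q : nat * nat, q \in s -> (q.1 + q.2 < n)%N.
    exists (\max_(q <- s) (q.1 + q.2)).+1 => q qs; rewrite ltnS.
    exact: (@leq_bigmax_seq _ _ xpredT (fun q : nat * nat => q.1 + q.2)%N).
  apply: (@le_trans _ _ (\sum_(q \in [set` [seq (i, j) | i <- iota 0 n, j <- iota 0 n]])
       `|(monomial_term (fun i j => cf2 a i j) p q)%:E|)%E).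
    apply: lee_fsum_nneg_subset => //; first exact: finite_seq.
    move=> q; rewrite !inE sX /= => qs.
    have := hn q qs.
    case: q qs => i j _ /= le.
    apply: allpairs_f; rewrite mem_iota add0n /=; first exact: leq_ltn_trans (leq_addr _ _) le.
    exact: leq_ltn_trans (leq_addl _ _) le.
  rewrite -fsbig_seq; last by rewrite allpairs_uniq ?iota_uniq // => -[? ?] [? ?].
  rewrite /= sumEFin lee_fin -(square_seq n (fun i j => `|monomial_term _ p (i, j)|)).
  apply: le_trans (ba n); apply: ler_sum => i _; apply: ler_sum => j _.
  by rewrite /monomial_term /= -mulrA normrM ler_wpM2l // mon_le // ltW.
by rewrite hF //; exact: (eval_cvg ba (ltW hp)).
Qed.

Lemma expr_lip (s x y : R) i : `|x| <= s -> `|y| <= s ->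
  s * `|y ^+ i - x ^+ i| <= i%:R * s ^+ i * `|y - x|.
Proof.
move=> hx hy; have s0 : 0 <= s by apply: le_trans hx.
elim: i => [|i IH]; first by rewrite !expr0 subrr normr0 mulr0 !mul0r.
rewrite (_ : y ^+ i.+1 - x ^+ i.+1 = y * (y ^+ i - x ^+ i) + x ^+ i * (y - x)); last first.
  by rewrite !exprS; ring.
apply: (@le_trans _ _ (s * (s * `|y ^+ i - x ^+ i|) + s * (s ^+ i * `|y - x|))).
  rewrite -mulrDr ler_wpM2l // (le_trans (ler_normD _ _)) // !normrM.
  by apply: lerD; rewrite ler_wpM2r // normrX lerXn2r ?nnegrE.
have := ler_wpM2l s0 IH; rewrite exprS -natr1.
set z := s ^+ i; set d := `|y - x|; set w := s * (s * _).
by move=> h; rewrite [leRHS](_ : _ = s * (i%:R * z * d) + s * (z * d)) ?lerD2r //; ring.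
Qed.

(** Taylor's inequality of order two for monomials, multiplied through by [s^2] to avoid
negative exponents; it implies the differentiability of the sum of a series. *)
Lemma expr_rem (s x y : R) i : `|x| <= s -> `|y| <= s ->
  s ^+ 2 * `|y ^+ i - x ^+ i - i%:R * x ^+ i.-1 * (y - x)| <=
  i%:R ^+ 2 * s ^+ i * `|y - x| ^+ 2.
Proof.
move=> hx hy; have s0 : 0 <= s by apply: le_trans hx.
elim: i => [|i IH]; first by rewrite !expr0 subrr !mul0r subr0 normr0 mulr0 expr0n !mul0r.
set rem := _ - _ in IH.
have -> : y ^+ i.+1 - x ^+ i.+1 - i.+1%:R * x ^+ i.+1.-1 * (y - x) =
          y * rem + i%:R * x ^+ i.-1 * (y - x) ^+ 2.
  rewrite /rem -natr1 /= exprS [x ^+ i.+1]exprS.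
  case: (i) => [|m] /=; first by rewrite expr0; ring.
  by rewrite [x ^+ m.+1]exprS; ring.
have h1 : s ^+ 2 * `|i%:R * x ^+ i.-1 * (y - x) ^+ 2| <=
    i%:R * s ^+ i.+1 * `|y - x| ^+ 2.
  rewrite !normrM !normrX normr_nat.
  case: (i) => [|m] /=; first by rewrite !mul0r mulr0.
  rewrite [leLHS](_ : _ = m.+1%:R * (s ^+ 2 * `|x| ^+ m) * `|y - x| ^+ 2); last by ring.
  have -> : s ^+ m.+2 = s ^+ 2 * s ^+ m by rewrite -exprD.
  rewrite ler_wpM2r ?exprn_ge0 // ler_wpM2l // ler_wpM2l ?exprn_ge0 //.
  by rewrite lerXn2r ?nnegrE.
apply: (@le_trans _ _ (s * (s ^+ 2 * `|rem|) + i%:R * s ^+ i.+1 * `|y - x| ^+ 2)).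
  apply: le_trans (ler_wpM2l (exprn_ge0 2 s0) (ler_normD _ _)) _.
  rewrite mulrDr lerD // normrM mulrCA ler_wpM2r // mulr_ge0 ?exprn_ge0 //.
apply: (@le_trans _ _ (s * (i%:R ^+ 2 * s ^+ i * `|y - x| ^+ 2) +
   i%:R * s ^+ i.+1 * `|y - x| ^+ 2)).
  by rewrite lerD2r ler_wpM2l.
rewrite [s ^+ i.+1]exprS -natr1; set z := s ^+ i; set d := `|y - x| ^+ 2.
have zd : 0 <= s * z * d by rewrite !mulr_ge0 ?exprn_ge0.
rewrite -subr_ge0 (_ : _ - _ = (i%:R + 1) * (s * z * d)); last by rewrite /=; ring.
by rewrite mulr_ge0 // addr_ge0.
Qed.

Lemma mon_rem (s : R) p q i j : `|p| <= s -> `|q| <= s ->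
  s ^+ 2 * `|q.1 ^+ i * q.2 ^+ j - p.1 ^+ i * p.2 ^+ j -
    (i%:R * p.1 ^+ i.-1 * p.2 ^+ j * (q.1 - p.1) +
     j%:R * p.1 ^+ i * p.2 ^+ j.-1 * (q.2 - p.2))| <=
  (i + j)%:R ^+ 2 * s ^+ (i + j) * `|q - p| ^+ 2.
Proof.
rewrite !norm_pair_le => /andP[p1 p2] /andP[q1 q2].
have s0 : 0 <= s by apply: le_trans p1.
set D1 := q.1 - p.1; set D2 := q.2 - p.2; set N := `|q - p|.
have D1N : `|D1| <= N by rewrite /N prod_normE le_max lexx.
have D2N : `|D2| <= N by rewrite /N prod_normE le_max lexx orbT.
set X := p.1 ^+ i; set X' := q.1 ^+ i; set Y := p.2 ^+ j; set Y' := q.2 ^+ j.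
have lX := expr_lip i p1 q1; have lY := expr_lip j p2 q2.
have rX := expr_rem i p1 q1; have rY := expr_rem j p2 q2.
rewrite -/X -/X' -/D1 in lX rX; rewrite -/Y -/Y' -/D2 in lY rY.
set remX := X' - X - _ in rX; set remY := Y' - Y - _ in rY.
have -> : X' * Y' - X * Y - (i%:R * p.1 ^+ i.-1 * Y * D1 + j%:R * X * p.2 ^+ j.-1 * D2)
    = (X' - X) * (Y' - Y) + (remX * Y + X * remY) by rewrite /remX /remY; ring.
have hX : `|X| <= s ^+ i by rewrite normrX lerXn2r ?nnegrE.
have hY : `|Y| <= s ^+ j by rewrite normrX lerXn2r ?nnegrE.
have N0 : 0 <= N by rewrite /N.
have sX : 0 <= s ^+ i by rewrite exprn_ge0.
have sY : 0 <= s ^+ j by rewrite exprn_ge0.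
have e1 : s ^+ 2 * `|(X' - X) * (Y' - Y)| <= i%:R * j%:R * s ^+ i * s ^+ j * N ^+ 2.
  rewrite normrM [leLHS](_ : _ = (s * `|X' - X|) * (s * `|Y' - Y|)); last by ring.
  rewrite [leRHS](_ : _ = (i%:R * s ^+ i * N) * (j%:R * s ^+ j * N)); last by ring.
  apply: ler_pM; rewrite ?mulr_ge0 //.
    by apply: le_trans lX _; rewrite ler_wpM2l ?mulr_ge0.
  by apply: le_trans lY _; rewrite ler_wpM2l ?mulr_ge0.
have e2 : s ^+ 2 * `|remX * Y| <= i%:R ^+ 2 * s ^+ i * s ^+ j * N ^+ 2.
  rewrite normrM mulrA [leRHS](_ : _ = i%:R ^+ 2 * s ^+ i * N ^+ 2 * s ^+ j); last by ring.
  apply: ler_pM; rewrite ?mulr_ge0 ?exprn_ge0 //.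
  apply: le_trans rX _; rewrite ler_wpM2l ?mulr_ge0 ?exprn_ge0 //.
  by rewrite lerXn2r ?nnegrE.
have e3 : s ^+ 2 * `|X * remY| <= j%:R ^+ 2 * s ^+ i * s ^+ j * N ^+ 2.
  rewrite normrM mulrCA [leRHS](_ : _ = s ^+ i * (j%:R ^+ 2 * s ^+ j * N ^+ 2)); last by ring.
  apply: ler_pM; rewrite ?mulr_ge0 ?exprn_ge0 //.
  apply: le_trans rY _; rewrite ler_wpM2l ?mulr_ge0 ?exprn_ge0 //.
  by rewrite lerXn2r ?nnegrE.
apply: (@le_trans _ _ (s ^+ 2 * `|(X' - X) * (Y' - Y)| +
   (s ^+ 2 * `|remX * Y| + s ^+ 2 * `|X * remY|))).
  rewrite -!mulrDr ler_wpM2l ?exprn_ge0 // (le_trans (ler_normD _ _)) // lerD2l.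
  exact: ler_normD.
apply: le_trans (lerD e1 (lerD e2 e3)) _; rewrite exprD natrD -subr_ge0.
rewrite (_ : _ - _ = i%:R * j%:R * (s ^+ i * s ^+ j * N ^+ 2)); last by ring.
by rewrite !mulr_ge0 ?exprn_ge0.
Qed.

Lemma expr_sq_le s r : 0 <= s -> s < r ->
  exists2 C, 0 <= C & forall n, n%:R ^+ 2 * s ^+ n <= C * r ^+ n.
Proof.
move=> s0 lt; pose t := (s + r) / 2.
have st : s < t by rewrite /t; lra.
have tr : t < r by rewrite /t; lra.
have t0 : 0 <= t by apply: le_trans s0 (ltW st).
have lin (x y : R) n : 0 <= x -> x < y -> n%:R * x ^+ n <= y / (y - x) * y ^+ n.
  move=> x0 xy; have y0 : 0 <= y by apply: le_trans x0 (ltW xy).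
  apply: (@le_trans _ _ (n.+1%:R * x ^+ n)).
    by rewrite ler_wpM2r ?exprn_ge0 // ler_nat.
  by apply: le_trans (expr_cauchy n x0 xy) _; rewrite exprS mulrAC.
exists (t / (t - s) * (r / (r - t))).
  have r0 : 0 <= r by apply: le_trans (ltW tr).
  by apply: mulr_ge0; apply: divr_ge0 => //; rewrite subr_ge0 ltW.
move=> n; rewrite expr2 -mulrA.
apply: (@le_trans _ _ (n%:R * (t / (t - s) * t ^+ n))).
  by rewrite ler_wpM2l // lin.
rewrite mulrCA -[leRHS]mulrA ler_wpM2l //; last exact: lin.
by apply: divr_ge0 => //; rewrite subr_ge0 ltW.
Qed.

Lemma eval_at0 r a : 0 <= r -> fin r a -> pseval a 0 = cf2 a 0 0.
Proof.
move=> r0 fa; apply: (evalP fa); first by rewrite normr0.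
apply: cvg_near_cst; exists 1%N => // -[//|n] _; apply/eqP.
rewrite /sq big_ord_recl [X in _ + X]big1 ?addr0; last first.
  by move=> i _; rewrite big1 // => j _; rewrite lift0 exprS !(mul0r, mulr0).
rewrite big_ord_recl [X in _ + X]big1 ?addr0; last first.
  by move=> i _; rewrite lift0 exprS !(mul0r, mulr0).
by rewrite !expr0 !mulr1.
Qed.

(** The estimates for monomials are summed with weights: [n^2 s^n] is at most a multiple of
[r^n] for [s < r]. *)
Lemma eval_rem s r M a : 0 < s -> s < r -> bnd r M a ->
  exists C, forall p q, `|p| <= s -> `|q| <= s ->
  `|pseval a q - pseval a p - (pseval (dx a) p * (q.1 - p.1) + pseval (dy a) p * (q.2 - p.2))|
    <= C * `|q - p| ^+ 2.
Proof.
move=> s0 lt ba; have r0 : 0 < r by apply: lt_trans lt.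
have [C C0 hC] := expr_sq_le (ltW s0) lt.
exists (C / s ^+ 2 * M) => p q hp hq.
set N := `|q - p|.
have rp : `|p| <= r by apply: le_trans (ltW lt).
have rq : `|q| <= r by apply: le_trans (ltW lt).
pose L b := pseval b q - pseval b p - (pseval (dx b) p * (q.1 - p.1) + pseval (dy b) p * (q.2 - p.2)).
rewrite -/(L a).
have fdx b : fin r b -> fin s (dx b).
  by move=> [m h]; exists (m / (r - s)); apply: bnd_dx => //; apply: ltW.
have fdy b : fin r b -> fin s (dy b).
  by move=> [m h]; exists (m / (r - s)); apply: bnd_dy => //; apply: ltW.
have LD b c : fin r b -> fin r c -> L (b + c) = L b + L c.
  move=> fb fc; have := (derD (@dxP R) b c, derD (@dyP R) b c) => -[E1 E2].
  rewrite /L E1 E2 (evalD (ltW r0) rp fb fc) (evalD (ltW r0) rq fb fc).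
  by rewrite (evalD (ltW s0) hp (fdx _ fb) (fdx _ fc))
     (evalD (ltW s0) hp (fdy _ fb) (fdy _ fc)); ring.
have fmon c i j : fin r (CC c * vx ^+ i * vy ^+ j).
  by exists (`|c| * r ^+ (i + j)); apply: bnd_mon; apply: ltW.
have L0 : L 0 = 0.
  rewrite /L (der0 (@dxP R)) (der0 (@dyP R)) (eval0 (ltW r0) rp) (eval0 (ltW r0) rq).
  by ring.
have Lsum I (l : seq I) (P : pred I) (G : I -> A) : (forall i, P i -> fin r (G i)) ->
    L (\sum_(i <- l | P i) G i) = \sum_(i <- l | P i) L (G i).
  move=> hG; elim: l => [|i l IH]; first by rewrite !big_nil.
  rewrite !big_cons; case: ifP => // Pi; rewrite LD ?IH //; first exact: hG.
  by apply: fin_sum => //; apply: ltW.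
have Lmon c i j : `|L (CC c * vx ^+ i * vy ^+ j)| <= C / s ^+ 2 * N ^+ 2 * (`|c| * r ^+ (i + j)).
  have dxE : dx (CC c * vx ^+ i * vy ^+ j) = CC (c * i%:R) * vx ^+ i.-1 * vy ^+ j.
    rewrite !(derM (@dxP R)) !(derX (@dxP R)) dxC dxvx dxvy rmorphM rmorph_nat.
    by ring.
  have dyE : dy (CC c * vx ^+ i * vy ^+ j) = CC (c * j%:R) * vx ^+ i * vy ^+ j.-1.
    rewrite !(derM (@dyP R)) !(derX (@dyP R)) dyC dyvx dyvy rmorphM rmorph_nat.
    by ring.
  rewrite /L dxE dyE !(eval_mon (ltW r0) rp) (eval_mon (ltW r0) rq).
  set m := (X in `|X|); have -> : m = c * (q.1 ^+ i * q.2 ^+ j - p.1 ^+ i * p.2 ^+ j -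
    (i%:R * p.1 ^+ i.-1 * p.2 ^+ j * (q.1 - p.1) +
     j%:R * p.1 ^+ i * p.2 ^+ j.-1 * (q.2 - p.2))) by rewrite /m; ring.
  rewrite normrM; have := mon_rem i j hp hq; set w := `|_ - _|.
  move=> h; rewrite [leRHS]mulrCA ler_wpM2l //.
  rewrite [leRHS](_ : _ = (C * r ^+ (i + j) * N ^+ 2) / s ^+ 2); last by ring.
  rewrite ler_pdivlMr ?exprn_gt0 // mulrC; apply: le_trans h _.
  by rewrite ler_wpM2r ?exprn_ge0.
have LT n : `|L (trunc n a)| <= C / s ^+ 2 * N ^+ 2 * M.
  apply: (@le_trans _ _ (C / s ^+ 2 * N ^+ 2 * mass r n a)); last first.
    apply: ler_wpM2l => //; apply: mulr_ge0; last by rewrite exprn_ge0 // /N.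
    by apply: divr_ge0 => //; rewrite exprn_ge0 // ltW.
  rewrite /trunc Lsum => [|i _]; last by apply: fin_sum => //; apply: ltW.
  rewrite (le_trans (ler_norm_sum _ _ _)) // mulr_sumr; apply: ler_sum => i _.
  rewrite Lsum // (le_trans (ler_norm_sum _ _ _)) // mulr_sumr.
  by apply: ler_sum => j _.
rewrite [leRHS](_ : _ = C / s ^+ 2 * N ^+ 2 * M); last by ring.
apply/ler_addgt0Pr => e e0.
pose K := 2 + (`|q.1 - p.1| + `|q.2 - p.2|) / (r - s).
have K0 : 0 < K.
  by apply: ltr_pwDl => //; apply: divr_ge0; [rewrite addr_ge0 | rewrite subr_ge0 ltW].
have d0 : 0 < e / K by rewrite divr_gt0.
have fa : fin r a by exists M.
have [n hn] := bnd_tail (ltW r0) fa d0.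
have ft : fin r (a - trunc n a) by exists (e / K).
have fT := fin_trunc (ltW r0) n a.
have -> : L a = L (trunc n a) + L (a - trunc n a).
  by rewrite -(LD _ _ fT ft) addrC subrK.
apply: le_trans (ler_normD _ _) _; apply: lerD; first exact: LT.
have b1 := eval_le hn rq; have b2 := eval_le hn rp.
have b3 := eval_le (bnd_dx (ltW s0) lt hn) hp.
have b4 := eval_le (bnd_dy (ltW s0) lt hn) hp.
rewrite /L; apply: (@le_trans _ _ (e / K + e / K +
   (e / K / (r - s) * `|q.1 - p.1| + e / K / (r - s) * `|q.2 - p.2|))).
  apply: le_trans (ler_normB _ _) _; apply: lerD.
    by apply: le_trans (ler_normB _ _) _; apply: lerD.
  apply: le_trans (ler_normD _ _) _; rewrite !normrM; apply: lerD;
    by rewrite ler_wpM2r.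
rewrite [leLHS](_ : _ = e / K * K); last by rewrite /K; ring.
by rewrite divfK // gt_eqF.
Qed.

Definition lin2 (c d : R) (u : R * R) : R := c * u.1 + d * u.2.
Fact lin2_linear c d : linear (lin2 c d).
Proof.
move=> k [x y] [z t]; rewrite /lin2 /=.
have E (w w' : R) : w *: w' = w * w' by [].
by rewrite !E; ring.
Qed.
HB.instance Definition _ c d :=
  GRing.isLinear.Build R (R * R)%type R *:%R (lin2 c d) (lin2_linear c d).

Lemma lin2_continuous c d : continuous (lin2 c d).
Proof.
by move=> p; apply: cvgD; apply: cvgMr; [exact: cvg_fst | exact: cvg_snd].
Qed.

(** The second-order estimate [eval_rem] says that the sum is differentiable with
differential given by the sums of the formal partial derivatives. *)
Lemma has_series_diff r a F p : has_series r a F -> `|p| < r ->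
  differentiable F p /\ 'd F p = lin2 (pseval (dx a) p) (pseval (dy a) p) :> (R * R -> R).
Proof.
move=> [r0 [M ba] hF] hp.
pose s := (`|p| + r) / 2.
have ps : `|p| < s by rewrite /s; lra.
have sr : s < r by rewrite /s; lra.
have s0 : 0 < s by apply: le_lt_trans ps.
have [C hC] := eval_rem s0 sr ba.
pose df : {linear (R * R)%type -> R} := lin2 (pseval (dx a) p) (pseval (dy a) p).
have E : F \o shift p = cst (F p) + df +o_ (0 : R * R) id.
  apply/eqaddoP => e e0.
  have C1 : 0 < `|C| + 1 by rewrite ltr_wpDl.
  have d0 : 0 < Num.min (s - `|p|) (e / (`|C| + 1)).
    by rewrite lt_min subr_gt0 ps divr_gt0.
  apply/nbhs_ballP; exists (Num.min (s - `|p|) (e / (`|C| + 1))) => //= h.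
  rewrite -ball_normE /= sub0r normrN lt_min => /andP[h1 h2].
  have hs : `|h + p| <= s.
    by apply: le_trans (ler_normD _ _) _; rewrite -lerBrDr ltW.
  rewrite !fctE /= hF ?hF //; last exact: le_lt_trans hs sr.
  have B := hC p (h + p) (ltW ps) hs.
  have E1 : (h + p).1 - p.1 = h.1 by rewrite -[(h + p).1]/(h.1 + p.1) addrK.
  have E2 : (h + p).2 - p.2 = h.2 by rewrite -[(h + p).2]/(h.2 + p.2) addrK.
  have E3 : h + p - p = h by rewrite addrK.
  rewrite E1 E2 E3 in B.
  rewrite opprD addrA; apply: le_trans B _.
  rewrite expr2 mulrA ler_wpM2r //.
  apply: (@le_trans _ _ ((`|C| + 1) * `|h|)).
    by rewrite ler_wpM2r // (le_trans (ler_norm _)) // lerDl.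
  by rewrite mulrC -ler_pdivlMr // ltW.
have dE : 'd F p = df :> (R * R -> R).
  have dfc : continuous df := @lin2_continuous _ _.
  have := @diff_unique _ _ _ F df p dfc E. exact.
split=> //; apply/diff_locallyP; rewrite dE; split=> //; exact: lin2_continuous.
Qed.

(** The constant term is the value at 0, and the other coefficients are reached by
differentiating, which preserves the hypothesis on a smaller polydisc. *)
Lemma eval_inj0 r a : 0 < r -> fin r a -> (forall p, `|p| < r -> pseval a p = 0) -> a = 0.
Proof.
move=> r0 fa h.
suff H : forall i j r a, 0 < r -> fin r a -> (forall p, `|p| < r -> pseval a p = 0) ->
    cf2 a i j = 0 by apply: cf2P => i j; rewrite (H i j r a).
have step b t : 0 < t -> fin t b -> (forall p, `|p| < t -> pseval b p = 0) ->
    forall p, `|p| < t / 2 -> pseval (dx b) p = 0 /\ pseval (dy b) p = 0.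
  move=> t0 fb hb p hp.
  have hp' : `|p| < t by apply: lt_trans hp _; lra.
  have rb : has_series t b (cst 0) by split=> // q hq; rewrite hb.
  have [_ E] := has_series_diff rb hp'.
  have E0 : 'd (cst 0 : R * R -> R) p = (fun=> 0) :> (R * R -> R) by rewrite diff_cst.
  rewrite E0 in E.
  have := congr1 (fun g => g (1, 0)) E; have := congr1 (fun g => g (0, 1)) E.
  by rewrite /lin2 /= !mulr1 !mulr0 addr0 add0r.
elim=> [|i IH].
  elim=> [|j IH] t b t0 fb hb; first by rewrite -(eval_at0 (ltW t0) fb) hb // normr0.
  have t2 : 0 < t / 2 by rewrite divr_gt0.
  have : cf2 (dy b) 0 j = 0.
    apply: (IH (t / 2)) => //; last by move=> p hp; have [] := step b t t0 fb hb p hp.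
    by case: fb => m hm; exists (m / (t - t / 2)); apply: bnd_dy => //; lra.
  by move/eqP; rewrite cf2_dy mulf_eq0 pnatr_eq0 /= => /eqP.
move=> j t b t0 fb hb; have t2 : 0 < t / 2 by rewrite divr_gt0.
have : cf2 (dx b) i j = 0.
  apply: (IH _ (t / 2)) => //; last by move=> p hp; have [] := step b t t0 fb hb p hp.
  by case: fb => m hm; exists (m / (t - t / 2)); apply: bnd_dx => //; lra.
by move/eqP; rewrite cf2_dx mulf_eq0 pnatr_eq0 /= => /eqP.
Qed.

Lemma eval_inj r a b : 0 < r -> fin r a -> fin r b ->
  (forall p, `|p| < r -> pseval a p = pseval b p) -> a = b.
Proof.
move=> r0 fa fb h; apply/eqP; rewrite -subr_eq0; apply/eqP.
apply: (@eval_inj0 r) => // [|p hp]; first exact: (finB (ltW r0)).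
by rewrite (evalB (ltW r0) (ltW hp)) // h // subrr.
Qed.
End Analytic2.

(** * Analytic inverses, and germs as convergent series *)

Section InverseMap.
Variable R : realType.
Local Notation A := (ps (ps R)).
Implicit Types (a b u v P Q : A).

(** The inverse of [id + N], with [N] of order two, is the fixed point of
[phi -> id - N o phi]; each iteration gains one order. *)
Lemma inverse_step N z n u v u' v' : ord 2 N -> ord 1 u -> ord 1 v -> ord 1 u' ->
  ord 1 v' -> (0 < n)%N -> eqm n u u' -> eqm n v v' ->
  eqm n.+1 (z - subst2 u v N) (z - subst2 u' v' N).
Proof.
move=> oN ou ov ou' ov' n0 hu hv; rewrite -addn1.
have h : eqm (n + 1) (subst2 u v N) (subst2 u' v' N) by apply: subst2_eqm.
by apply: eqmD; [apply: eqm_refl | apply: eqmN].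
Qed.

Section Iter.
Variables (N1 N2 : A) (c1 : convergent N1) (c2 : convergent N2) (o1 : ord 2 N1) (o2 : ord 2 N2).

Fixpoint inv_iter m : A * A :=
  if m is m'.+1 then
    let: (P, Q) := inv_iter m' in (vx - subst2 P Q N1, vy - subst2 P Q N2)
  else (vx, vy).

Lemma inv_iterS m : inv_iter m.+1 =
  (vx - subst2 (inv_iter m).1 (inv_iter m).2 N1,
   vy - subst2 (inv_iter m).1 (inv_iter m).2 N2).
Proof. by rewrite /=; case: (inv_iter m). Qed.

Lemma inv_iter_ord m : ord 1 (inv_iter m).1 /\ ord 1 (inv_iter m).2.
Proof.
elim: m => [|m [IH1 IH2]]; first by split; [exact: ord_vx | exact: ord_vy].
rewrite inv_iterS; split=> /=; apply: ordB; try exact: ord_vx; try exact: ord_vy;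
  apply: (@ord_le _ _ 2) => //; exact: subst2_ord.
Qed.

Lemma inv_iter_eqm m : eqm m.+2 (inv_iter m).1 (inv_iter m.+1).1 /\
  eqm m.+2 (inv_iter m).2 (inv_iter m.+1).2.
Proof.
elim: m => [|m [IH1 IH2]].
  have sub_eqm (z w : A) : ord 2 w -> eqm 2 z (z - w).
    by move=> hw; rewrite /eqm (_ : z - (z - w) = w) //; ring.
  rewrite inv_iterS; split=> /=; apply: sub_eqm;
    apply: subst2_ord => //; try exact: ord_vx; exact: ord_vy.
have [h1 h2] := inv_iter_ord m; have [h3 h4] := inv_iter_ord m.+1.
have E1 n : (inv_iter n.+1).1 = vx - subst2 (inv_iter n).1 (inv_iter n).2 N1.
  by rewrite inv_iterS.
have E2 n : (inv_iter n.+1).2 = vy - subst2 (inv_iter n).1 (inv_iter n).2 N2.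
  by rewrite inv_iterS.
by split; [rewrite (E1 m.+1) {1}(E1 m) | rewrite (E2 m.+1) {1}(E2 m)]; apply: inverse_step.
Qed.

Lemma inv_iter_stable m n : (m <= n)%N ->
  eqm m.+1 (inv_iter m).1 (inv_iter n).1 /\ eqm m.+1 (inv_iter m).2 (inv_iter n).2.
Proof.
elim: n => [|n IH]; first by rewrite leqn0 => /eqP ->; split; exact: eqm_refl.
rewrite leq_eqVlt => /orP[/eqP <-|le]; first by split; exact: eqm_refl.
have [h1 h2] := IH le; have [h3 h4] := inv_iter_eqm n.
split; [apply: eqm_trans h1 _ | apply: eqm_trans h2 _];
  by [apply: eqm_le h3; rewrite ltnS ltnW | apply: eqm_le h4; rewrite ltnS ltnW].
Qed.

(** The iterates stabilise: the coefficient of bidegree [(i, j)] is final from step [i + j]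
on. *)
Definition inv1 : A := PS (fun i => PS (fun j => cf2 (inv_iter (i + j)).1 i j)).
Definition inv2 : A := PS (fun i => PS (fun j => cf2 (inv_iter (i + j)).2 i j)).

Lemma inv_eqm m : eqm m.+1 inv1 (inv_iter m).1 /\ eqm m.+1 inv2 (inv_iter m).2.
Proof.
split; split=> i j lt; have [h1 h2] := @inv_iter_stable (i + j) m lt.
  by have := ordE h1 (ltnSn _); rewrite !cf2B.
by have := ordE h2 (ltnSn _); rewrite !cf2B.
Qed.

Lemma inv_ord : ord 1 inv1 /\ ord 1 inv2.
Proof.
have [h1 h2] := inv_eqm 0; have [h3 h4] := inv_iter_ord 0.
split; apply/eqm_ord; [apply: eqm_trans h1 _ | apply: eqm_trans h2 _]; exact/eqm_ord.
Qed.

Lemma inv_fix : inv1 = vx - subst2 inv1 inv2 N1 /\ inv2 = vy - subst2 inv1 inv2 N2.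
Proof.
have [k1 k2] := inv_ord.
split; apply: eqm_inj => -[|m]; try exact: ord_triv; have [h1 h2] := inv_eqm m;
  have [h3 h4] := inv_eqm m.+1; have [k3 k4] := inv_iter_ord m; rewrite inv_iterS in h3 h4.
  apply: eqm_trans (eqm_le (ltnW (ltnSn _)) h3) _.
  by apply: (eqm_le (ltnW (ltnSn _))); apply: inverse_step => //; apply: eqm_sym.
apply: eqm_trans (eqm_le (ltnW (ltnSn _)) h4) _.
by apply: (eqm_le (ltnW (ltnSn _))); apply: inverse_step => //; apply: eqm_sym.
Qed.

(** On a small polydisc the iterates stay bounded uniformly, and a coefficientwise bound
passes to the limit since each coefficient is eventually constant. *)
Lemma inv_convergent : convergent inv1 /\ convergent inv2.
Proof.
have [rho [M rho0 [b1 b2]]] := convergentP2 c1 c2.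
have M0 := bnd_ge0 b1.
(* With [r = t rho / 2], the second-order terms are at most [t^2 M <= r] at radius [2 r],
   so iterates of norm at most [2 r] produce iterates of norm at most [r + r]. *)
pose t := Num.min 1 (rho / (2 * (M + 1))).
have M1 : 0 < M + 1 by rewrite ltr_wpDl.
have t0 : 0 < t by rewrite lt_min ltr01 divr_gt0 // mulr_gt0.
have t1 : 0 <= t <= 1 by rewrite (ltW t0) ge_min lexx.
pose r := t * rho / 2.
have r0 : 0 < r by rewrite divr_gt0 // mulr_gt0.
have rr : t * rho = r + r by rewrite /r; lra.
have small : t ^+ 2 * M <= r.
  rewrite /r expr2 -!mulrA ler_wpM2l ?(ltW t0) //.
  apply: (@le_trans _ _ (rho / (2 * (M + 1)) * (M + 1))).
    apply: ler_pM => //; first exact: ltW.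
      by rewrite ge_min lexx orbT.
    by rewrite lerDl.
  by rewrite invfM mulrA mulfVK // gt_eqF.
have bN N : ord 2 N -> bnd rho M N -> bnd (r + r) r N.
  by move=> oN bN; rewrite -rr; apply: bnd_le (bnd_ord (ltW rho0) bN oN t1) small.
have bi m : bnd r (r + r) (inv_iter m).1 /\ bnd r (r + r) (inv_iter m).2.
  elim: m => [|m [IH1 IH2]].
    split=> /=; (apply: (@bnd_le _ _ r); last by rewrite lerDl ltW);
      [apply: bnd_vx | apply: bnd_vy]; exact: ltW.
  have [k1 k2] := inv_iter_ord m.
  rewrite inv_iterS; split=> /=; apply: bndD; rewrite ?(ltW r0) //.
  - by apply: bnd_vx; apply: ltW.
  - by apply: bndN; apply: (@bnd_subst2 _ r (r + r)); rewrite ?(ltW r0) //; apply: bN.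
  - by apply: bnd_vy; apply: ltW.
  - by apply: bndN; apply: (@bnd_subst2 _ r (r + r)); rewrite ?(ltW r0) //; apply: bN.
split; exists r, (r + r) => // n.
  have [h _] := inv_eqm (n + n); have [b _] := bi (n + n)%N.
  apply: le_trans (b n); rewrite le_eqVlt; apply/orP; left; apply/eqP.
  apply: eq_bigr => i _; apply: eq_bigr => j _; congr (`|_| * _).
  apply/eqP; rewrite -subr_eq0 -cf2B (ordE h) //.
  by move: (ltn_ord i) (ltn_ord j); lia.
have [_ h] := inv_eqm (n + n); have [_ b] := bi (n + n)%N.
apply: le_trans (b n); rewrite le_eqVlt; apply/orP; left; apply/eqP.
apply: eq_bigr => i _; apply: eq_bigr => j _; congr (`|_| * _).
apply/eqP; rewrite -subr_eq0 -cf2B (ordE h) //.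
by move: (ltn_ord i) (ltn_ord j); lia.
Qed.
End Iter.

(** Changes of variables tangent to the identity: these suffice here, and their inverses
need no linear algebra. *)
Definition near_id u v := [/\ convergent u, convergent v, ord 2 (u - vx) & ord 2 (v - vy)].

Lemma near_id_ord u v : near_id u v -> ord 1 u /\ ord 1 v.
Proof.
move=> [_ _ h1 h2]; split.
  by rewrite -(subrK vx u); apply: ordD; [apply: ord_le h1 | exact: ord_vx].
by rewrite -(subrK vy v); apply: ordD; [apply: ord_le h2 | exact: ord_vy].
Qed.

Lemma near_id_right_inverse u v : near_id u v ->
  exists P Q, [/\ near_id P Q, subst2 P Q u = vx & subst2 P Q v = vy].
Proof.
move=> [cu cv ou ov]; pose N1 := u - vx; pose N2 := v - vy.
have c1 : convergent N1 by apply: convergentB => //; exact: convergent_vx.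
have c2 : convergent N2 by apply: convergentB => //; exact: convergent_vy.
have [h1 h2] := inv_ord ou ov; have [f1 f2] := inv_fix ou ov.
have [k1 k2] := inv_convergent c1 c2 ou ov.
have hs := subst2_hom h1 h2.
exists (inv1 N1 N2), (inv2 N1 N2); split.
- split=> //.
    by rewrite {1}f1 addrAC subrr add0r; apply: ordN; apply: subst2_ord.
  by rewrite {1}f2 addrAC subrr add0r; apply: ordN; apply: subst2_ord.
- have -> : u = vx + N1 by rewrite /N1 addrC subrK.
  by rewrite (rhD hs) subst2_vx // {1}f1 subrK.
- have -> : v = vy + N2 by rewrite /N2 addrC subrK.
  by rewrite (rhD hs) subst2_vy // {1}f2 subrK.
Qed.

(** The right inverse has a right inverse as well, which must be the original map. *)
Lemma near_id_inverse u v : near_id u v ->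
  exists P Q, [/\ near_id P Q, subst2 P Q u = vx, subst2 P Q v = vy,
    subst2 u v P = vx & subst2 u v Q = vy].
Proof.
move=> huv; have [P [Q [hPQ e1 e2]]] := near_id_right_inverse huv.
have [u' [v' [huv' e3 e4]]] := near_id_right_inverse hPQ.
have [ou ov] := near_id_ord huv; have [oP oQ] := near_id_ord hPQ.
have [ou' ov'] := near_id_ord huv'.
have eu : u = u'.
  by rewrite -[u]subst2_id -e3 -e4 -subst2_comp // e1 subst2_vx.
have ev : v = v'.
  by rewrite -[v]subst2_id -e3 -e4 -subst2_comp // e2 subst2_vy.
by exists P, Q; split=> //; rewrite eu ev.
Qed.
End InverseMap.

Section Germ.
Variable R : realType.
Local Notation A := (ps (ps R)).
Implicit Types (a b u v : A) (F G : R * R -> R) (psi : R * R -> R * R).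

Lemma near0P (V : normedModType R) (P : V -> Prop) :
  (\forall p \near (0 : V), P p) <-> exists2 r : R, 0 < r & forall p, `|p| < r -> P p.
Proof.
split=> [/nbhs_ballP [r r0 h]|[r r0 h]].
  exists r => // p hp; apply: h.
  by rewrite -ball_normE /= sub0r normrN.
apply/nbhs_ballP; exists r => // p; rewrite -ball_normE /= sub0r normrN; exact: h.
Qed.

(** The dictionary between analytic germs and formal series. *)
Definition germ a F := exists r, has_series r a F.

Lemma germ_convergent a F : germ a F -> convergent a.
Proof. by move=> [r [r0 [M h] _]]; exists r, M. Qed.

Lemma convergent_germ a : convergent a -> germ a (pseval a).
Proof. by move=> [r [M r0 h]]; exists r; split=> //; exists M. Qed.

Lemma germ_analytic2 a F : germ a F -> analytic2 F.
Proof. by move=> [r h]; apply: has_series_analytic2 h. Qed.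

Lemma analytic2_germ F : analytic2 F -> exists a, germ a F.
Proof. by move=> /analytic2_has_series [r [a h]]; exists a, r. Qed.

Lemma germ_near a F G : germ a F -> (\forall p \near (0 : R * R), F p = G p) -> germ a G.
Proof.
move=> [r h] /near0P [s s0 e]; exists (Num.min r s).
have [r0 _ _] := h; have m0 : 0 < Num.min r s by rewrite lt_min r0.
have [_ fa hF] : has_series (Num.min r s) a F by apply: has_series_le h _ _; rewrite // ge_min lexx.
split=> // p hp; rewrite -hF // e //.
by apply: lt_le_trans hp _; rewrite ge_min lexx orbT.
Qed.

Lemma germ2 a b F G : germ a F -> germ b G -> exists r, has_series r a F /\ has_series r b G.
Proof.
move=> [r h] [s h']; exists (Num.min r s).
have [r0 _ _] := h; have [s0 _ _] := h'.
have m0 : 0 < Num.min r s by rewrite lt_min r0.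
by split; [apply: has_series_le h _ _ | apply: has_series_le h' _ _] => //; rewrite ge_min lexx ?orbT.
Qed.

Lemma germ_inj a b F G : germ a F -> germ b G ->
  (\forall p \near (0 : R * R), F p = G p) -> a = b.
Proof.
move=> ha hb e; have ha' := germ_near ha e.
have [r [[r0 fa h1] [_ fb h2]]] := germ2 ha' hb.
by apply: (@eval_inj _ r) => // p hp; rewrite -h1 // h2.
Qed.

Lemma germ_eq a F G : germ a F -> germ a G -> \forall p \near (0 : R * R), F p = G p.
Proof.
move=> ha hb; have [r [[r0 fa h1] [_ fb h2]]] := germ2 ha hb.
by apply/near0P; exists r => // p hp; rewrite h1 // h2.
Qed.

Lemma germD a b F G : germ a F -> germ b G -> germ (a + b) (fun p => F p + G p).
Proof.
move=> ha hb; have [r [[r0 fa h1] [_ fb h2]]] := germ2 ha hb.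
exists r; split=> // [|p hp]; first exact: (finD (ltW r0)).
by rewrite h1 // h2 // (evalD (ltW r0) (ltW hp)).
Qed.

Lemma germM a b F G : germ a F -> germ b G -> germ (a * b) (fun p => F p * G p).
Proof.
move=> ha hb; have [r [[r0 fa h1] [_ fb h2]]] := germ2 ha hb.
exists r; split=> // [|p hp]; first exact: (finM (ltW r0)).
by rewrite h1 // h2 // (evalM (ltW r0) (ltW hp)).
Qed.

Lemma germC c : germ (CC c) (fun=> c).
Proof.
exists 1; split=> // [|p hp]; first exact: finC.
by rewrite (evalC ler01 (ltW hp)).
Qed.

Lemma germX a F n : germ a F -> germ (a ^+ n) (fun p => F p ^+ n).
Proof.
move=> ha; elim: n => [|n IH].
  rewrite expr0 -(rmorph1 (@CC R)); apply: germ_near (germC 1) _.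
  by apply/near0P; exists 1 => // p _; rewrite expr0.
rewrite exprS; apply: germ_near (germM ha IH) _; apply/near0P; exists 1 => // p _.
by rewrite exprS.
Qed.

Lemma germ_sum n (a : 'I_n -> A) (F : 'I_n -> R * R -> R) :
  (forall i, germ (a i) (F i)) -> germ (\sum_i a i) (fun p => \sum_i F i p).
Proof.
elim: n a F => [|n IH] a F h.
  rewrite big_ord0 -(rmorph0 (@CC R)); apply: germ_near (germC 0) _.
  by apply/near0P; exists 1 => // p _; rewrite big_ord0.
rewrite big_ord_recl.
apply: germ_near (germD (h ord0) (IH _ _ (fun i => h (lift ord0 i)))) _.
by apply/near0P; exists 1 => // p _; rewrite big_ord_recl.
Qed.

Lemma germ_fst : germ vx (fun p => p.1).
Proof.
exists 1; split=> // [|p hp]; first exact: fin_vx.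
by rewrite (eval_vx ler01 (ltW hp)).
Qed.
Lemma germ_snd : germ vy (fun p => p.2).
Proof.
exists 1; split=> // [|p hp]; first exact: fin_vy.
by rewrite (eval_vy ler01 (ltW hp)).
Qed.

Lemma germ_at0 a F : germ a F -> F 0 = cf2 a 0 0.
Proof.
by move=> [r [r0 fa h]]; rewrite h ?normr0 // (eval_at0 (ltW r0)).
Qed.

(** [ord 1] says that the map fixes the origin. *)
Definition is_emap psi u v :=
  [/\ germ u (fun p => (psi p).1), germ v (fun p => (psi p).2), ord 1 u & ord 1 v].

Lemma emap_analytic psi u v : is_emap psi u v -> analytic_map psi /\ psi 0 = 0.
Proof.
move=> [gu gv ou ov]; split.
  by split; [apply: germ_analytic2 gu | apply: germ_analytic2 gv].
have := germ_at0 gu; have := germ_at0 gv; rewrite (ordE ou) // (ordE ov) //.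
by case: (psi 0) => x y /= -> ->.
Qed.

Lemma analytic_emap psi : analytic_map psi -> psi 0 = 0 -> exists u v, is_emap psi u v.
Proof.
move=> [/analytic2_germ [u gu] /analytic2_germ [v gv]] psi0.
exists u, v; split=> //; apply: ord1P.
  by rewrite -(germ_at0 gu) psi0.
by rewrite -(germ_at0 gv) psi0.
Qed.

Lemma convergent_emap u v : convergent u -> convergent v -> ord 1 u -> ord 1 v ->
  is_emap (fun p => (pseval u p, pseval v p)) u v.
Proof. by move=> cu cv ou ov; split=> //; apply: convergent_germ. Qed.

Lemma emap_small psi u v (rho : R) : is_emap psi u v -> 0 < rho ->
  exists2 r, 0 < r & [/\ bnd r rho u, bnd r rho v &
    forall p, `|p| < r -> psi p = (pseval u p, pseval v p)].
Proof.
move=> [gu gv ou ov] rho0.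
have [r [[r0 _ h1] [_ _ h2]]] := germ2 gu gv.
have [s s0 hs] := convergent_small2 (germ_convergent gu) ou (germ_convergent gv) ov rho0.
have m0 : 0 < Num.min r s by rewrite lt_min r0.
have [bu bv] : bnd (Num.min r s) rho u /\ bnd (Num.min r s) rho v.
  by apply: hs; rewrite (ltW m0) ge_min lexx orbT.
exists (Num.min r s) => //; split=> // p; rewrite lt_min => /andP[hp _].
by rewrite -h1 // -h2 //; case: (psi p).
Qed.

Lemma emap_near psi u v (P : R * R -> Prop) : is_emap psi u v ->
  (\forall p \near (0 : R * R), P p) -> \forall p \near (0 : R * R), P (psi p).
Proof.
move=> he /near0P [rho rho0 hP].
have r20 : 0 < rho / 2 by rewrite divr_gt0.
have [r r0 [bu bv hpsi]] := emap_small he r20.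
apply/near0P; exists r => // p hp; apply: hP; rewrite hpsi //.
apply: (@le_lt_trans _ _ (rho / 2)); last by lra.
by rewrite norm_pair_le /= (eval_le bu (ltW hp)) (eval_le bv (ltW hp)).
Qed.

Lemma germ_emap a F psi u v : germ a F -> is_emap psi u v ->
  germ (subst2 u v a) (fun p => F (psi p)).
Proof.
move=> [rho [rho0 fa hF]] he; have [_ _ ou ov] := he.
have r20 : 0 < rho / 2 by rewrite divr_gt0.
have [r r0 [bu bv hpsi]] := emap_small he r20.
have fa2 : fin (rho / 2) a.
  by case: fa => M ba; exists M; apply: bnd_rad ba _; apply/andP; split; lra.
exists r; split=> // [|p hp].
  by case: fa2 => M ba; exists M; apply: bnd_subst2 ba => //; apply: ltW.
rewrite hpsi // (eval_subst2 (ltW r0) (ltW hp) ou ov bu bv fa2) hF //.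
apply: (@le_lt_trans _ _ (rho / 2)); last by lra.
by rewrite norm_pair_le /= (eval_le bu (ltW hp)) (eval_le bv (ltW hp)).
Qed.

Lemma emap_comp psi psi' u v u' v' : is_emap psi u v -> is_emap psi' u' v' ->
  is_emap (fun p => psi' (psi p)) (subst2 u v u') (subst2 u v v').
Proof.
move=> he [gu' gv' ou' ov']; have [_ _ ou ov] := he.
split; [exact: germ_emap gu' he | exact: germ_emap gv' he | exact: subst2_ord..].
Qed.

Lemma germ_deriv a F : germ a F -> \forall p \near (0 : R * R),
  differentiable F p /\ 'd F p = lin2 (pseval (dx a) p) (pseval (dy a) p) :> (R * R -> R).
Proof.
move=> [r h]; apply/near0P; have [r0 _ _] := h; exists r => // p hp.
exact: has_series_diff h hp.
Qed.

(** The differential in the sense of the definition of the pull-back is the formal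
Jacobian matrix. *)
Lemma emap_diff psi u v : is_emap psi u v -> \forall p \near (0 : R * R),
  forall w, 'd psi p w = (lin2 (pseval (dx u) p) (pseval (dy u) p) w,
                          lin2 (pseval (dx v) p) (pseval (dy v) p) w).
Proof.
move=> [gu gv _ _]; near=> p.
have [d1 e1] : differentiable (fun p => (psi p).1) p /\
    'd (fun p => (psi p).1) p = lin2 (pseval (dx u) p) (pseval (dy u) p) :> (R * R -> R).
  by near: p; exact: germ_deriv.
have [d2 e2] : differentiable (fun p => (psi p).2) p /\
    'd (fun p => (psi p).2) p = lin2 (pseval (dx v) p) (pseval (dy v) p) :> (R * R -> R).
  by near: p; exact: germ_deriv.
have -> : psi = fun p => ((psi p).1, (psi p).2) by apply/funext => q; case: (psi q).
by move=> w; rewrite (diff_pair d1 d2) e1 e2.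
Unshelve. all: by end_near. Qed.

Lemma near_id_diffeo u v : near_id u v -> exists psi,
  is_emap psi u v /\ diffeo_germ psi.
Proof.
move=> h; have [ou ov] := near_id_ord h.
have [P [Q [hPQ e1 e2 e3 e4]]] := near_id_inverse h.
have [oP oQ] := near_id_ord hPQ.
have [cu cv _ _] := h; have [cP cQ _ _] := hPQ.
pose psi p := (pseval u p, pseval v p); pose phi p := (pseval P p, pseval Q p).
have epsi : is_emap psi u v by apply: convergent_emap.
have ephi : is_emap phi P Q by apply: convergent_emap.
have [an0 psi0] := emap_analytic epsi; have [an1 phi0] := emap_analytic ephi.
have inv_of f (f' : R * R -> R * R) : is_emap (fun p => f (f' p)) vx vy ->
    \forall p \near (0 : R * R), f (f' p) = p.
  move=> [g1 g2 _ _]; have n1 := germ_eq g1 germ_fst; have n2 := germ_eq g2 germ_snd.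
  near=> p; have E1 : (f (f' p)).1 = p.1 by near: p.
  have E2 : (f (f' p)).2 = p.2 by near: p.
  by rewrite [LHS]surjective_pairing E1 E2 -surjective_pairing.
exists psi; split=> //; split=> //; exists phi; split=> //.
  by apply: inv_of; rewrite -{1}e3 -e4; apply: emap_comp.
by apply: inv_of; rewrite -{1}e1 -e2; apply: emap_comp.
Unshelve. all: by end_near. Qed.
End Germ.

(** * The Brieskorn module of the singularity *)

Section Decomposition.
Variables (R : realType) (k : nat) (e : R).
Hypotheses (hk : (2 <= k)%N) (he : e * e = 1).
Local Notation A := (ps (ps R)).
Implicit Types (a b h g F G : A).

(** The model singularity. *)
Definition ff : A := vy ^+ 2 + CC e * vx ^+ k.
Definition series_at (w : A) (c : ps R) : A := psubst (@CC R) w c.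

Lemma dx_ff : dx ff = CC e * k%:R * vx ^+ k.-1.
Proof.
rewrite /ff (derD (@dxP R)) (derM (@dxP R) (CC e)) !(derX (@dxP R)) dxC dxvx dxvy; ring.
Qed.
Lemma dy_ff : dy ff = 2%:R * vy.
Proof.
rewrite /ff (derD (@dyP R)) (derM (@dyP R) (CC e)) !(derX (@dyP R)) dyC dyvx dyvy expr1; ring.
Qed.

Lemma ord_ff : ord 1 ff.
Proof.
apply: ordD; first by apply: (@ord_le _ _ 2) => //; apply: ordX; exact: ord_vy.
apply: ordMl; apply: (@ord_le _ _ k); first exact: ltnW.
by apply: ordX; exact: ord_vx.
Qed.

Lemma convergent_ff : convergent ff.
Proof.
apply: convergentD; first by apply: convergentX; exact: convergent_vy.
by apply: convergentM; [exact: convergentC | apply: convergentX; exact: convergent_vx].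
Qed.

Lemma subst2_psC u v c : ord 1 u -> ord 1 v -> subst2 u v (psC c) = series_at v c.
Proof.
by move=> hu hv; apply: psubst_C => //; apply: psubst_hom => //; exact: CC_rhom.
Qed.

(** Functions of [f] Poisson-commute with [f], so that the bracket with [f] is linear
over them. *)
Lemma pb_series_at c : pb (series_at ff c) ff = 0.
Proof.
have of_ := ord_ff.
have CD : {morph @CC R : a b / a + b} by move=> a b; rewrite rmorphD.
have hx := psubst_der c of_ CD (@dxP R) (@ord_dx R).
have hy := psubst_der c of_ CD (@dyP R) (@ord_dy R).
have z d : (forall c : R, d (CC c) = 0) -> psubst (d \o @CC R) ff c = 0.
  move=> hd; apply: (psubstP of_) => n.
  rewrite big1 => [|l _]; [exact: eqm_refl | by rewrite /= hd mul0r].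
rewrite (z _ (@dxC R)) in hx; rewrite (z _ (@dyC R)) in hy.
by rewrite /pb /series_at hx hy !add0r; ring.
Qed.

(** This polynomial in the variables [(x, y)] becomes [xi^2] when [y] is replaced by [f]. *)
Definition ym : A := vy - CC e * vx ^+ k.
Definition yp : A := vy + CC e * vx ^+ k.
Lemma ord_xk : ord 1 (CC e * vx ^+ k).
Proof.
apply: ordMl; apply: (@ord_le _ _ k); first exact: ltnW.
by apply: ordX; exact: ord_vx.
Qed.
Lemma ord_ym : ord 1 ym.
Proof. by apply: ordB; [exact: ord_vy | exact: ord_xk]. Qed.
Lemma ord_yp : ord 1 yp.
Proof. by apply: ordD; [exact: ord_vy | exact: ord_xk]. Qed.
Lemma ord_vy2 : ord 1 (vy ^+ 2 : A).
Proof. by apply: (@ord_le _ _ 2) => //; apply: ordX; exact: ord_vy. Qed.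
Local Notation ox := (@ord_vx R).

Lemma subst_lin u w : ord 1 u -> ord 1 w ->
  subst2 u w ym = w - CC e * u ^+ k /\ subst2 u w yp = w + CC e * u ^+ k.
Proof.
move=> hu hw; have hs := subst2_hom hu hw.
have E : subst2 u w (CC e * vx ^+ k) = CC e * u ^+ k.
  by rewrite (rhM hs (CC e)) (rhX hs vx k) (subst2_CC hu hw e) (subst2_vx hu hw).
by rewrite /ym /yp (rhB hs vy) (rhD hs vy) E (subst2_vy hu hw).
Qed.

Lemma subst_ff_ym a : subst2 vx ff (subst2 vx ym a) = subst2 vx (vy ^+ 2) a.
Proof.
rewrite (subst2_comp _ ox ord_ym ox ord_ff) (subst2_vx ox ord_ff).
by have [-> _] := subst_lin ox ord_ff; rewrite /ff addrK.
Qed.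

Lemma subst_ff_yp a : subst2 vx ff a = subst2 vx (vy ^+ 2) (subst2 vx yp a).
Proof.
rewrite (subst2_comp _ ox ord_yp ox ord_vy2) (subst2_vx ox ord_vy2).
by have [_ ->] := subst_lin ox ord_vy2.
Qed.

Lemma subst_yp_ym a : subst2 vx ym (subst2 vx yp a) = a.
Proof.
rewrite (subst2_comp _ ox ord_yp ox ord_ym) (subst2_vx ox ord_ym).
by have [_ ->] := subst_lin ox ord_ym; rewrite /ym subrK subst2_id.
Qed.

Lemma cf2_dbl a p q : cf2 (subst2 vx (vy ^+ 2) a) p q =
  if odd q then 0 else cf2 a p q./2.
Proof.
rewrite (subst2_coef ox ord_vy2 _ (ltnSn (p + q))).
have E i j : cf2 a i j * cf2 (vx ^+ i * (vy ^+ 2) ^+ j) p q =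
    if (p == i) && (q == j.*2)%N then cf2 a i j else 0.
  rewrite -exprM -[vx ^+ i]mul1r -(rmorph1 (@CC R)) cf2_mon mul2n.
  by case: ifP; rewrite ?mulr1 ?mulr0.
under eq_bigr => i _ do under eq_bigr => j _ do rewrite E.
have hp : (p < (p + q).+1)%N by rewrite ltnS leq_addr.
rewrite (bigD1 (Ordinal hp)) //= [X in _ + X]big1 ?addr0; last first.
  move=> i /eqP hi; rewrite big1 // => j _; case: eqP => //= E'.
  by case: hi; apply: val_inj.
rewrite eqxx /=; case: ifP => oq.
  rewrite big1 // => j _; case: eqP => // E'; by rewrite E' odd_double in oq.
have hq : (q./2 < (p + q).+1)%N.
  rewrite ltnS (leq_trans _ (leq_addl _ _)) // -{2}(odd_double_half q) oq add0n.
  by rewrite -addnn leq_addr.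
have qE : q./2.*2 = q by rewrite -{2}(odd_double_half q) oq.
rewrite (bigD1 (Ordinal hq)) //= qE eqxx big1 ?addr0 // => j /eqP hj.
case: eqP => // E'; case: hj; apply: val_inj => /=.
by rewrite -[LHS]doubleK -E'.
Qed.

Definition even_half F : A := PS (fun i => PS (fun j => cf2 F i j.*2)).
Definition odd_half F : A := PS (fun i => PS (fun j => cf2 F i j.*2.+1)).

Lemma halves F :
  F = subst2 vx (vy ^+ 2) (even_half F) + vy * subst2 vx (vy ^+ 2) (odd_half F).
Proof.
apply: cf2P => p q; rewrite cf2D cf2_vyM cf2_dbl.
case: q => [|q]; first by rewrite addr0.
rewrite cf2_dbl /=; case oq: (odd q) => /=.
  rewrite addr0 -[RHS]/(cf2 F p (uphalf q).*2); congr (cf2 _ _ _).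
  by rewrite uphalf_half oq add1n doubleS -{1}(odd_double_half q) oq.
rewrite add0r -[RHS]/(cf2 F p (q./2).*2.+1); congr (cf2 _ _ _).
by rewrite -{1}(odd_double_half q) oq.
Qed.

Lemma convergent_halves F : convergent F ->
  convergent (even_half F) /\ convergent (odd_half F).
Proof.
move=> [r0 [M r00 b0]]; pose r := Num.min 1 r0.
have rp : 0 < r by rewrite lt_min ltr01.
have r1 : r <= 1 by rewrite ge_min lexx.
have b : bnd r M F by apply: bnd_rad b0 _; rewrite (ltW rp) ge_min lexx orbT.
have M0 := bnd_ge0 b.
have key m n : (m <= n)%N -> r ^+ n <= r ^+ m by move=> le; rewrite ler_wiXn2l // ltW.
split.
  apply: (@convergent_coef _ (r ^+ 2) M); first by rewrite exprn_gt0.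
  move=> i j; apply: le_trans (bnd_coef i j.*2 (ltW rp) b).
  by rewrite ler_wpM2l // -exprM key // -addnn; lia.
apply: (@convergent_coef _ (r ^+ 2) (M / r)); first by rewrite exprn_gt0.
move=> i j; rewrite ler_pdivlMr //; apply: le_trans (bnd_coef i j.*2.+1 (ltW rp) b).
by rewrite -mulrA ler_wpM2l // -exprM -exprSr key // -addnn; lia.
Qed.

(** The splitting into even and odd part in [xi], where [xi^2] is written [f - e x^k]. *)
Lemma split_ff F : exists a b,
  F = subst2 vx ff a + vy * subst2 vx ff b /\
  (convergent F -> convergent a /\ convergent b).
Proof.
exists (subst2 vx ym (even_half F)), (subst2 vx ym (odd_half F)).
rewrite !subst_ff_ym; split; first exact: halves.
move=> /convergent_halves[h1 h2].
have cy : convergent ym.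
  apply: convergentB; first exact: convergent_vy.
  by apply: convergentM; [exact: convergentC | apply: convergentX; exact: convergent_vx].
by split; apply: convergent_subst2 => //; try exact: ox; try exact: ord_ym; exact: convergent_vx.
Qed.

Lemma split_ff_inj a b : subst2 vx ff a + vy * subst2 vx ff b = 0 -> a = 0 /\ b = 0.
Proof.
have hs := subst2_hom ox ord_ym.
rewrite (subst_ff_yp a) (subst_ff_yp b) => E.
suff [h1 h2] : subst2 vx yp a = 0 /\ subst2 vx yp b = 0.
  by rewrite -(subst_yp_ym a) h1 -(subst_yp_ym b) h2 (rh0 hs).
split; apply: cf2P => i j.
  have := congr1 (fun z => cf2 z i j.*2) E; rewrite /= cf2D cf2_vyM cf2_dbl.
  rewrite odd_double doubleK; case: j => [|j]; first by rewrite addr0.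
  by rewrite doubleS cf2_dbl /= odd_double /= addr0.
have := congr1 (fun z => cf2 z i j.*2.+1) E; rewrite /= cf2D cf2_vyM !cf2_dbl.
by rewrite /= odd_double /= add0r doubleK.
Qed.

(** The action of the bracket with [f] on the odd part: [{xi b(x, f), f} = (T b)(x, f)]. *)
Definition opT b := 2%:R * ym * dx b - CC e * k%:R * vx ^+ k.-1 * b.

(** The bracket with [f] exchanges even and odd part, as it differentiates [f] to zero and
[{x, f} = 2 xi]. *)
Lemma pb_split a b : pb (subst2 vx ff a + vy * subst2 vx ff b) ff =
  subst2 vx ff (opT b) + vy * subst2 vx ff (2%:R * dx a).
Proof.
have of_ := ord_ff; have hs := subst2_hom ox of_.
have lowx : lowers (@dx R) := @ord_dx R.
have lowy : lowers (@dy R) := @ord_dy R.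
have Cx c := subst2_der ox of_ c (@dxP R) lowx (@dxC R).
have Cy c := subst2_der ox of_ c (@dyP R) lowy (@dyC R).
rewrite /pb [dx ff]dx_ff [dy ff]dy_ff (derD (@dxP R)) (derD (@dyP R)) (derM (@dxP R) vy) (derM (@dyP R) vy) !Cx !Cy.
have -> : subst2 vx ff (2%:R * dx a) = 2%:R * subst2 vx ff (dx a).
  by rewrite (rhM hs 2%:R) (rhn hs).
have -> : subst2 vx ff (opT b) = 2%:R * (ff - CC e * vx ^+ k) * subst2 vx ff (dx b) -
    CC e * k%:R * vx ^+ k.-1 * subst2 vx ff b.
  have [h1 _] := subst_lin ox of_; rewrite /opT (rhB hs) (rhM hs (2%:R * ym)).
  rewrite (rhM hs 2%:R) (rhn hs) h1 (rhM hs (CC e * k%:R * vx ^+ k.-1)).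
  rewrite (rhM hs (CC e * k%:R)) (rhM hs (CC e)) (rhn hs) (rhX hs vx k.-1).
  by rewrite (subst2_CC ox of_ e) (subst2_vx ox of_).
rewrite dxvx dyvx dxvy dyvy.
have -> : ff - CC e * vx ^+ k = vy ^+ 2 by rewrite /ff addrK.
rewrite dx_ff dy_ff; ring.
Qed.

Lemma cf2_natM n a i j : cf2 (n%:R * a) i j = n%:R * cf2 a i j.
Proof. by rewrite -(rmorph_nat (@CC R)) cf2CM. Qed.

Lemma cf2_opT b m n : cf2 (opT b) m n =
  2 * m.+1%:R * (if n is n'.+1 then cf2 b m.+1 n' else 0) -
  (if (k.-1 <= m)%N then e * (2 * (m - k.-1)%:R + k%:R) * cf2 b (m - k.-1) n else 0).
Proof.
have -> : opT b = 2%:R * (vy * dx b) - CC e * (2%:R * (vx ^+ k * dx b)) -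
   CC e * (k%:R * (vx ^+ k.-1 * b)) by rewrite /opT /ym; ring.
rewrite !cf2B !cf2CM !cf2_natM cf2_vyM !cf2_vxXM.
have kE : k = k.-1.+1 by rewrite prednK // ltnW.
have -> : (if n is n0.+1 then cf2 (dx b) m n0 else 0) =
   m.+1%:R * (if n is n'.+1 then cf2 b m.+1 n' else 0).
  by case: n => [|n]; rewrite ?mulr0 // cf2_dx.
have kE1 : (k <= m)%N = (k.-1 < m)%N by rewrite {1}kE.
rewrite kE1; case: (ltngtP k.-1 m) => hm.
- have E : (m - k.-1 = (m - k).+1)%N by move: hm kE; lia.
  by rewrite E cf2_dx; ring.
- by ring.
- by rewrite -hm subnn; ring.
Qed.

Section Solve.
Variable h : A.

(** The coefficient of [x^j y^n] of the series [b] for which [T b] and [h] agree in all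
powers [x^m] with [k - 1 <= m].  The coefficient of [x^(j+k-1) y^n] of [T b] is
[2 (j + k) b_(j+k, n-1) - e (2 j + k) b_(j, n)], and [1 / e = e]. *)
Fixpoint gco n j : R :=
  - e * (cf2 h (j + k.-1) n -
    (if n is n'.+1 then 2 * (j + k)%:R * gco n' (j + k)%N else 0)) / (2 * j%:R + k%:R).

Definition solT : A := PS (fun j => PS (fun n => gco n j)).

Lemma gcoE n j : gco n j = - e * (cf2 h (j + k.-1) n -
    (if n is n'.+1 then 2 * (j + k)%:R * gco n' (j + k)%N else 0)) / (2 * j%:R + k%:R).
Proof. by case: n. Qed.

Lemma den_gt0 j : 0 < 2 * j%:R + k%:R :> R.
Proof. by rewrite ltr_wpDl ?mulr_ge0 // ltr0n ltnW. Qed.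

Lemma solT_eq m n : (k.-1 <= m)%N -> cf2 (h - opT solT) m n = 0.
Proof.
move=> hm; rewrite cf2B cf2_opT hm; set j := (m - k.-1)%N.
have mE : (j + k.-1)%N = m by rewrite /j subnK.
have mE' : (j + k)%N = m.+1 by rewrite -mE -addnS prednK // ltnW.
rewrite -[cf2 solT j n]/(gco n j) gcoE mE mE'.
have -> : (if n is n'.+1 then 2 * m.+1%:R * gco n' m.+1 else 0) =
    2 * m.+1%:R * (if n is n'.+1 then cf2 solT m.+1 n' else 0).
  by case: n => [|n]; rewrite ?mulr0.
set w := (if n is n'.+1 then cf2 solT m.+1 n' else 0).
have d0 : 2 * j%:R + k%:R != 0 :> R by rewrite gt_eqF // den_gt0.
set x := cf2 h m n; set y := 2 * m.+1%:R * w; set d := 2 * _ + _ in d0 *.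
have -> : e * d * (- e * (x - y) / d) = - (e * e) * (x - y) by field.
by rewrite he; ring.
Qed.

(** By induction on [n], the coefficient of [x^j y^n] is at most a multiple of
[S^j D^n].  No factorials appear because the factor [2 (j + k)] of the recursion is at
most twice its pivot [2 j + k]. *)
Lemma solT_convergent : convergent h -> convergent solT.
Proof.
move=> [r0 [M r00 b0]]; pose r := Num.min 1 r0.
have rp : 0 < r by rewrite lt_min ltr01.
have r1 : r <= 1 by rewrite ge_min lexx.
have b : bnd r M h by apply: bnd_rad b0 _; rewrite (ltW rp) ge_min lexx orbT.
have M0 := bnd_ge0 b.
pose S := r^-1; have S1 : 1 <= S by rewrite /S invf_ge1.
have S0 : 0 < S by rewrite invr_gt0.
have hb i j : `|cf2 h i j| <= M * S ^+ (i + j).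
  by rewrite /S exprVn -ler_pdivrMr ?invr_gt0 ?exprn_gt0 // invrK; apply: bnd_coef => //; exact: ltW.
(* [D] closes the recursion: [D^(n+1)] is at least [S^(n+1) + 2 S^k D^n] *)
pose D := S + 2 * S ^+ k.
have SD : S <= D by rewrite /D lerDl mulr_ge0 ?exprn_ge0 // ltW.
have D0 : 0 < D by apply: lt_le_trans SD.
have en : `|e| = 1.
  have : `|e| * `|e| = 1 by rewrite -normrM he normr1.
  have := normr_ge0 e; set z := `|e| => z0 z2; nra.
have gb n j : `|gco n j| <= M * S ^+ k.-1 * S ^+ j * D ^+ n.
  elim: n j => [|n IH] j; rewrite gcoE.
    rewrite subr0 expr0 mulr1 !normrM normrN en mul1r normfV [`|2 * _ + _|]gtr0_norm ?den_gt0 //.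
    apply: (@le_trans _ _ (`|cf2 h (j + k.-1) 0|)).
      rewrite ler_pdivrMr ?den_gt0 // ler_peMr //.
      by rewrite -natrM -natrD ler1n addn_gt0 (ltnW hk) orbT.
    by apply: le_trans (hb _ _) _; rewrite addn0 exprD; rewrite le_eqVlt; apply/orP; left;
      apply/eqP; ring.
  rewrite !normrM normrN en mul1r normfV [`|2 * _ + _|]gtr0_norm ?den_gt0 //.
  rewrite ler_pdivrMr ?den_gt0 //.
  apply: le_trans (ler_normB _ _) _.
  have d1 : 1 <= 2 * j%:R + k%:R :> R.
    by rewrite -natrM -natrD ler1n addn_gt0 (ltnW hk) orbT.
  have h1 : `|cf2 h (j + k.-1) n.+1| <= M * S ^+ k.-1 * S ^+ j * S ^+ n.+1 * (2 * j%:R + k%:R).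
    apply: (@le_trans _ _ (M * S ^+ k.-1 * S ^+ j * S ^+ n.+1)).
      apply: le_trans (hb _ _) _; rewrite !exprD le_eqVlt; apply/orP; left; apply/eqP; ring.
    by rewrite ler_peMr // !mulr_ge0 ?exprn_ge0 // ltW.
  have h2 : `|2 * (j + k)%:R * gco n (j + k)| <=
      M * S ^+ k.-1 * S ^+ j * (2 * S ^+ k * D ^+ n) * (2 * j%:R + k%:R).
    rewrite !normrM !normr_nat.
    apply: (@le_trans _ _ (2 * (2 * j%:R + k%:R) * (M * S ^+ k.-1 * S ^+ (j + k) * D ^+ n))).
      apply: ler_pM; [exact: mulr_ge0 | exact: normr_ge0 | | exact: IH].
      by rewrite ler_wpM2l // natrD lerD2r ler_peMl // ler1n.
    by rewrite exprD le_eqVlt; apply/orP; left; apply/eqP; ring.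
  apply: le_trans (lerD h1 h2) _.
  rewrite -mulrDl ler_wpM2r ?(ltW (den_gt0 j)) // -mulrDr ler_wpM2l //.
    by rewrite !mulr_ge0 ?exprn_ge0 // ltW.
  have -> : D ^+ n.+1 = S * D ^+ n + 2 * S ^+ k * D ^+ n by rewrite exprS {1}/D mulrDl.
  rewrite lerD2r exprS ler_wpM2l ?(ltW S0) //.
  by rewrite lerXn2r ?nnegrE ?(ltW S0) ?(ltW D0).
apply: (@convergent_coef _ D^-1 (M * S ^+ k.-1)); first by rewrite invr_gt0.
move=> j n; rewrite -[cf2 _ _ _]/(gco n j).
rewrite exprVn ler_pdivrMr ?exprn_gt0 // exprD mulrA.
apply: le_trans (gb n j) _; rewrite ler_wpM2r ?exprn_ge0 ?(ltW D0) //.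
rewrite ler_wpM2l ?mulr_ge0 ?exprn_ge0 ?(ltW S0) //.
by rewrite lerXn2r ?nnegrE ?(ltW S0) ?(ltW D0).
Qed.
End Solve.

Lemma rows_sum N a : (forall i j, (N <= i)%N -> cf2 a i j = 0) ->
  a = \sum_(i < N) vx ^+ i * psC (cf a i).
Proof.
move=> ha; apply: cf2P => m n; rewrite cf2_sum.
have E i : cf2 (vx ^+ i * psC (cf a i)) m n = if m == i then cf2 a m n else 0.
  rewrite cf2_vxXM; case: (ltngtP i m) => hm //.
    by rewrite /cf2 cfC subn_eq0 leqNgt hm.
  by rewrite /cf2 hm subnn.
under eq_bigr do rewrite E.
have [lt|le] := ltnP m N; last first.
  by rewrite ha // big1 // => i _; case: ifP.
rewrite (bigD1 (Ordinal lt)) //= eqxx big1 ?addr0 // => i /eqP hi.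
by case: eqP => // E'; case: hi; apply: val_inj.
Qed.

Lemma convergent_row a i : convergent a -> convergent (psC (cf a i)).
Proof.
move=> [r [M r0 b]]; have M0 := bnd_ge0 b.
apply: (@convergent_coef _ r (M / r ^+ i)) => // -[|m] n; last first.
  by rewrite /cf2 /= normr0 mul0r divr_ge0 // exprn_ge0 // ltW.
rewrite add0n ler_pdivlMr ?exprn_gt0 // -mulrA -exprD addnC.
exact: (bnd_coef i n (ltW r0) b).
Qed.

(** The density of the normal form with coefficients [c]. *)
Definition hser (c : nat -> ps R) : A := \sum_(i < k.-1) vx ^+ i * series_at ff (c i).

Lemma hser_subst c : hser c = subst2 vx ff (\sum_(i < k.-1) vx ^+ i * psC (c i)).
Proof.
have hs := subst2_hom ox ord_ff.
rewrite (rh_sum hs); apply: eq_bigr => i _.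
by rewrite (rhM hs (vx ^+ i)) (rhX hs vx i) (subst2_vx ox ord_ff) (subst2_psC _ ox ord_ff).
Qed.

(** The odd part is [2 a_x] for an antiderivative [a], and the even part is [T b] up to
the powers of [x] below [k - 1] by [solT_eq]. *)
Theorem brieskorn_generated h : convergent h -> exists (c : nat -> ps R) (G : A),
  [/\ forall i, convergent (psC (c i)), convergent G & h = hser c + pb G ff].
Proof.
move=> ch; have [a [b [hE hc]]] := split_ff h.
have [ca cb] := hc ch.
have hs := subst2_hom ox ord_ff.
pose g := solT a; have cg : convergent g by apply: solT_convergent.
have convn n : convergent (n%:R : A) by rewrite -(rmorph_nat (@CC R)); exact: convergentC.
have cT : convergent (opT g).
  apply: convergentB; last first.
    apply: convergentM => //; apply: convergentM; last by apply: convergentX; exact: convergent_vx.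
    by apply: convergentM; [exact: convergentC | exact: convn].
  apply: convergentM; last exact: convergent_dx.
  apply: convergentM; first exact: convn.
  apply: convergentB; first exact: convergent_vy.
  by apply: convergentM; [exact: convergentC | apply: convergentX; exact: convergent_vx].
(* half of the antiderivative of the odd part with respect to [x] *)
pose G0 : A := PS (fun i => PS (fun j =>
   if i is i'.+1 then (2 * i'.+1%:R)^-1 * cf2 b i' j else 0)).
have dG0 : 2%:R * dx G0 = b.
  apply: cf2P => i j; rewrite cf2_natM cf2_dx -[cf2 G0 _ _]/(_ * _).
  by rewrite !mulrA divff ?mul1r // mulf_neq0 // pnatr_eq0.
have cG0 : convergent G0.
  case: cb => r [M r0 bb]; have M0 := bnd_ge0 bb.
  apply: (@convergent_coef _ r (r * M)) => // -[|i] j.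
    by rewrite /cf2 /= normr0 mul0r mulr_ge0 // ltW.
  rewrite -[cf2 G0 _ _]/(_ * _) normrM addSn exprS mulrCA ler_wpM2l ?(ltW r0) //.
  rewrite -mulrA; apply: le_trans (bnd_coef i j (ltW r0) bb).
  rewrite ler_piMl ?mulr_ge0 ?exprn_ge0 ?(ltW r0) //.
  rewrite normfV invf_le1 ?normr_gt0 ?mulf_neq0 ?pnatr_eq0 //.
  by rewrite -natrM normr_nat ler1n.
exists (fun i => cf (a - opT g) i), (subst2 vx ff G0 + vy * subst2 vx ff g).
have csub z : convergent z -> convergent (subst2 vx ff z).
  move=> cz; apply: convergent_subst2 => //; [exact: ox | exact: ord_ff | exact: convergent_vx |].
  exact: convergent_ff.
split.
- by move=> i; apply: convergent_row; apply: convergentB.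
- by apply: convergentD; [exact: csub | apply: convergentM; [exact: convergent_vy | exact: csub]].
rewrite hser_subst -rows_sum; last by move=> i j; exact: solT_eq.
by rewrite pb_split dG0 addrA -(rhD hs) subrK.
Qed.

(** Comparison of the even parts gives [d_0 + ... + x^(k-2) d_(k-2) = T b].  The
coefficients of [T b] at [x^(j+k-1)] vanish, and induction on the power of [y] gives
[b = 0] since the pivots [2 j + k] are not zero. *)
Theorem brieskorn_free (d : nat -> ps R) G : hser d = pb G ff ->
  forall i, (i < k.-1)%N -> d i = 0.
Proof.
have hs := subst2_hom ox ord_ff.
have [a [b [-> _]]] := split_ff G; rewrite hser_subst pb_split => E.
set P := \sum_(i < k.-1) vx ^+ i * psC (d i) in E.
have PE m n : cf2 P m n = if (m < k.-1)%N then cf (d m) n else 0.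
  rewrite /P cf2_sum.
  have E' i : cf2 (vx ^+ i * psC (d i)) m n = if m == i then cf (d m) n else 0.
    rewrite cf2_vxXM; case: (ltngtP i m) => hm //.
      by rewrite /cf2 cfC subn_eq0 leqNgt hm.
    by rewrite /cf2 hm subnn.
  under eq_bigr do rewrite E'.
  have [lt|le] := ltnP m k.-1; last first.
    rewrite big1 // => i _; case: eqP => // mi.
    by move: (ltn_ord i); rewrite -mi ltnNge le.
  rewrite (bigD1 (Ordinal lt)) //= eqxx big1 ?addr0 // => i /eqP hi.
  by case: eqP => // mi; case: hi; apply: val_inj.
have [TP _] : P - opT b = 0 /\ - (2%:R * dx a) = 0.
  by apply: split_ff_inj; rewrite (rhB hs) (rhN hs) E; ring.
have {}TP : P = opT b by apply/eqP; rewrite -subr_eq0 TP.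
have e0 : e != 0.
  by apply/eqP => e0; move: he; rewrite e0 mulr0 => /esym/eqP; rewrite oner_eq0.
have b0 n j : cf2 b j n = 0.
  elim: n j => [|n IH] j.
    have := PE (j + k.-1)%N 0%N; rewrite TP cf2_opT leq_addl addnK ltnNge leq_addl /=.
    move/eqP; rewrite mulr0 sub0r oppr_eq0 !mulf_eq0 (negPf e0) (gt_eqF (den_gt0 j)).
    by move/eqP.
  have := PE (j + k.-1)%N n.+1; rewrite TP cf2_opT leq_addl addnK ltnNge leq_addl /=.
  move/eqP; rewrite IH mulr0 sub0r oppr_eq0 !mulf_eq0 (negPf e0) (gt_eqF (den_gt0 j)).
  by move/eqP.
move=> i hi; apply: psP => n; have := PE i n; rewrite hi => <-.
have bz : b = 0 by apply: cf2P => ? ?; exact: b0.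
by rewrite TP bz /opT (der0 (@dxP R)) !mulr0 subrr.
Qed.
End Decomposition.

(** * Lie series of Hamiltonian vector fields *)

(** The Jacobi identity in the following form: if two functions evolve by the vector field
[H] of density [1/r], so does their Jacobian multiplied by [r].  Here [X] and [Y] are the
space derivatives, [d] the time derivative, and [fx], [fy] the partial derivatives of the
Hamiltonian. *)
Lemma jacobi (P : comNzRingType) (X Y d : P -> P) (r fx fy a b : P) :
  is_deriv X -> is_deriv Y -> is_deriv d ->
  (forall c, Y (X c) = X (Y c)) -> (forall c, d (X c) = X (d c)) ->
  (forall c, d (Y c) = Y (d c)) -> d r = 0 -> X fy = Y fx ->
  let H z := r * (X z * fy - Y z * fx) in
  let w := r * (X a * Y b - Y a * X b) in
  d a = H a -> d b = H b -> d w = H w.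
Proof.
move=> hX hY hd XY dX dY dr Xfy H w ea eb.
rewrite /w (derM hd) dr mul0r add0r (derB hd) !(derM hd) !dX !dY ea eb /H.
rewrite !(derM hX, derB hX, derM hY, derB hY) Xfy !XY.
ring.
Qed.

(** The determinant computation behind [lie_area]: a time depending on the point adds to
the columns of the Jacobian matrix the multiples [tx] and [ty] of the velocity
[(Ha, Hb)]; the correction is the bracket of the time with the Hamiltonian. *)
Lemma area_identity (P : comNzRingType) (Pa Qa Pb Qb tx ty fx fy r h lr lh : P) :
  let Ha := r * (Pa * fy - Qa * fx) in let Hb := r * (Pb * fy - Qb * fx) in
  Pa * Qb - Qa * Pb = h * lr -> lr * lh = 1 -> h * r = 1 ->
  ((Pa + tx * Ha) * (Qb + ty * Hb) - (Qa + ty * Ha) * (Pb + tx * Hb)) * lh =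
  h + (tx * fy - ty * fx).
Proof.
move=> Ha Hb W E1 hr.
transitivity ((Pa * Qb - Qa * Pb) * (1 + r * (tx * fy - ty * fx)) * lh).
  by rewrite /Ha /Hb; ring.
rewrite W; transitivity ((lr * lh) * (h + (h * r) * (tx * fy - ty * fx))); first by ring.
by rewrite E1 hr; ring.
Qed.

Section LieSeries.
Variables (R : realType) (k : nat) (e : R).
Hypotheses (hk : (2 <= k)%N).
Local Notation A := (ps (ps R)).
Local Notation f := (ff k e).
Variables (hh rr tau : A).
Hypotheses (hr : hh * rr = 1) (otau : ord 1 tau).

(** The Hamiltonian vector field of [f] for the area form of density [hh], of inverse
[rr]. *)
Definition ham F : A := rr * pb F f.

Lemma hamP : is_deriv ham.
Proof.
split=> a b; rewrite /ham /pb.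
  by rewrite (derD (@dxP R)) (derD (@dyP R)); ring.
by rewrite (derM (@dxP R) a) (derM (@dyP R) a); ring.
Qed.

Lemma ham_ord n F : ord n F -> ord n (ham F).
Proof.
case: n => [|n] hF; first exact: ord_triv.
have oy : ord 1 (dy f) by rewrite dy_ff; apply: ordMl; exact: ord_vy.
have ox : ord 1 (dx f).
  rewrite dx_ff; apply: ordMl; apply: (@ord_le _ _ k.-1); first by rewrite -ltnS prednK // ltnW.
  by apply: ordX; exact: ord_vx.
by apply: ordMl; rewrite -addn1; apply: ordB; apply: ordM => //;
  [apply: ord_dx | apply: ord_dy].
Qed.

Fixpoint ham_div n F : A :=
  if n is n'.+1 then CC (n'.+1%:R^-1) * ham (ham_div n' F) else F.
(** The Lie series [sum t^n ham^n(F) / n!], as a power series in the time. *)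
Definition flow F : ps A := PS (fun n => ham_div n F).

Lemma natA_inv n (a : A) : CC (n.+1%:R^-1) * (n.+1%:R * a) = a.
Proof.
rewrite -(rmorph_nat (@CC R) n.+1) mulrA -rmorphM mulVf ?pnatr_eq0 //.
by rewrite rmorph1 mul1r.
Qed.

Lemma flow_ode F : pderiv (flow F) = psmap ham (flow F).
Proof.
by apply: psP => n /=; rewrite mulrCA natA_inv.
Qed.

(** Uniqueness for the formal differential equation turns every expected property of the
flow into the verification of an equation and of an initial value. *)
Lemma ode_uniq (y z : ps A) : pderiv y = psmap ham y -> pderiv z = psmap ham z ->
  cf y 0 = cf z 0 -> y = z.
Proof.
move=> hy hz h0; apply: psP; elim=> // n IH.
have := congr1 (fun w => CC (n.+1%:R^-1) * cf w n) hy.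
have := congr1 (fun w => CC (n.+1%:R^-1) * cf w n) hz.
by rewrite /= !natA_inv IH => -> ->.
Qed.

Lemma psmap_hamP : is_deriv (psmap ham). Proof. exact: psmap_deriv hamP. Qed.

Lemma flow_const c : ham c = 0 -> flow c = psC c.
Proof.
move=> hc; apply: ode_uniq => //; first exact: flow_ode.
by rewrite pderivC (psmapC hamP) hc rmorph0.
Qed.

Lemma flow_hom : is_rhom flow.
Proof.
split=> [a b|a b|].
- apply: ode_uniq => //; first exact: flow_ode.
  by rewrite (derD (@pderivP _)) (derD psmap_hamP) !flow_ode.
- apply: ode_uniq; first exact: flow_ode.
    by rewrite (derM (@pderivP _) (flow a)) (derM psmap_hamP (flow a)) !flow_ode.
  by rewrite cfM big_ord1.
by rewrite flow_const ?rmorph1 // (der1 hamP).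
Qed.

Lemma ham_CC c : ham (CC c) = 0.
Proof. by rewrite /ham /pb dxC dyC; ring. Qed.

Lemma ham_ff : ham f = 0.
Proof. by rewrite /ham /pb; ring. Qed.

Let idh : is_rhom (@id A). Proof. by split. Qed.
(** Evaluation of the time at a function of the point. *)
Definition at_tau (a : ps A) : A := psubst id tau a.
Lemma at_tau_hom : is_rhom at_tau. Proof. exact: psubst_hom. Qed.
Lemma at_tau_C c : at_tau (psC c) = c. Proof. exact: psubst_C. Qed.

Definition lie F : A := at_tau (flow F).

Lemma lie_hom : is_rhom lie.
Proof.
have h1 := at_tau_hom; have h2 := flow_hom; rewrite /lie.
split=> [a b|a b|].
- by rewrite (rhD h2 a b) (rhD h1 (flow a) (flow b)).
- by rewrite (rhM h2 a b) (rhM h1 (flow a) (flow b)).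
- by rewrite (rh1 h2) (rh1 h1).
Qed.

Lemma lie_const c : ham c = 0 -> lie c = c.
Proof. by move=> hc; rewrite /lie (flow_const hc) at_tau_C. Qed.

Lemma ham_div_ord n m F : ord n F -> ord n (ham_div m F).
Proof.
by move=> hF; elim: m => [|m IH] //=; apply: ordMl; apply: ham_ord.
Qed.

Lemma lie_ord n F : ord n F -> ord n (lie F).
Proof.
by move=> hF; apply: psubst_ord => // l; apply: ham_div_ord.
Qed.

Lemma lie_subst F : lie F = subst2 (lie vx) (lie vy) F.
Proof.
apply: hom_subst2; [exact: lie_hom | | exact: lie_ord].
by move=> c; apply: lie_const; exact: ham_CC.
Qed.

(** The first-order correction is [ham(F) tau], a product of two elements without constant
term. *)
Lemma lie_near F : ord 1 F -> ord 2 (lie F - F).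
Proof.
move=> hF; have h : eqm 2 (lie F) _ := psubst_mod id otau (flow F) 2.
apply: (eqm_trans h); rewrite !big_ord_recl big_ord0 addr0 expr0 mulr1 expr1.
rewrite /eqm [X in ord _ X](_ : _ = cf (flow F) 1 * tau); last by rewrite /=; ring.
by apply: (@ordM _ 1 1) => //; apply: (@ham_div_ord 1 1).
Qed.

(** The flow preserves the area form: the Jacobian multiplied by the inverse of the density
at the starting point solves the same equation as the transported inverse density. *)
Lemma flow_area : psmap (@dx R) (flow vx) * psmap (@dy R) (flow vy) -
  psmap (@dy R) (flow vx) * psmap (@dx R) (flow vy) = psC hh * flow rr.
Proof.
pose X := psmap (@dx R); pose Y := psmap (@dy R).
have hX : is_deriv X := psmap_deriv (@dxP R).
have hY : is_deriv Y := psmap_deriv (@dyP R).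
pose r := psC rr; pose fx := psC (dx f); pose fy := psC (dy f).
have hamE a : psmap ham a = r * (X a * fy - Y a * fx).
  by apply: psP => n; rewrite cfCM cfB ![X a * _]mulrC ![Y a * _]mulrC !cfCM /= /ham /pb; ring.
set a := flow vx; set b := flow vy.
have ea : pderiv a = r * (X a * fy - Y a * fx) by rewrite -hamE; exact: flow_ode.
have eb : pderiv b = r * (X b * fy - Y b * fx) by rewrite -hamE; exact: flow_ode.
have XY c : Y (X c) = X (Y c) by apply: psP => n; exact: dydx.
have dX c : pderiv (X c) = X (pderiv c) by rewrite /X -psmap_pderiv //; exact: dxP.
have dY c : pderiv (Y c) = Y (pderiv c) by rewrite /Y -psmap_pderiv //; exact: dyP.
have Xfy : X fy = Y fx by rewrite /X /Y /fx /fy (psmapC (@dxP R)) (psmapC (@dyP R)) dydx.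
have dr : pderiv r = 0 by exact: pderivC.
suff E : r * (X a * Y b - Y a * X b) = flow rr.
  rewrite -E mulrA -rmorphM hr rmorph1 mul1r //.
apply: ode_uniq; [| exact: flow_ode |].
  by rewrite hamE; exact: (jacobi hX hY (@pderivP _) XY dX dY dr Xfy ea eb).
rewrite cfCM cfB !cfM !big_ord1 /= dxvx dyvx dxvy dyvy; ring.
Qed.

(** The fixed-time flow preserves the density [hh] by [flow_area]; the dependence of the
time on the point contributes exactly [{tau, f}]. *)
Lemma lie_area : pb (lie vx) (lie vy) * lie hh = hh + pb tau f.
Proof.
have hS := at_tau_hom.
have lowx : lowers (@dx R) := @ord_dx R.
have lowy : lowers (@dy R) := @ord_dy R.
have hamE a : at_tau (psmap ham a) =
    rr * (at_tau (psmap (@dx R) a) * dy f - at_tau (psmap (@dy R) a) * dx f).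
  have -> : psmap ham a = psC rr * (psC (dy f) * psmap (@dx R) a - psC (dx f) * psmap (@dy R) a).
    by apply: psP => n; rewrite cfCM cfB !cfCM /= /ham /pb; ring.
  rewrite (rhM hS (psC rr)) (rhB hS) (rhM hS (psC (dy f))) (rhM hS (psC (dx f))).
  by rewrite !at_tau_C; ring.
have idD : {morph @id A : a b / a + b} by [].
have lx F : dx (lie F) = at_tau (psmap (@dx R) (flow F)) + dx tau * at_tau (psmap ham (flow F)).
  have E := psubst_der (flow F) otau idD (@dxP R) lowx.
  by rewrite flow_ode in E; rewrite /at_tau psubst_psmap; exact: E.
have ly F : dy (lie F) = at_tau (psmap (@dy R) (flow F)) + dy tau * at_tau (psmap ham (flow F)).
  have E := psubst_der (flow F) otau idD (@dyP R) lowy.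
  by rewrite flow_ode in E; rewrite /at_tau psubst_psmap; exact: E.
have := congr1 at_tau flow_area.
rewrite (rhB hS) (rhM hS (psmap (@dx R) (flow vx))) (rhM hS (psmap (@dy R) (flow vx))).
rewrite (rhM hS (psC hh)) at_tau_C => W.
have E1 : lie rr * lie hh = 1.
  by have hl := lie_hom; rewrite -(rhM hl rr hh) mulrC hr (rh1 hl).
have lx' F := etrans (lx F) (congr1 (fun z => _ + dx tau * z) (hamE (flow F))).
have ly' F := etrans (ly F) (congr1 (fun z => _ + dy tau * z) (hamE (flow F))).
rewrite {1}/pb (lx' vx) (lx' vy) (ly' vx) (ly' vy).
exact: area_identity W E1 hr.
Qed.

(** Nagumo's argument: the norm at radius [s] of the n-th term is measured against
[(rho - s)^n], which makes repeated differentiation cost a geometric factor. *)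
Lemma ham_div_bnd rho M C F : 0 < rho -> bnd rho M F ->
  bnd rho C (rr * dy f) -> bnd rho C (rr * dx f) ->
  forall n s, 0 <= s -> s < rho ->
  bnd s (M * (2 * C * expR 1) ^+ n / (rho - s) ^+ n) (ham_div n F).
Proof.
move=> rho0 bF by_ bx; have C0 := bnd_ge0 bx; have M0 := bnd_ge0 bF.
elim=> [|n IH] s s0 srho.
  by rewrite !expr0 mulr1 divr1; apply: bnd_rad bF _; rewrite s0 ltW.
pose d := rho - s; have d0 : 0 < d by rewrite subr_gt0.
(* This loss of radius makes the successive factors combine into
   [((n + 2) / (n + 1))^(n + 1)], which is at most [exp 1]. *)
pose s' := s + d / n.+2%:R.
have n2 : 0 < n.+2%:R :> R by [].
have n1 : 0 < n.+1%:R :> R by [].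
have ss' : s < s' by rewrite ltrDl divr_gt0.
have ds' : rho - s' = d * (n.+1%:R / n.+2%:R).
  rewrite /s' opprD addrA -/d -{1}[d]mulr1 -mulrBr; congr (_ * _).
  have aux (x : R) : 0 < x -> 1 - (x + 1)^-1 = x / (x + 1).
    by move=> x0; field; rewrite gt_eqF // addr_gt0.
  by rewrite -[n.+2%:R]natr1 aux.
have s'rho : s' < rho by rewrite -subr_gt0 ds' mulr_gt0 // divr_gt0.
have s'0 : 0 <= s' by rewrite (le_trans s0) // ltW.
have := IH s' s'0 s'rho; set B := (X in bnd s' X _) => bI.
have B0 := bnd_ge0 bI.
have dd : s' - s = d / n.+2%:R by rewrite /s' addrAC subrr add0r.
have b1 : bnd s (2 * (B / (d / n.+2%:R) * C)) (ham (ham_div n F)).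
  rewrite (_ : ham _ = dx (ham_div n F) * (rr * dy f) - dy (ham_div n F) * (rr * dx f)).
    rewrite mulr2n mulrDl mul1r; apply: bndD => //; last apply: bndN.
      apply: bndM => //; first by rewrite -dd; apply: bnd_dx.
      by apply: bnd_rad by_ _; rewrite s0 ltW.
    apply: bndM => //; first by rewrite -dd; apply: bnd_dy.
    by apply: bnd_rad bx _; rewrite s0 ltW.
  by rewrite /ham /pb; ring.
apply: (@bnd_le _ _ (`|n.+1%:R^-1| * (2 * (B / (d / n.+2%:R) * C)))).
  by apply: bndM => //; apply: bndC.
rewrite normfV normr_nat.
have key : (n.+2%:R / n.+1%:R) ^+ n.+1 <= expR 1 :> R.
  have -> : (n.+2%:R / n.+1%:R : R) = 1 + n.+1%:R^-1.
    by rewrite -[n.+2%:R]natr1 mulrDl divff ?gt_eqF // mul1r.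
  have -> : expR 1 = expR (n.+1%:R^-1) ^+ n.+1 :> R.
    by rewrite -expRM_natl divff ?gt_eqF.
  by apply: lerXn2r; rewrite ?nnegrE ?expR_ge0 ?expR_ge1Dx // addr_ge0 // invr_ge0.
rewrite /B ds'.
set L := 2 * C * expR 1.
rewrite exprMn exprS [d ^+ n.+1]exprS.
have dn : d ^+ n != 0 by rewrite expf_neq0 // gt_eqF.
rewrite [leLHS](_ : _ = (M * L ^+ n / d ^+ n / d) * (2 * C) * (n.+2%:R / n.+1%:R) ^+ n.+1).
  rewrite [leRHS](_ : _ = (M * L ^+ n / d ^+ n / d) * (2 * C) * expR 1).
    rewrite ler_wpM2l // !mulr_ge0 ?invr_ge0 ?exprn_ge0 ?(ltW d0) //.
    by rewrite !mulr_ge0 // expR_ge0.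
  by rewrite /L; field; rewrite dn gt_eqF.
rewrite exprS !exprMn !exprVn; field.
by rewrite !expf_neq0 ?gt_eqF // -natr1 -natrD.
Qed.

(** On a small polydisc the time is small enough for the geometric growth of
[ham_div_bnd]. *)
Lemma lie_convergent F : convergent rr -> convergent tau -> convergent F ->
  convergent (lie F).
Proof.
move=> cr ct cF.
have cy : convergent (rr * dy f) by apply: convergentM => //; apply: convergent_dy; exact: convergent_ff.
have cx : convergent (rr * dx f) by apply: convergentM => //; apply: convergent_dx; exact: convergent_ff.
have [r1 [C r10 [by_ bx]]] := convergentP2 cy cx.
have [rho [M [rho0 bF rho1]]] : exists rho M, [/\ 0 < rho, bnd rho M F & rho <= r1].
  case: cF => r [M r0 b]; exists (Num.min r r1), M; split; first by rewrite lt_min r0.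
    by apply: bnd_rad b _; rewrite le_min (ltW r0) (ltW r10) ge_min lexx.
  by rewrite ge_min lexx orbT.
have hrho : 0 <= rho <= r1 by rewrite (ltW rho0) rho1.
have bD := ham_div_bnd rho0 bF (bnd_rad by_ hrho) (bnd_rad bx hrho).
have C0 := bnd_ge0 bx; have M0 := bnd_ge0 bF.
pose s := rho / 2; have s0 : 0 < s by rewrite divr_gt0.
have ss : rho - s = s by rewrite /s; lra.
have srho : s < rho by rewrite /s; lra.
set L := 2 * C * expR 1 in bD.
have L0 : 0 <= L by rewrite /L !mulr_ge0 // expR_ge0.
(* a bound on the time for which the n-th term is at most [M / 2^n] *)
pose dl := s / (2 * (L + 1)).
have L1 : 0 < L + 1 by rewrite ltr_wpDl.
have dl0 : 0 < dl by rewrite divr_gt0 // mulr_gt0.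
have [r r0 hrt] := convergent_small ct otau dl0.
pose t := Num.min r s; have t0 : 0 < t by rewrite lt_min r0.
have bt : bnd t dl tau by apply: hrt; rewrite (ltW t0) ge_min lexx.
have ts : 0 <= t <= s by rewrite (ltW t0) ge_min lexx orbT.
exists t, (M * 2) => //.
apply: (@bnd_psubst _ _ _ _ _ _ _ (fun l => M * 2^-1 ^+ l)) => //; first exact: ltW.
  move=> l; have bl := bnd_rad (bD l s (ltW s0) srho) ts.
  apply: bnd_le (bndM (ltW t0) bl (bndX l (ltW t0) bt)) _.
  rewrite ss -!mulrA ler_wpM2l // mulrA -exprVn -!exprMn lerXn2r ?nnegrE //.
    by apply: mulr_ge0; [apply: divr_ge0 => // |]; apply: ltW.
  rewrite /dl (_ : L / s * _ = L / (L + 1) / 2); last by field; rewrite !gt_eqF.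
  by rewrite ler_pdivrMr // mulVf // ler_pdivrMr // mul1r lerDl.
by move=> n; rewrite -mulr_sumr ler_wpM2l // geom2.
Qed.

End LieSeries.

(** A constant may be subtracted from [tau], since only the bracket [{tau, f}] matters; the
Lie series then has a time without constant term. *)
Theorem straighten (R : realType) k (e : R) (hh tau : ps (ps R)) : (2 <= k)%N ->
  convergent hh -> cf2 hh 0 0 != 0 -> convergent tau -> exists u v,
  [/\ near_id u v, subst2 u v (ff k e) = ff k e &
      pb u v * subst2 u v hh = hh + pb tau (ff k e)].
Proof.
move=> hk ch h0 ct0; have [rr cr hr] := convergent_inv ch h0.
pose tau1 := tau - CC (cf2 tau 0 0).
have ct : convergent tau1 by apply: convergentB => //; exact: convergentC.
have ot : ord 1 tau1 by apply: ord1P; rewrite cf2B cf2_CC subrr.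
have <- : pb tau1 (ff k e) = pb tau (ff k e).
  by rewrite /pb /tau1 (derB (@dxP R)) (derB (@dyP R)) dxC dyC !subr0.
pose E := lie k e rr tau1.
exists (E vx), (E vy); split.
- split.
  + by apply: lie_convergent => //; exact: convergent_vx.
  + by apply: lie_convergent => //; exact: convergent_vy.
  + by apply: lie_near => //; exact: ord_vx.
  + by apply: lie_near => //; exact: ord_vy.
- by rewrite -lie_subst //; apply: lie_const => //; exact: ham_ff.
by rewrite -lie_subst //; exact: lie_area.
Qed.

(** * The weighted homotopy of a map preserving the singularity *)

Section BaseChange.
Variables (K L : comNzRingType).
Implicit Types (g : K -> L) (a b : ps (ps K)).

Definition psmap2 g a : ps (ps L) := psmap (psmap g) a.

Lemma cf2_psmap2 g a i j : cf2 (psmap2 g a) i j = g (cf2 a i j). Proof. by []. Qed.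

Lemma psmap_rhom g : is_rhom g -> is_rhom (psmap g).
Proof.
move=> hg; split=> [a b|a b|]; apply: psP => n /=; first by rewrite (rhD hg).
  rewrite (rh_sum hg); apply: eq_bigr => i _; exact: (rhM hg).
by case: eqP; rewrite ?(rh1 hg) ?(rh0 hg).
Qed.

Lemma rhom_natM g n x : {morph g : x y / x + y} -> g (n%:R * x) = n%:R * g x.
Proof.
move=> gD; have g0 : g 0 = 0 by apply: (@addrI _ (g 0)); rewrite -gD !addr0.
elim: n => [|n IH]; first by rewrite !mulr0n !mul0r.
by rewrite -!natr1 !mulrDl gD IH !mul1r.
Qed.

Lemma dx_psmap2 g a : {morph g : x y / x + y} -> dx (psmap2 g a) = psmap2 g (dx a).
Proof.
by move=> gD; apply: cf2P => i j; rewrite cf2_dx !cf2_psmap2 cf2_dx rhom_natM.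
Qed.
Lemma dy_psmap2 g a : {morph g : x y / x + y} -> dy (psmap2 g a) = psmap2 g (dy a).
Proof.
by move=> gD; apply: cf2P => i j; rewrite cf2_dy !cf2_psmap2 cf2_dy rhom_natM.
Qed.
End BaseChange.

Section BaseChangeHom.
Variables (K L : comNzRingType) (g : K -> L).
Hypothesis hg : is_rhom g.
Lemma psmap2_rhom : is_rhom (psmap2 g).
Proof. by do 2!apply: psmap_rhom. Qed.
Lemma psmap2_CC c : psmap2 g (CC c) = CC (g c).
Proof.
by apply: cf2P => i j; rewrite cf2_psmap2 !cf2_CC; case: ifP; rewrite ?(rh0 hg).
Qed.
Lemma psmap2_vx : psmap2 g vx = vx.
Proof.
by apply: cf2P => i j; rewrite cf2_psmap2 !cf2_vx (rhn hg).
Qed.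
Lemma psmap2_vy : psmap2 g vy = vy.
Proof.
by apply: cf2P => i j; rewrite cf2_psmap2 !cf2_vy (rhn hg).
Qed.
Lemma psmap2_pb a b : psmap2 g (pb a b) = pb (psmap2 g a) (psmap2 g b).
Proof.
have gD : {morph g : x y / x + y} by case: hg.
have h := psmap2_rhom.
by rewrite /pb !dx_psmap2 // !dy_psmap2 // (rhB h (dx a * dy b) (dy a * dx b))
  (rhM h (dx a) (dy b)) (rhM h (dy a) (dx b)).
Qed.
End BaseChangeHom.

(** The variation of [u^i {u, v}] along a family is the exterior derivative of the 1-form
[u^i (u' dv - v' du)]. *)
Lemma area_variation (B : comNzRingType) (X Y d : B -> B) (u v : B) i :
  is_deriv X -> is_deriv Y -> is_deriv d ->
  (forall c, Y (X c) = X (Y c)) -> (forall c, d (X c) = X (d c)) ->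
  (forall c, d (Y c) = Y (d c)) ->
  d (u ^+ i * (X u * Y v - Y u * X v)) =
  X (u ^+ i * (d u * Y v - d v * Y u)) - Y (u ^+ i * (d u * X v - d v * X u)).
Proof.
move=> hX hY hd XY dX dY.
rewrite (derM hd (u ^+ i)) (derM hX (u ^+ i)) (derM hY (u ^+ i)).
rewrite (derX hd u i) (derX hX u i) (derX hY u i).
rewrite (derB hd) (derB hX) (derB hY) !(derM hd (X u), derM hd (Y u)).
rewrite !(derM hX (d u), derM hX (d v), derM hY (d u), derM hY (d v)) !dX !dY !XY.
ring.
Qed.

(** Differentiating [v^2 + e u^k = f] with respect to the parameter gives
[2 v v' + e k u^(k-1) u' = 0]; hence the form [u' dv - v' du] is proportional to
[df = 2 v dv + e k u^(k-1) du]. *)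
Lemma wedge_zero (B : comNzRingType) (u v ux uy vx vy du dv w kk : B) :
  2%:R * v * dv + kk * du = 0 ->
  (w * (du * vx - dv * ux)) * (2%:R * v * vy + kk * uy) =
  (w * (du * vy - dv * uy)) * (2%:R * v * vx + kk * ux).
Proof.
move=> h; apply/eqP; rewrite -subr_eq0; apply/eqP.
transitivity (- (w * (ux * vy - uy * vx)) * (2%:R * v * dv + kk * du)); first by ring.
by rewrite h mulr0.
Qed.

Lemma sub_swap (V : zmodType) (x y z w : V) : x - y = z - w -> x - z = y - w.
Proof. by move=> /eqP; rewrite subr_eq => /eqP ->; rewrite -[z - w + y]addrA [z + _]addrC addrK addrC. Qed.

Section Lambda.
Variables (R : realType).
Local Notation A := (ps (ps R)).
Local Notation B := (ps (ps {poly R})).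

(** The derivative with respect to the parameter of the family, on which the coefficients
depend polynomially. *)
Definition dl : B -> B := psmap2 (@deriv R).
Lemma polyderivP : is_deriv (@deriv R).
Proof. by split=> [a b|a b]; rewrite ?derivD ?derivM. Qed.
Lemma dlP : is_deriv dl.
Proof. exact: psmap_deriv (psmap_deriv polyderivP). Qed.
Lemma dl_dx a : dl (dx a) = dx (dl a).
Proof. by rewrite /dl dx_psmap2 // => x y; rewrite derivD. Qed.
Lemma dl_dy a : dl (dy a) = dy (dl a).
Proof. by rewrite /dl dy_psmap2 // => x y; rewrite derivD. Qed.
Lemma dl_CC (c : R) : dl (CC c%:P) = 0.
Proof. by apply: cf2P => i j; rewrite cf2_psmap2 cf2_CC; case: ifP => _; rewrite ?derivC ?deriv0. Qed.
Lemma dl_vx : dl vx = 0.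
Proof.
by apply: cf2P => i j; rewrite cf2_psmap2 cf2_vx -(rmorph_nat (@polyC R)) derivC.
Qed.
Lemma dl_vy : dl vy = 0.
Proof.
by apply: cf2P => i j; rewrite cf2_psmap2 cf2_vy -(rmorph_nat (@polyC R)) derivC.
Qed.

Definition inj (a : A) : B := psmap2 (@polyC R) a.
Definition ev (t : R) (a : B) : A := psmap2 (fun p : {poly R} => p.[t]) a.
Lemma polyC_rhom : is_rhom (@polyC R). Proof. exact: rmorph_rhom. Qed.
Lemma horner_rhom t : is_rhom (fun p : {poly R} => p.[t]).
Proof. by split=> [a b|a b|]; rewrite ?hornerD ?hornerM ?hornerC. Qed.
Lemma ev_rhom t : is_rhom (ev t). Proof. exact: psmap2_rhom (horner_rhom t). Qed.
Lemma inj_rhom : is_rhom inj. Proof. exact: psmap2_rhom polyC_rhom. Qed.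
Lemma ev_inj t a : ev t (inj a) = a.
Proof. by apply: cf2P => i j; rewrite !cf2_psmap2 hornerC. Qed.
Lemma dl_inj a : dl (inj a) = 0.
Proof. by apply: cf2P => i j; rewrite !cf2_psmap2 derivC. Qed.

Definition antideriv (p : {poly R}) : {poly R} :=
  \poly_(i < (size p).+1) (p`_i.-1 / i%:R).
Lemma deriv_antideriv p : (antideriv p)^`() = p.
Proof.
apply/polyP => i; rewrite coef_deriv coef_poly ltnS /=; case: ltnP => [_|le].
  by rewrite -[LHS]mulr_natr divfK // pnatr_eq0.
by rewrite mul0rn nth_default.
Qed.
Lemma deriv0_const (p : {poly R}) (s t : R) : p^`() = 0 -> p.[s] = p.[t].
Proof.
move=> hp; suff -> : p = (p`_0)%:P by rewrite !hornerC.
apply/polyP => -[|i]; rewrite coefC //=.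
have := congr1 (fun q : {poly R} => q`_i) hp.
by rewrite coef_deriv coef0 => /eqP; rewrite mulrn_eq0 /= => /eqP.
Qed.

Variables (k : nat) (e : R).
Hypotheses (hk : (2 <= k)%N) (he : e * e = 1).
Definition ffB : B := vy ^+ 2 + CC e%:P * vx ^+ k.

Lemma dx_ffB : dx ffB = CC e%:P * k%:R * vx ^+ k.-1.
Proof.
rewrite /ffB (derD (@dxP _)) (derM (@dxP _) (CC e%:P)) !(derX (@dxP _)) dxC dxvx dxvy; ring.
Qed.
Lemma dy_ffB : dy ffB = 2%:R * vy.
Proof.
rewrite /ffB (derD (@dyP _)) (derM (@dyP _) (CC e%:P)) !(derX (@dyP _)) dyC dyvx dyvy expr1; ring.
Qed.
Lemma dl_ffB : dl ffB = 0.
Proof.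
by rewrite /ffB (derD dlP) (derM dlP (CC e%:P)) !(derX dlP) dl_CC dl_vx dl_vy; ring.
Qed.

Lemma inj_ff : inj (ff k e) = ffB.
Proof.
have h := inj_rhom.
rewrite /ff (rhD h) (rhM h (CC e)) (rhX h vx k) (rhX h vy 2) /inj.
by rewrite (psmap2_CC polyC_rhom) (psmap2_vx polyC_rhom) (psmap2_vy polyC_rhom).
Qed.
Lemma ev_ffB t : ev t ffB = ff k e.
Proof. by rewrite -inj_ff ev_inj. Qed.

(** A 1-form whose wedge product with [df] vanishes is a multiple of [df], as [x^(k-1)]
and [xi] have no common factor. *)
Lemma division_by_df (ax ay : B) : ax * dy ffB = ay * dx ffB -> exists G,
  ax = dx ffB * G /\ ay = dy ffB * G.
Proof.
rewrite dx_ffB dy_ffB => E.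
pose be : B := PS (fun i => PS (fun j => cf2 ay i j.+1)).
have e0 : e != 0.
  by apply/eqP => e0; move: he; rewrite e0 mulr0 => /esym/eqP; rewrite oner_eq0.
have k0 : k%:R != 0 :> {poly R}.
  by rewrite -(rmorph_nat (@polyC R)) polyC_eq0 pnatr_eq0 -lt0n ltnW.
have E1 : vy * (2%:R * ax) = vx ^+ k.-1 * (CC e%:P * (k%:R * ay)).
  transitivity (ax * (2%:R * vy)); first by ring.
  by rewrite E; ring.
have natM n (z : B) i j : cf2 (n%:R * z) i j = n%:R * cf2 z i j.
  by rewrite -(rmorph_nat (@CC {poly R}) n) cf2CM.
have ay0 i : cf2 ay i 0 = 0.
  have := congr1 (fun z => cf2 z (k.-1 + i)%N 0) E1.
  rewrite cf2_vyM cf2_vxXM leq_addr addKn cf2CM natM => /esym/eqP.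
  by rewrite !mulf_eq0 polyC_eq0 (negPf e0) (negPf k0) => /eqP.
have ayE : ay = vy * be by apply: cf2P => i [|j]; rewrite cf2_vyM.
have E2 : 2%:R * ax = CC e%:P * k%:R * vx ^+ k.-1 * be.
  apply: cf2P => i j; have := congr1 (fun z => cf2 z i j.+1) E1.
  rewrite {1}ayE cf2_vyM => ->.
  rewrite [X in cf2 X _ _](_ : _ = vy * (CC e%:P * k%:R * vx ^+ k.-1 * be)) ?cf2_vyM //.
  by ring.
pose G := CC ((2^-1)%:P) * be.
have half : CC ((2^-1)%:P) * 2%:R = 1 :> B.
  rewrite -(rmorph_nat (@CC {poly R})) -(rmorph_nat (@polyC R)) -rmorphM -rmorphM.
  by rewrite mulVf ?pnatr_eq0 // !rmorph1.
exists G; split.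
  transitivity ((CC ((2^-1)%:P) * 2%:R) * ax); first by rewrite half mul1r.
  by rewrite -mulrA E2 /G; ring.
transitivity ((CC ((2^-1)%:P) * 2%:R) * ay); first by rewrite half mul1r.
by rewrite {1}ayE /G; ring.
Qed.

(** Combination of [area_variation], [wedge_zero] and [division_by_df], with
[d (G df)] equal to the bracket of [G] and [f]. *)
Lemma area_exact (u v : B) i : v ^+ 2 + CC e%:P * u ^+ k = ffB ->
  exists G, dl (u ^+ i * pb u v) = pb G ffB.
Proof.
move=> hf.
have D (d : B -> B) : is_deriv d -> d (CC e%:P) = 0 ->
    2%:R * v * d v + (CC e%:P * k%:R * u ^+ k.-1) * d u = d ffB.
  move=> hd d0; rewrite -hf (derD hd) (derM hd (CC e%:P)) !(derX hd) d0 /= expr1; ring.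
have Dl := D dl dlP (dl_CC e); rewrite dl_ffB in Dl.
have Dx := D (@dx _) (@dxP _) (dxC _).
have Dy := D (@dy _) (@dyP _) (dyC _).
have W := @wedge_zero _ u v (dx u) (dy u) (dx v) (dy v) (dl u) (dl v) (u ^+ i) _ Dl.
rewrite Dx Dy in W; have [G [gx gy]] := division_by_df W.
exists G.
rewrite /pb (area_variation u v i (@dxP _) (@dyP _) dlP (@dydx _) dl_dx dl_dy) gx gy.
rewrite (derM (@dxP _) (dy ffB)) (derM (@dyP _) (dx ffB)) dydx; ring.
Qed.

Lemma dl_injM a b : dl (inj a * b) = inj a * dl b.
Proof. by rewrite (derM dlP) dl_inj mul0r add0r. Qed.

Lemma dl_pb (a : B) : dl (pb a ffB) = pb (dl a) ffB.
Proof.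
rewrite /pb (derB dlP) (derM dlP (dx a)) (derM dlP (dy a)) !dl_dx !dl_dy dl_ffB.
rewrite (der0 (@dxP _)) (der0 (@dyP _)); ring.
Qed.

Lemma ev_CC t c : ev t (CC c%:P) = CC c.
Proof. by rewrite /ev (psmap2_CC (horner_rhom t)) hornerC. Qed.

Lemma ev_pb t a b : ev t (pb a b) = pb (ev t a) (ev t b).
Proof. exact: psmap2_pb (horner_rhom t) a b. Qed.

Section Twist.
Variables (K L : comNzRingType) (g : K -> L) (w : L).
Definition twist (a : ps K) : ps L := PS (fun n => g (cf a n) * w ^+ n).
Lemma twist_rhom : is_rhom g -> is_rhom twist.
Proof.
move=> hg; split=> [a b|a b|]; apply: psP => n /=.
- by rewrite (rhD hg) mulrDl.
- rewrite (rh_sum hg) mulr_suml; apply: eq_bigr => i _.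
  have -> : w ^+ n = w ^+ i * w ^+ (n - i) by rewrite -exprD subnKC ?leq_ord.
  by rewrite (rhM hg); ring.
by case: n => [|n]; rewrite /= ?(rh1 hg) ?(rh0 hg) ?mul1r ?mul0r.
Qed.
End Twist.

(** The substitution [(x, xi) -> (l^2 x, l^k xi)], where [l] is the polynomial variable; it
multiplies [f] by [l^(2k)]. *)
Definition scale (a : A) : B :=
  twist (twist (@polyC R) ('X^k)) (psC ('X^2)) a.
Lemma scale_rhom : is_rhom scale.
Proof. by do 2!apply: twist_rhom; exact: polyC_rhom. Qed.
Lemma cf2_scale a p q : cf2 (scale a) p q = (cf2 a p q)%:P * 'X^(2 * p + k * q).
Proof.
have E : cf (scale a) p = psC ('X^2 ^+ p) * twist (@polyC R) 'X^k (cf a p).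
  by rewrite mulrC rmorphXn.
rewrite {1}/cf2 E cfCM -[cf (twist _ _ _) q]/((cf2 a p q)%:P * 'X^k ^+ q).
by rewrite exprD -!exprM; ring.
Qed.

(** The rescaled series divided by [l^m].  The subtraction of exponents is the true one
when all terms have weight at least [m]. *)
Definition unscale m (a : A) : B :=
  PS (fun p => PS (fun q => (cf2 a p q)%:P * 'X^(2 * p + k * q - m))).
Lemma cf2_unscale m a p q :
  cf2 (unscale m a) p q = (cf2 a p q)%:P * 'X^(2 * p + k * q - m).
Proof. by []. Qed.

Lemma unscaleE m a : (forall p q, (2 * p + k * q < m)%N -> cf2 a p q = 0) ->
  CC 'X^m * unscale m a = scale a.
Proof.
move=> h; apply: cf2P => p q; rewrite cf2CM cf2_unscale cf2_scale mulrCA -exprD.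
have [lt|le] := ltnP (2 * p + k * q) m; first by rewrite h // polyC0 !mul0r.
by rewrite subnKC.
Qed.

Lemma ev1_unscale m a : ev 1 (unscale m a) = a.
Proof.
apply: cf2P => p q; rewrite cf2_psmap2 cf2_unscale hornerM hornerC hornerXn.
by rewrite expr1n mulr1.
Qed.
Lemma cf2_ev0 m a p q : cf2 (ev 0 (unscale m a)) p q =
  if (2 * p + k * q <= m)%N then cf2 a p q else 0.
Proof.
rewrite cf2_psmap2 cf2_unscale hornerM hornerC hornerXn expr0n subn_eq0.
by case: ifP; rewrite ?mulr1 ?mulr0.
Qed.

Lemma scale_CC c : scale (CC c) = CC c%:P.
Proof.
apply: cf2P => p q; rewrite cf2_scale !cf2_CC; case: ifP; last by rewrite polyC0 mul0r.
by case: p q => [|p] [|q] // _; rewrite !muln0 expr0 mulr1.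
Qed.

Lemma scale_ff : scale (ff k e) = CC 'X^(k * 2) * ffB.
Proof.
have h := scale_rhom.
have hx : scale vx = CC 'X^2 * vx.
  apply: cf2P => p q; rewrite cf2_scale cf2CM !cf2_vx; case: andP => [[/eqP -> /eqP ->]|_].
    by rewrite muln0 mul1r mulr1.
  by rewrite polyC0 mul0r mulr0.
have hy : scale vy = CC 'X^k * vy.
  apply: cf2P => p q; rewrite cf2_scale cf2CM !cf2_vy; case: andP => [[/eqP -> /eqP ->]|_].
    by rewrite muln0 add0n muln1 mul1r mulr1.
  by rewrite polyC0 mul0r mulr0.
rewrite /ff (rhD h) (rhM h (CC e)) (rhX h vx k) (rhX h vy 2) hx hy scale_CC.
rewrite /ffB !exprMn -!rmorphXn -!exprM [(2 * k)%N]mulnC; ring.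
Qed.

Lemma CC_Xn_inj n (a b : B) : CC 'X^n * a = CC 'X^n * b -> a = b.
Proof.
move=> E; apply: cf2P => i j; have := congr1 (fun z => cf2 z i j) E.
rewrite !cf2CM; apply: mulfI; by rewrite expf_neq0 // polyX_eq0.
Qed.

Section Family.
Variables (u v : A).
Hypotheses (ou : ord 1 u) (ov : ord 1 v) (hf : v ^+ 2 + CC e * u ^+ k = ff k e).

Lemma cf2_ff i j : cf2 (ff k e) i j =
  (if (i == 0%N) && (j == 2%N) then 1 else 0) + (if (i == k) && (j == 0%N) then e else 0).
Proof.
have := cf2_mon (1 : R) 0 2 i j; rewrite (rmorph1 (@CC R)) expr0 !mul1r => <-.
by have := cf2_mon e k 0 i j; rewrite expr0 mulr1 => <-.
Qed.

(** The square of the lowest coefficient of [v(x, 0)] is a coefficient of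
[v^2 = f - e u^k], whose powers of [x] start at [x^k]. *)
Lemma v_low p : (2 * p < k)%N -> cf2 v p 0 = 0.
Proof.
elim/ltn_ind: p => p IH lt.
have E : cf2 (v ^+ 2) (2 * p) 0 = 0.
  have -> : v ^+ 2 = ff k e - CC e * u ^+ k by rewrite -hf addrK.
  have E1 : cf2 (CC e * u ^+ k) (2 * p) 0 = 0.
    by apply: (ordE (ordMl (CC e) (ordX k ou))); rewrite addn0.
  by rewrite (cf2B (ff k e)) E1 cf2_ff /= andbF (ltn_eqF lt) addr0 subr0.
have hp : (p < (2 * p).+1)%N by rewrite ltnS mul2n -addnn leq_addr.
suff S : cf2 (v ^+ 2) (2 * p) 0 = cf2 v p 0 * cf2 v p 0.
  by move/eqP: E; rewrite S mulf_eq0 orbb => /eqP.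
have -> : cf2 (v ^+ 2) (2 * p) 0 =
    \sum_(i < (2 * p).+1) cf2 v i 0 * cf2 v (2 * p - i) 0.
  by rewrite expr2 cf2M; apply: eq_bigr => i _; rewrite big_ord1.
have F0 (i : 'I_(2 * p).+1) : i != Ordinal hp -> cf2 v i 0 * cf2 v (2 * p - i) 0 = 0.
  move=> /eqP hi; have [lt1|le1] := ltnP i p.
    have lt3 : (2 * i < k)%N by apply: leq_ltn_trans lt; rewrite leq_mul2l ltnW.
    by rewrite (IH i lt1 lt3) mul0r.
  have lt1 : (p < i)%N.
    by rewrite ltn_neqAle le1 andbT; apply/eqP => Ei; case: hi; apply: val_inj.
  have lt2 : (2 * p - i < p)%N by move: (ltn_ord i); lia.
  have lt3 : (2 * (2 * p - i) < k)%N by move: lt lt2; lia.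
  by rewrite (IH _ lt2 lt3) mulr0.
rewrite (bigD1 (Ordinal hp) isT) (big1 _ _ _ F0) -[nat_of_ord (Ordinal hp)]/p.
have -> : (2 * p - p)%N = p by rewrite mul2n -addnn addKn.
exact: addr0.
Qed.

Lemma u_low p q : (2 * p + k * q < 2)%N -> cf2 u p q = 0.
Proof.
move=> lt; have [p0 q0] : p = 0%N /\ q = 0%N by move: hk lt; case: p q => [|p] [|q]; nia.
by rewrite p0 q0 (ordE ou).
Qed.
Lemma v_low2 p q : (2 * p + k * q < k)%N -> cf2 v p q = 0.
Proof.
move=> lt; have q0 : q = 0%N by move: hk lt; case: q => [|q]; nia.
by rewrite q0; apply: v_low; move: lt; rewrite q0 muln0 addn0.
Qed.

Definition ul := unscale 2 u.
Definition vl := unscale k v.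
(** Both members of [v^2 + e u^k = f] are homogeneous under the rescaling, with the same
factor [l^(2k)]. *)
Lemma family_ff : vl ^+ 2 + CC e%:P * ul ^+ k = ffB.
Proof.
have h := scale_rhom.
have E : scale (v ^+ 2 + CC e * u ^+ k) = CC 'X^(k * 2) * (vl ^+ 2 + CC e%:P * ul ^+ k).
  rewrite (rhD h (v ^+ 2)) (rhM h (CC e)) (rhX h u k) (rhX h v 2) scale_CC.
  rewrite -(unscaleE u_low) -(unscaleE v_low2) -/ul -/vl.
  have e1 : CC 'X^2 ^+ k = CC 'X^(k * 2) :> B by rewrite -rmorphXn -exprM mulnC.
  have e2 : CC 'X^k ^+ 2 = CC 'X^(k * 2) :> B by rewrite -rmorphXn -exprM.
  rewrite (exprMn k (CC 'X^2)) (exprMn 2 (CC 'X^k)) e1 e2.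
  move: (CC 'X^(k * 2)) (vl ^+ 2) (CC e%:P) (ul ^+ k) => a b c d; ring.
exact: (CC_Xn_inj (etrans (esym E) (etrans (congr1 scale hf) scale_ff))).
Qed.

(** The part of [u] of weight 2, which is the limit of the family at [l = 0]. *)
Definition u0 := ev 0 ul.
Definition v0 := ev 0 vl.

(** Integration of [area_exact] over the parameter from 0 to 1.  The coefficients [c_i(f)]
are constant along the family and commute with [f]. *)
Lemma homotopy (c : nat -> ps R) : exists G,
  pb u v * (\sum_(i < k.-1) u ^+ i * series_at (ff k e) (c i)) -
  pb u0 v0 * (\sum_(i < k.-1) u0 ^+ i * series_at (ff k e) (c i)) = pb G (ff k e).
Proof.
pose C i := series_at (ff k e) (c i).
have /choice [G hG] : forall i, exists G, dl (ul ^+ i * pb ul vl) = pb G ffB.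
  by move=> i; apply: area_exact; exact: family_ff.
(* [Ga i] is an antiderivative of [G i] in the parameter *)
pose Ga i : B := psmap2 antideriv (G i).
have dGa i : dl (Ga i) = G i.
  by apply: cf2P => p q; rewrite !cf2_psmap2 deriv_antideriv.
pose H := \sum_(i < k.-1) inj (C i) * (ul ^+ i * pb ul vl).
pose GG := \sum_(i < k.-1) inj (C i) * Ga i.
have pbC i : dx (inj (C i)) * dy ffB = dy (inj (C i)) * dx ffB.
  have E := psmap2_pb polyC_rhom (C i) (ff k e).
  have E0 : pb (inj (C i)) (inj (ff k e)) = 0.
    exact: etrans (esym E) (etrans (congr1 inj (pb_series_at e hk (c i))) (rh0 inj_rhom)).
  by rewrite inj_ff in E0; exact: subr0_eq E0.
have hd : dl (H - pb GG ffB) = 0.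
  have -> : pb GG ffB = \sum_(i < k.-1) inj (C i) * pb (Ga i) ffB.
    rewrite /pb /GG (der_sum (@dxP _)) (der_sum (@dyP _)) !mulr_suml -sumrB.
    apply: eq_bigr => i _; rewrite (derM (@dxP _) (inj (C i))) (derM (@dyP _) (inj (C i))).
    transitivity ((dx (inj (C i)) * dy ffB - dy (inj (C i)) * dx ffB) * Ga i +
      inj (C i) * (dx (Ga i) * dy ffB - dy (Ga i) * dx ffB)); first by ring.
    by rewrite pbC subrr mul0r add0r.
  rewrite /H -sumrB (der_sum dlP); apply: big1 => i _.
  by rewrite -mulrBr dl_injM (derB dlP) (hG i) dl_pb dGa subrr mulr0.
have E : ev 1 (H - pb GG ffB) = ev 0 (H - pb GG ffB).
  apply: cf2P => p q; rewrite !cf2_psmap2; apply: deriv0_const.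
  exact: (congr1 (fun z => cf2 z p q) hd).
have evH t : ev t H = pb (ev t ul) (ev t vl) * (\sum_(i < k.-1) (ev t ul) ^+ i * C i).
  have h := ev_rhom t; rewrite /H (rh_sum h) mulr_sumr; apply: eq_bigr => i _.
  rewrite (rhM h (inj (C i))) (rhM h (ul ^+ i)) (rhX h ul i) ev_inj ev_pb.
  move: (C i) (ev t ul ^+ i) (pb _ _) => x y z; ring.
exists (ev 1 GG - ev 0 GG).
have ev_split t : ev t (H - pb GG ffB) = ev t H - pb (ev t GG) (ff k e).
  by rewrite (rhB (ev_rhom t) H) ev_pb ev_ffB.
have H1 := evH 1; have H0 := evH 0; rewrite /ul /vl !ev1_unscale in H1.
rewrite pbBl; rewrite !ev_split H1 H0 in E.
exact: sub_swap E.
Qed.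

Lemma u0v0_ff : v0 ^+ 2 + CC e * u0 ^+ k = ff k e.
Proof.
have h := ev_rhom 0; apply: etrans (etrans (congr1 (ev 0) family_ff) (ev_ffB 0)); rewrite (rhD h (vl ^+ 2) (CC e%:P * ul ^+ k)).
rewrite (rhM h (CC e%:P) (ul ^+ k)) (rhX h ul k) (rhX h vl 2) ev_CC.
exact: erefl.
Qed.
End Family.
End Lambda.

(** * Uniqueness of the formal normal form *)

Section Unique.
Variables (R : realType) (k : nat) (e : R).
Hypotheses (hk : (2 <= k)%N) (he : e * e = 1).
Local Notation A := (ps (ps R)).
Local Notation f := (ff k e).
Local Notation "'H' c" := (hser k e c) (at level 10).

Lemma series_at_hom : is_rhom (@series_at R f).
Proof. exact: psubst_hom (ord_ff e hk) (CC_rhom R). Qed.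

Lemma hserB c c' : H c - H c' = H (fun i => c i - c' i).
Proof.
rewrite /hser -sumrB; apply: eq_bigr => i _.
by rewrite -mulrBr (rhB series_at_hom).
Qed.

Lemma cf2_series_at00 c : cf2 (series_at f c) 0 0 = cf c 0.
Proof.
rewrite (@psubst_coef _ _ _ _ (ord_ff e hk) c 1 0 0 isT) big_ord1 expr0 mulr1 cf2_CC.
by [].
Qed.

Lemma cf2_hser00 c : cf2 (H c) 0 0 = cf (c 0%N) 0.
Proof.
rewrite /hser cf2_sum.
have k1 : (0 < k.-1)%N by rewrite -ltnS prednK // ltnW.
have F0 (i : 'I_k.-1) : i != Ordinal k1 -> cf2 (vx ^+ i * series_at f (c i)) 0 0 = 0.
  move=> /eqP hi; rewrite cf2_vxXM leqn0; case: eqP => // i0.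
  by case: hi; apply: val_inj.
rewrite (bigD1 (Ordinal k1) isT) (big1 _ _ _ F0); apply: etrans (addr0 _) _.
by rewrite -[nat_of_ord (Ordinal k1)]/0%N expr0 mul1r cf2_series_at00.
Qed.

Lemma cf2_pb00 (G : A) : cf2 (pb G f) 0 0 = 0.
Proof.
have o : ord 1 (pb G f).
  rewrite /pb dx_ff dy_ff; apply: ordB; apply: ordMl; apply: ordMl.
    exact: ord_vy.
  apply: (@ord_le _ _ k.-1); first by rewrite -ltnS prednK // ltnW.
  by apply: ordX; exact: ord_vx.
by rewrite (ordE o).
Qed.

Lemma hser_unique c c' (G : A) : H c' - H c = pb G f ->
  forall i, (i < k.-1)%N -> c' i = c i.
Proof.
rewrite hserB => /(brieskorn_free hk he) h i hi.
exact: subr0_eq (h i hi).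
Qed.

(** The class in the Brieskorn module determines the coefficients; the Jacobian [x] must be
positive by comparison of the values at 0. *)
Lemma twisted_unique (x : R) c c' (G : A) : H c' - CC x * H c = pb G f ->
  0 < cf (c 0%N) 0 * cf (c' 0%N) 0 -> x ^+ 2 = 1 ->
  forall i, (i < k.-1)%N -> c' i = c i.
Proof.
move=> E hs hx.
have E0 := congr1 (fun z => cf2 z 0 0) E.
rewrite /= cf2_pb00 cf2B cf2CM !cf2_hser00 in E0.
suff x1 : x = 1.
  by rewrite x1 rmorph1 mul1r in E; exact: hser_unique E.
move: hs; rewrite (subr0_eq E0) mulrCA => hs.
have sq : 0 <= cf (c 0%N) 0 * cf (c 0%N) 0 by rewrite -expr2 sqr_ge0.
have x0 : 0 < x.
  rewrite ltNge; apply/negP => x0.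
  by move: hs; rewrite ltNge mulr_le0_ge0.
apply/eqP; rewrite -(@eqrXn2 _ 2) ?ltW //; first by rewrite hx expr1n.
Qed.

Lemma square_one (y : R) n : (0 < n)%N -> y ^+ n = 1 -> y ^+ 2 = 1.
Proof.
move=> n0 h; have : `|y| ^+ n = 1 by rewrite -normrX h normr1.
move=> /eqP; rewrite pexpr_eq1 ?normr_ge0 // => /eqP y1.
by rewrite -real_normK ?num_real // y1 expr1n.
Qed.

(** Comparison of the coefficients of [xi^2], [x^l xi] and [x^k].  The monomial [x^l] in
[v0] has the weight of [xi] only when [k = 2 l]. *)
Lemma leading_generic (u0 v0 : A) (a d g : R) (l : nat) :
  v0 ^+ 2 + CC e * u0 ^+ k = f -> (2 < k)%N -> (0 < l)%N ->
  (odd k -> g = 0) -> (~~ odd k -> l.*2 = k) ->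
  u0 = CC a * vx -> v0 = CC d * vy + CC g * vx ^+ l ->
  [/\ d ^+ 2 = 1, g = 0 & a ^+ k = 1].
Proof.
move=> hf k3 l0 godd leven hu hv.
have E : CC (d ^+ 2) * vx ^+ 0 * vy ^+ 2 + CC (2 * d * g) * vx ^+ l * vy ^+ 1 +
    CC (g ^+ 2) * vx ^+ l.*2 * vy ^+ 0 + CC (e * a ^+ k) * vx ^+ k * vy ^+ 0 = f.
  apply: etrans hf; rewrite hu hv (exprMn k (CC a)) expr0 expr1 expr0.
  rewrite -addnn exprD !CCM !CCX (CCn R 2).
  move: (CC d) (CC g) (CC e) (CC a ^+ k) (vx ^+ l) (vx ^+ k) => x1 x2 x3 x4 x5 x6; ring.
have C0 i j := congr1 (fun z => cf2 z i j) E.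
have {E C0 hf hu hv}C i j : (if (i == 0%N) && (j == 2%N) then d ^+ 2 else 0) +
    (if (i == l) && (j == 1%N) then 2 * d * g else 0) +
    (if (i == l.*2) && (j == 0%N) then g ^+ 2 else 0) +
    (if (i == k) && (j == 0%N) then e * a ^+ k else 0) =
    (if (i == 0%N) && (j == 2%N) then 1 else 0) + (if (i == k) && (j == 0%N) then e else 0).
  by rewrite -cf2_ff -(C0 i j) /= !cf2D !cf2_mon.
have d1 : d ^+ 2 = 1.
  by have := C 0%N 2%N; rewrite /= !andbF !addr0.
have g0 : g = 0.
  case ok: (odd k); first exact: godd.
  have := C l 1%N; rewrite /= !andbF eqxx /= !addr0 add0r => /eqP.
  rewrite !mulf_eq0 pnatr_eq0 /= => /orP[/eqP d0|/eqP //].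
  by move: d1; rewrite d0 expr0n => /esym/eqP; rewrite oner_eq0.
have ak : e * a ^+ k = e.
  have := C k 0%N; rewrite /= !andbF eqxx /= g0 expr0n /= !add0r.
  by rewrite if_same add0r eqxx.
split; [exact: d1 | exact: g0 |].
by rewrite -[LHS]mul1r -he -mulrA ak.
Qed.

(** The quadratic form [xi^2 + e x^2] is preserved, so the square of the determinant
is 1. *)
Lemma leading_two (u0 v0 : A) (a b g d : R) :
  v0 ^+ 2 + CC e * u0 ^+ k = f -> k = 2%N ->
  u0 = CC a * vx + CC b * vy -> v0 = CC g * vx + CC d * vy ->
  (a * d - b * g) ^+ 2 = 1.
Proof.
move=> hf k2 hu hv.
have E : CC (g ^+ 2 + e * a ^+ 2) * vx ^+ 2 * vy ^+ 0 +
    CC (2 * (g * d + e * (a * b))) * vx ^+ 1 * vy ^+ 1 +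
    CC (d ^+ 2 + e * b ^+ 2) * vx ^+ 0 * vy ^+ 2 = f.
  apply: etrans hf; rewrite hu hv k2 expr0 expr1 expr0 expr1.
  rewrite (CCM 2) (CCn R 2) !(CCM, CCD, CCX).
  move: (CC d) (CC g) (CC e) (CC a) (CC b) => x1 x2 x3 x4 x5; ring.
have C i j : (if (i == 2%N) && (j == 0%N) then g ^+ 2 + e * a ^+ 2 else 0) +
    (if (i == 1%N) && (j == 1%N) then 2 * (g * d + e * (a * b)) else 0) +
    (if (i == 0%N) && (j == 2%N) then d ^+ 2 + e * b ^+ 2 else 0) =
    (if (i == 0%N) && (j == 2%N) then 1 else 0) + (if (i == k) && (j == 0%N) then e else 0).
  by rewrite -cf2_ff -E !cf2D !cf2_mon.
clear E hf hu hv.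
have h1 : g ^+ 2 + e * a ^+ 2 = e by have := C 2%N 0%N; rewrite k2 /= !addr0 add0r.
have h2 : d ^+ 2 + e * b ^+ 2 = 1 by have := C 0%N 2%N; rewrite /= !add0r andbF addr0.
have h3 : g * d + e * (a * b) = 0.
  have := C 1%N 1%N; rewrite /= andbF !addr0 add0r => /eqP.
  by rewrite mulf_eq0 pnatr_eq0 /= => /eqP.
have h4 : g * d = - (e * (a * b)) by apply/eqP; rewrite -addr_eq0 h3.
have h5 : g ^+ 2 = e - e * a ^+ 2 by clear -h1; lra.
have h6 : d ^+ 2 = 1 - e * b ^+ 2 by clear -h2; lra.
have h7 : (g * d) ^+ 2 = a ^+ 2 * b ^+ 2.
  by rewrite h4; transitivity ((e * e) * (a ^+ 2 * b ^+ 2)); [ring | rewrite he mul1r].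
have h8 : a ^+ 2 + e * b ^+ 2 = 1.
  move: h7; rewrite exprMn h5 h6 => h7.
  have : e * ((e - e * a ^+ 2) * (1 - e * b ^+ 2)) = e * (a ^+ 2 * b ^+ 2) by rewrite h7.
  have -> : e * ((e - e * a ^+ 2) * (1 - e * b ^+ 2)) =
     (e * e) * (1 - a ^+ 2) - (e * e) * e * (b ^+ 2 - a ^+ 2 * b ^+ 2) by ring.
  rewrite he => h9; have : e * (a ^+ 2 * b ^+ 2) = e * (a ^+ 2 * b ^+ 2) by [].
  lra.
transitivity (a ^+ 2 * d ^+ 2 - 2 * (a * b) * (g * d) + b ^+ 2 * g ^+ 2); first by ring.
by rewrite h4 h5 h6 -[RHS]h8; ring.
Qed.

Lemma linear_part (x u : A) : cf2 u 0 0 = 0 ->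
  (forall p q, cf2 x p q = if (2 * p + 2 * q <= 2)%N then cf2 u p q else 0) ->
  x = CC (cf2 u 1 0) * vx + CC (cf2 u 0 1) * vy.
Proof.
move=> U0 U; apply: cf2P => p q; rewrite U cf2D !cf2CM cf2_vx cf2_vy; clear U.
have : [\/ p = 0%N /\ q = 0%N, p = 1%N /\ q = 0%N, p = 0%N /\ q = 1%N |
        (2 < 2 * p + 2 * q)%N].
  have : (p + q <= 1)%N \/ (2 < 2 * p + 2 * q)%N by clear; lia.
  case=> h; last by apply: Or44.
  by case: p q h => [|[|p]] [|[|q]] h; by [apply: Or41|apply: Or42|apply: Or43|].
case=> [[-> ->]|[-> ->]|[-> ->]|h].
- by rewrite U0 !mulr0 addr0.
- by rewrite mulr1 mulr0 addr0.
- by rewrite mulr1 mulr0 add0r.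
have -> : (p == 1%N) && (q == 0%N) = false by apply/negP => /andP[/eqP p1 /eqP q0]; rewrite p1 q0 in h.
have -> : (p == 0%N) && (q == 1%N) = false by apply/negP => /andP[/eqP p1 /eqP q0]; rewrite p1 q0 in h.
by rewrite leqNgt h !mulr0 addr0.
Qed.

Lemma weighted_part_fst (x u : A) : (2 < k)%N -> cf2 u 0 0 = 0 ->
  (forall p q, cf2 x p q = if (2 * p + k * q <= 2)%N then cf2 u p q else 0) ->
  x = CC (cf2 u 1 0) * vx.
Proof.
move=> k3 U0 U; apply: cf2P => p q; rewrite U cf2CM cf2_vx; clear U.
case: q => [|q]; last first.
  rewrite andbF mulr0 leqNgt (_ : (2 < 2 * p + k * q.+1)%N); first by [].
  by apply: leq_trans k3 _; rewrite mulnS addnCA leq_addr.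
rewrite muln0 addn0 andbT; case: p => [|[|p]]; rewrite ?muln0 ?muln1 ?mulr0 ?mulr1.
- by rewrite U0.
- exact: erefl.
by rewrite leqNgt (_ : (2 < 2 * p.+2)%N) //; clear; lia.
Qed.

Lemma weighted_part_snd (y v : A) (g := if odd k then 0 else cf2 v k./2 0) :
  (2 < k)%N -> (forall p, (2 * p < k)%N -> cf2 v p 0 = 0) ->
  (forall p q, cf2 y p q = if (2 * p + k * q <= k)%N then cf2 v p q else 0) ->
  y = CC (cf2 v 0 1) * vy + CC g * vx ^+ k./2.
Proof.
move=> k3 V0 V.
have vxk p q : cf2 (vx ^+ k./2 : A) p q = if (p == k./2) && (q == 0%N) then 1 else 0.
  have := cf2_mon (1 : R) k./2 0 p q.
  by rewrite (rmorph1 (@CC R)) expr0 mul1r mulr1.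
apply: cf2P => p q; rewrite V cf2D !cf2CM cf2_vy vxk; clear V vxk.
case: q => [|[|q]]; last first.
- rewrite andbF andbF !mulr0 addr0; case: leqP => [h|_]; last exact: erefl.
  exfalso; move: h; apply/negP; rewrite -ltnNge !mulnS addnCA.
  by rewrite -[X in (X < _)%N]addn0 ltn_add2l addnCA ltn_addr // ltnW // ltnW.
- rewrite muln1 andbF andbT mulr0 addr0.
  case: p => [|p]; first by rewrite muln0 add0n leqnn mulr1.
  by rewrite mulr0 leqNgt (_ : (k < 2 * p.+1 + k)%N); [|clear; lia].
rewrite muln0 addn0 andbF andbT mulr0 add0r.
case: (ltngtP (2 * p) k) => h.
- rewrite (V0 _ h) /g; case ok: (odd k); first by rewrite mul0r.
  case: eqP => E; last by rewrite mulr0.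
  by move: h; rewrite E mul2n -{2}(odd_double_half k) ok ltnn.
- case: eqP => E; last by rewrite mulr0.
  exfalso; move: h; rewrite E mul2n -{1}(odd_double_half k).
  by case: (odd k) => /=; clear; lia.
- have ok : odd k = false by rewrite -h mul2n odd_double.
  have E : p = k./2 by rewrite -h mul2n doubleK.
  by rewrite E eqxx mulr1 /g ok.
Qed.

Lemma dx_linear (a b : R) : dx (CC a * vx + CC b * vy) = CC a :> A.
Proof.
apply: etrans (derD (@dxP R) _ _) _.
rewrite (derM (@dxP R) (CC a)) (derM (@dxP R) (CC b)) !dxC dxvx dxvy.
by rewrite !mul0r mulr1 mulr0 !add0r addr0.
Qed.

Lemma dy_linear (a b : R) : dy (CC a * vx + CC b * vy) = CC b :> A.
Proof.
apply: etrans (derD (@dyP R) _ _) _.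
rewrite (derM (@dyP R) (CC a)) (derM (@dyP R) (CC b)) !dyC dyvx dyvy.
by rewrite !mul0r mulr1 mulr0 !add0r.
Qed.

Lemma pb_linear (a b g d : R) :
  pb (CC a * vx + CC b * vy) (CC g * vx + CC d * vy) = CC (a * d - b * g) :> A.
Proof.
apply: (@etrans _ _ (CC a * CC d - CC b * CC g)); last by rewrite CCD CCN !CCM.
by congr (_ * _ - _ * _);
  [exact: dx_linear | exact: dy_linear | exact: dy_linear | exact: dx_linear].
Qed.

Lemma pb_diag (a d : R) : pb (CC a * vx) (CC d * vy) = CC (a * d) :> A.
Proof.
rewrite /pb !(derM (@dxP R) (CC _)) !(derM (@dyP R) (CC _)) !dxC !dyC.
rewrite dxvx dyvx dxvy dyvy CCM.
by move: (CC a) (CC d) => x1 x2; ring.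
Qed.

Lemma weighted_unique_two (a b g d : R) (c c' : nat -> ps R) (G : A) : k = 2%N ->
  (CC g * vx + CC d * vy) ^+ 2 + CC e * (CC a * vx + CC b * vy) ^+ k = f ->
  H c' - pb (CC a * vx + CC b * vy) (CC g * vx + CC d * vy) *
    (\sum_(i < k.-1) (CC a * vx + CC b * vy) ^+ i * series_at f (c i)) = pb G f ->
  0 < cf (c 0%N) 0 * cf (c' 0%N) 0 ->
  forall i, (i < k.-1)%N -> c' i = c i.
Proof.
move=> k2 hf; have J := leading_two hf k2 erefl erefl; clear hf.
rewrite pb_linear; set S := (\sum_(i < _) _) => hG hs.
have ES : S = H c.
  clear hG; apply: eq_bigr => i _.
  have -> : nat_of_ord i = 0%N by move: (ltn_ord i); rewrite {2}k2; case: (nat_of_ord i).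
  by rewrite !expr0.
rewrite ES in hG; exact: (twisted_unique hG hs J).
Qed.

(** For [a = -1], possible only for even [k], the sign [a^i] is absorbed in the
coefficients with odd index. *)
Lemma weighted_unique (a d : R) (c c' : nat -> ps R) (G : A) : a ^+ k = 1 -> d ^+ 2 = 1 ->
  H c' - pb (CC a * vx) (CC d * vy) *
    (\sum_(i < k.-1) (CC a * vx) ^+ i * series_at f (c i)) = pb G f ->
  0 < cf (c 0%N) 0 * cf (c' 0%N) 0 ->
  (forall i, (i < k.-1)%N -> c' i = c i) \/
  (~~ odd k /\ forall i, (i < k.-1)%N -> c' i = if odd i then - c i else c i).
Proof.
move=> ak d1; rewrite pb_diag; set S := (\sum_(i < _) _) => hG hs.
have a1 : a ^+ 2 = 1 by apply: square_one ak; apply: leq_trans hk.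
have ad1 : (a * d) ^+ 2 = 1 by rewrite exprMn a1 d1 mulr1.
have [aE|aE] : a = 1 \/ a = -1.
  by have /eqP := a1; rewrite sqrf_eq1 => /orP[/eqP|/eqP]; [left|right].
  have ES : S = H c by clear hG; apply: eq_bigr => i _; rewrite aE CC1 mul1r.
  by left; rewrite ES in hG; exact: (twisted_unique hG hs ad1).
right; have ok : ~~ odd k.
  apply/negP => ok; move: ak; rewrite aE -signr_odd ok expr1 => h.
  by have := ltrN10 R; rewrite h ltr10.
split; first exact: ok.
pose c1 i := if odd i then - c i else c i.
have ES : S = H c1.
  clear hG; apply: eq_bigr => i _.
  rewrite (exprMn i (CC a)) aE CCN CC1 -signr_odd /c1.
  case: (odd i); rewrite ?expr1 ?expr0 ?mul1r ?mulN1r ?(rhN series_at_hom) ?mulrN ?mulNr; exact: erefl.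
rewrite ES in hG; exact: (@twisted_unique (a * d) c1 c' G hG hs ad1).
Qed.

(** By [homotopy] the map may be replaced by its part of lowest weight, which is determined
explicitly. *)
Theorem formal_unique (u v : A) (c c' : nat -> ps R) : ord 1 u ->
  v ^+ 2 + CC e * u ^+ k = f ->
  pb u v * (\sum_(i < k.-1) u ^+ i * series_at f (c i)) = H c' ->
  0 < cf (c 0%N) 0 * cf (c' 0%N) 0 ->
  (forall i, (i < k.-1)%N -> c' i = c i) \/
  (~~ odd k /\ forall i, (i < k.-1)%N -> c' i = if odd i then - c i else c i).
Proof.
move=> ou hf hw hs.
have [G hG] := homotopy hk he ou hf c.
have hf0 := u0v0_ff hk ou hf.
rewrite hw in hG.
have U p q : cf2 (u0 k u) p q = if (2 * p + k * q <= 2)%N then cf2 u p q else 0.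
  exact: cf2_ev0.
have V p q : cf2 (v0 k v) p q = if (2 * p + k * q <= k)%N then cf2 v p q else 0.
  exact: cf2_ev0.
have V0 p : (2 * p < k)%N -> cf2 v p 0 = 0 := fun h => v_low hk ou hf h.
have U0 : cf2 u 0 0 = 0 := ordE ou (isT : (0 + 0 < 1)%N).
clear hf hw.
move: (u0 k u) (v0 k v) hf0 hG U V => x y hf hG U V.
have [k2|k3] : k = 2%N \/ (2 < k)%N.
  by clear -hk; move: hk; rewrite leq_eqVlt => /orP[/eqP|]; [left|right].
  left.
  have {U}U p q : cf2 x p q = if (2 * p + 2 * q <= 2)%N then cf2 u p q else 0.
    by rewrite U k2.
  have {V}V p q : cf2 y p q = if (2 * p + 2 * q <= 2)%N then cf2 v p q else 0.
    by rewrite V k2.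
  have v00 : cf2 v 0 0 = 0 by apply: V0; rewrite k2.
  have hx := linear_part U0 U; have hy := linear_part v00 V.
  rewrite hx hy in hf hG; exact: (weighted_unique_two k2 hf hG hs).
have hx := weighted_part_fst k3 U0 U; have hy := weighted_part_snd k3 V0 V.
set g := if odd k then _ else _ in hy.
have kh : (0 < k./2)%N by clear -k3; rewrite half_gt0; exact: ltnW.
have leven : ~~ odd k -> k./2.*2 = k.
  by clear; move=> ok; rewrite -{2}(odd_double_half k) (negPf ok).
have godd : odd k -> g = 0 by clear; rewrite /g => ->.
have [d1 g0 ak] := leading_generic hf k3 kh godd leven hx hy.
rewrite g0 CC0 mul0r addr0 in hy; rewrite hx hy in hG.
exact: (weighted_unique ak d1 hG hs).
Qed.
End Unique.

(** * Analytic functions of one variable and their Taylor coefficients *)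

Section Germ1.
Variable R : realType.
Implicit Types (a : ps R) (c : R -> R).

(** Functions of one variable are treated as functions of the second coordinate, so that the
results for two variables apply. *)
Definition germ1 a c := germ (psC a) (fun p => c p.2).

Lemma cf2_psC a i j : cf2 (psC a) i j = if i == 0%N then cf a j else 0.
Proof. by rewrite /cf2 cfC; case: eqP. Qed.

Lemma sq_psC a (p : R * R) n : sq (psC a) p n = pseries (cf a) p.2 n.
Proof.
case: n => [|n]; first by rewrite /sq /pseries /series /= big_ord0 big_geq.
rewrite /sq big_ord_recl [X in _ + X]big1 ?addr0; last first.
  by move=> i _; rewrite big1 // => j _; rewrite cf2_psC lift0 !mul0r.
rewrite /pseries /series /= big_mkord; apply: eq_bigr => j _.
by rewrite cf2_psC expr0 mulr1.
Qed.

(** The terms of a convergent series are bounded, whence absolute convergence at a smaller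
radius. *)
Lemma analytic1_germ c : analytic1 c -> exists a, germ1 a c.
Proof.
move=> [a0 [r [r0 h]]]; pose a := PS a0.
pose s := r / 2; have s0 : 0 < s by rewrite divr_gt0.
have sr : s < r by rewrite /s; lra.
have [M hM] : exists M, forall n, `|a0 n| * s ^+ n <= M.
  have hs : `|s| < r by rewrite gtr0_norm.
  have cv : cvgn (series (fun n => a0 n * s ^+ n)).
    by apply/cvg_ex; exists (c s); exact: h.
  have [M _ hM] := pinfty_ex_gt0 (cvg_seq_bounded (cvgP _ (cvg_series_cvg_0 cv))).
  exists M => n; have := hM n I => /=.
  by rewrite normrM normrX (gtr0_norm s0).
have ca : convergent (psC a).
  apply: (@convergent_coef _ s (Num.max M 0)) => // i j.
  rewrite cf2_psC; case: eqP => [->|_]; last by rewrite normr0 mul0r le_max lexx orbT.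
  by rewrite add0n le_max hM.
have [t [K t0 ba]] := ca.
exists a, (Num.min t r); have m0 : 0 < Num.min t r by rewrite lt_min t0.
have fa : fin (Num.min t r) (psC a).
  by exists K; apply: bnd_rad ba _; rewrite (ltW m0) ge_min lexx.
split; [exact: m0 | exact: fa | move=> p hp].
have E : sq (psC a) p n @[n --> \oo] --> c p.2.
  have -> : sq (psC a) p = pseries a0 p.2 by apply/funext => n; rewrite sq_psC.
  apply: h; move: hp; rewrite norm_pair_lt => /andP[_]; rewrite lt_min.
  by case/andP.
by rewrite (evalP fa (ltW hp) E).
Qed.

Lemma germ1_analytic c a : germ1 a c -> analytic1 c.
Proof.
move=> [r [r0 [M ba] h]]; exists (cf a), r; split=> // t ht.
have hp : `|(0, t) : R * R| < r by rewrite norm_pair_lt /= normr0 r0.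
have -> : c t = pseval (psC a) (0, t) := h _ hp.
have := eval_cvg ba (ltW hp).
by rewrite (_ : sq (psC a) (0, t) = pseries (cf a) t) //; apply/funext => n; rewrite sq_psC.
Qed.

Definition psfun a : R -> R := fun t => pseval (psC a) (0, t).

Lemma pseval_psC a (p : R * R) : pseval (psC a) p = psfun a p.2.
Proof.
rewrite /psfun pseval.unlock; congr (limn _); apply/funext => n.
exact: etrans (sq_psC a p n) (esym (sq_psC a (0, p.2) n)).
Qed.

Lemma germ1_psfun a : convergent (psC a) -> germ1 a (psfun a).
Proof.
move=> /convergent_germ h; rewrite /germ1.
by rewrite (_ : (fun p => psfun a p.2) = pseval (psC a)) //; apply/funext => p; rewrite pseval_psC.
Qed.

Lemma near_snd (P : R -> Prop) : (\forall t \near (0 : R), P t) <->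
  \forall p \near (0 : R * R), P p.2.
Proof.
split=> /near0P [r r0 h]; apply/near0P; exists r => // x hx.
  by apply: h; move: hx; rewrite norm_pair_lt => /andP[].
apply: (h (0, x)).
by rewrite norm_pair_lt /= normr0 r0.
Qed.


Lemma germ1_eq a b c d : germ1 a c -> germ1 b d -> (eq_germ c d <-> a = b).
Proof.
move=> ha hb; split=> [/near_snd h|E].
  have /(congr1 (fun z => cf z 0)) := germ_inj ha hb h; rewrite !cfC; exact.
by apply/near_snd; rewrite E in ha; exact: germ_eq ha hb.
Qed.

Lemma germ1_at0 a c : germ1 a c -> c 0 = cf a 0.
Proof. by move=> h; apply: etrans (germ_at0 h) _; rewrite cf2_psC. Qed.

Lemma germ1N a c : germ1 a c -> germ1 (- a) (fun t => - c t).
Proof.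
move=> h; rewrite /germ1 -mulN1r.
have h1 := germM (germC (-1)) h.
rewrite CCN CC1 in h1.
by rewrite (_ : psC (-1 * a) = -1 * psC a); [apply: germ_near h1 _; near=> p; rewrite mulN1r | rewrite !mulN1r rmorphN].
Unshelve. all: by end_near. Qed.

(** The derivative is the differential of [(x, t) -> c(t)] restricted to a vertical
line. *)
Lemma germ1_derive a c : germ1 a c -> germ1 (pderiv a) (derive1 c).
Proof.
move=> h.
have hd : dy (psC a) = psC (pderiv a) :> ps (ps R) by apply: psmapC; exact: pderivP.
have g : germ (psC (pderiv a)) (pseval (psC (pderiv a))).
  by apply: convergent_germ; rewrite -hd; apply: convergent_dy; exact: germ_convergent h.
apply: germ_near g _; have D := germ_deriv h.
suff : \forall t \near (0 : R), psfun (pderiv a) t = (derive1 c) t.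
  by move=> /near_snd N; near=> p; rewrite pseval_psC; near: p.
move/near0P: D => [r r0 D]; apply/near0P; exists r => // t ht.
have hp : `|(0, t) : R * R| < r by rewrite norm_pair_lt /= normr0 r0.
have [d1 e1] := D _ hp.
pose inc (t : R) : R * R := (0, t).
have : is_derive t (1 : R) ((fun p : R * R => c p.2) \o inc) (psfun (pderiv a) t).
  have [dinc vinc] : differentiable inc t /\ 'd inc t = (fun u => (0, u)) :> (R -> R * R).
    have di : is_diff t inc (fun u => (0, u)) by apply: is_diff_eq.
    by case: di.
  have dd : differentiable ((fun p : R * R => c p.2) \o inc) t by exact: differentiable_comp.
  apply: DeriveDef; first exact: diff_derivable.
  rewrite (deriveE _ dd) (diff_comp dinc d1) /= e1 vinc.
  by rewrite /lin2 /= mulr0 add0r mulr1 hd pseval_psC.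
by move=> D1; rewrite derive1E (@derive_val _ _ _ _ _ _ _ D1).
Unshelve. all: by end_near. Qed.

Lemma taylor_coefE a c n : germ1 a c -> taylor_coef c n = cf a n.
Proof.
have H m : forall a c, germ1 a c -> derive1n m c 0 = cf a m * m`!%:R.
  elim: m => [|m IH] {}a {}c h; first by rewrite derive1n0 (germ1_at0 h) mulr1.
  rewrite derive1Sn.
  rewrite (IH _ _ (germ1_derive h)) /= factS natrM mulrA; congr (_ * _).
  by rewrite mulrC.
by move=> h; rewrite /taylor_coef (H n _ _ h) mulfK // pnatr_eq0 -lt0n fact_gt0.
Qed.
End Germ1.

(** * Pull-back of area forms *)

Section Forms.
Variable R : realType.
Local Notation A := (ps (ps R)).
Implicit Types (a b u v : A) (H K h q : R * R -> R) (psi : R * R -> R * R).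

(** The multiplicativity of Jacobians. *)
Lemma pb_subst2 u v a b : ord 1 u -> ord 1 v ->
  pb (subst2 u v a) (subst2 u v b) = subst2 u v (pb a b) * pb u v.
Proof.
move=> hu hv; have hs := subst2_hom hu hv.
have X c := subst2_der hu hv c (@dxP R) (@ord_dx R) (@dxC R).
have Y c := subst2_der hu hv c (@dyP R) (@ord_dy R) (@dyC R).
rewrite {1}/pb (X a) (X b) (Y a) (Y b).
rewrite {1}/pb (rhB hs) (rhM hs (dx a)) (rhM hs (dy a)) /pb.
move: (subst2 u v (dx a)) (subst2 u v (dy a)) (subst2 u v (dx b)) (subst2 u v (dy b)).
move: (dx u) (dy u) (dx v) (dy v) => x1 x2 x3 x4 y1 y2 y3 y4; ring.
Qed.

Lemma pb_id : pb vx vy = 1 :> A.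
Proof. by rewrite /pb dxvx dyvy dyvx mul0r subr0 mulr1. Qed.

Lemma cf2_00M a b : cf2 (a * b) 0 0 = cf2 a 0 0 * cf2 b 0 0.
Proof. by rewrite cf2M big_ord1 big_ord1. Qed.

Lemma cf2_00_subst2 u v a : ord 1 u -> ord 1 v -> cf2 (subst2 u v a) 0 0 = cf2 a 0 0.
Proof.
move=> hu hv; rewrite (@subst2_coef _ _ _ hu hv 1 a 0 0 isT) !big_ord1 !expr0 mulr1.
by rewrite -(rmorph1 (@CC R)) cf2_CC mulr1.
Qed.

Lemma germB a b H K : germ a H -> germ b K -> germ (a - b) (fun p => H p - K p).
Proof.
move=> ha hb; have := germD ha (germM (germC (-1)) hb).
rewrite CCN CC1 mulN1r => h; apply: germ_near h _.
by near=> p; rewrite mulN1r.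
Unshelve. all: by end_near. Qed.

(** In the plane a 2-form is pulled back by multiplication with the Jacobian
determinant. *)
Lemma pullback_area psi u v : is_emap psi u v -> exists2 J, germ (pb u v) J &
  \forall p \near (0 : R * R), forall x y,
    dxi_dx ('d psi p x) ('d psi p y) = J p * dxi_dx x y.
Proof.
move=> he; have [/germ_convergent cu /germ_convergent cv _ _] := he.
exists (fun p => pseval (dx u) p * pseval (dy v) p - pseval (dy u) p * pseval (dx v) p).
  by apply: germB; apply: germM; apply: convergent_germ;
    try (exact: convergent_dx); exact: convergent_dy.
near=> p => x y.
have D w : 'd psi p w = (lin2 (pseval (dx u) p) (pseval (dy u) p) w,
                         lin2 (pseval (dx v) p) (pseval (dy v) p) w).
  by move: w; near: p; exact: emap_diff.
by rewrite !D /dxi_dx /lin2 /=; ring.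
Unshelve. all: by end_near. Qed.

Section Equiv.
Variables (H h : R * R -> R) (w : two_form R) (a b : A).
Hypotheses (ga : germ a H) (gb : germ b h).
Hypothesis wE : \forall p \near (0 : R * R), forall x y, w p x y = h p * dxi_dx x y.

Lemma pullback_density psi u v : is_emap psi u v ->
  exists2 q, germ (subst2 u v b * pb u v) q &
  \forall p \near (0 : R * R), forall x y, pullback_form psi w p x y = q p * dxi_dx x y.
Proof.
move=> he; have [J gJ hJ] := pullback_area he.
exists (fun p => h (psi p) * J p); first exact: germM (germ_emap gb he) gJ.
have hw := emap_near he wE.
near=> p => x y; rewrite /pullback_form.
have -> x' y' : w (psi p) x' y' = h (psi p) * dxi_dx x' y'.
  by move: x' y'; near: p.
by rewrite -mulrA; congr (_ * _); move: x y; near: p.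
Unshelve. all: by end_near. Qed.

(** Sufficient condition for equivalence in terms of series: only one function has to be
compared for each form, since forms in the plane are multiples of [dxi_dx]. *)
Lemma pair_equivI psi u v K q : diffeo_germ psi -> is_emap psi u v ->
  germ (subst2 u v a) K -> germ (subst2 u v b * pb u v) q ->
  pair_equiv (H, w) (K, fun p x y => q p * dxi_dx x y).
Proof.
move=> hpsi he gK gq; exists psi; split=> //=.
  exact: germ_eq gK (germ_emap ga he).
have [q' gq' hq'] := pullback_density he.
have hq := germ_eq gq gq'.
near=> p => x y.
have -> : q p = q' p by near: p.
by apply: esym; move: x y; near: p.
Unshelve. all: by end_near. Qed.

(** Evaluation of the forms on the standard frame [(0, 1), (1, 0)], on which [dxi_dx] has
value 1. *)
Lemma pair_equivE K q a' b' : germ a' K -> germ b' q ->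
  pair_equiv (H, w) (K, fun p x y => q p * dxi_dx x y) ->
  exists u v, [/\ ord 1 u, ord 1 v, subst2 u v a = a' & subst2 u v b * pb u v = b'].
Proof.
move=> ga' gb' [psi [[psi0 an _] /= EK Eq]].
have [u [v he]] := analytic_emap an psi0; have [_ _ ou ov] := he.
have [q' gq' hq'] := pullback_density he.
exists u, v; split; [exact: ou | exact: ov | |].
  apply: germ_inj (germ_emap ga he) ga' _.
  by near=> p; apply: esym; near: p.
apply: germ_inj gq' gb' _; near=> p.
have one : dxi_dx (0, 1) (1, 0) = 1 :> R by rewrite /dxi_dx /= mulr1 mulr0 subr0.
have E1 : forall x y, q p * dxi_dx x y = pullback_form psi w p x y by near: p.
have E2 : forall x y, pullback_form psi w p x y = q' p * dxi_dx x y by near: p.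
by have := etrans (E1 (0, 1) (1, 0)) (E2 _ _); rewrite one !mulr1.
Unshelve. all: by end_near. Qed.
End Equiv.

Lemma diffeo_comp psi psi' : diffeo_germ psi -> diffeo_germ psi' ->
  diffeo_germ (fun p => psi' (psi p)).
Proof.
move=> [p0 ap [phi [f0 af e1 e2]]] [p0' ap' [phi' [f0' af' e1' e2']]].
have [u [v he]] := analytic_emap ap p0; have [u' [v' he']] := analytic_emap ap' p0'.
have [s [t hf]] := analytic_emap af f0; have [s' [t' hf']] := analytic_emap af' f0'.
have [an _] := emap_analytic (emap_comp he he').
have [an' _] := emap_analytic (emap_comp hf' hf).
split; [by rewrite p0 p0' | exact: an | exists (fun p => phi (phi' p))].
split; [by rewrite f0' f0 | exact: an' | |].
  have h := emap_near he e1'; near=> p.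
  have -> : phi' (psi' (psi p)) = psi p by near: p.
  by near: p.
have h := emap_near hf' e2; near=> p.
have -> : psi (phi (phi' p)) = phi' p by near: p.
by near: p.
Unshelve. all: by end_near. Qed.

Lemma diffeo_id : diffeo_germ (fun p : R * R => p) /\ is_emap (fun p : R * R => p) vx vy.
Proof.
have he : is_emap (fun p : R * R => p) vx vy.
  by split; [exact: germ_fst | exact: germ_snd | exact: ord_vx | exact: ord_vy].
have [an _] := emap_analytic he.
split; last exact: he.
by split; [exact: erefl | exact: an | exists (fun p => p); split; [exact: erefl | exact: an | |]; near=> p].
Unshelve. all: by end_near. Qed.

Lemma diffeo_opp : diffeo_germ (fun p : R * R => - p) /\
  is_emap (fun p : R * R => - p) (- vx) (- vy).
Proof.
have neg (c : A) (F : R * R -> R) : germ c F -> germ (- c) (fun p => - F p).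
  move=> g; have := germM (germC (-1)) g; rewrite CCN CC1 mulN1r => h.
  by apply: germ_near h _; near=> p; rewrite mulN1r.
have he : is_emap (fun p : R * R => - p) (- vx) (- vy).
  split; [exact: (neg _ _ (@germ_fst R)) | exact: (neg _ _ (@germ_snd R)) | |]; apply: ordN.
    exact: ord_vx.
  exact: ord_vy.
have [an z0] := emap_analytic he.
split; last exact: he.
split; [exact: z0 | exact: an | exists (fun p => - p); split; [exact: z0 | exact: an | |]];
  by near=> p; rewrite opprK.
Unshelve. all: by end_near. Qed.

(** Bilinearity and antisymmetry determine the form by its value on the frame; that
value does not vanish at 0 by nondegeneracy. *)
Lemma symplectic_density w : symplectic_germ w -> exists2 h : R * R -> R,
  h 0 != 0 & analytic2 h /\
  \forall p \near (0 : R * R), forall x y, w p x y = h p * dxi_dx x y.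
Proof.
have lin (f : R * R -> R) : linear_for *%R f ->
    forall x : R * R, f x = x.1 * f (1, 0) + x.2 * f (0, 1).
  move=> L x; have f0 : f 0 = 0.
    have := L 1 0 0; rewrite scaler0 addr0 mul1r => /eqP.
    by rewrite -subr_eq0 opprD addrA subrr sub0r oppr_eq0 => /eqP.
  rewrite -[x.2 * _]addr0 -[X in _ + (_ + X)]f0 -L -L addr0; congr f.
  case: x => x y; apply: (@etrans _ _ (x * 1 + y * 0, x * 0 + y * 1)); last exact: erefl.
  by rewrite !mulr1 !mulr0 addr0 add0r.
move=> [bil an nd]; pose h p := w p (0, 1) (1, 0).
have wE : \forall p \near (0 : R * R), forall x y, w p x y = h p * dxi_dx x y.
  near=> p => x y.
  have [[L1 L2] alt] : bilinear_for *%R *%R (w p) /\ forall x, w p x x = 0.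
    by near: p.
  have E (z t : R * R) : w p z t = z.1 * (t.1 * w p (1, 0) (1, 0) + t.2 * w p (1, 0) (0, 1)) +
      z.2 * (t.1 * w p (0, 1) (1, 0) + t.2 * w p (0, 1) (0, 1)).
    by rewrite (lin _ (L1 t)) (lin _ (L2 (1, 0))) (lin _ (L2 (0, 1))).
  have anti : w p (1, 0) (0, 1) = - h p.
    have := alt (1, 1); rewrite E !alt /= !mul1r add0r addr0 /h => /eqP.
    by rewrite addr_eq0 => /eqP.
  by rewrite E !alt anti -/(h p) /dxi_dx; ring.
exists h; last by split; [exact: an | exact: wE].
apply/eqP => h0; have w0 := nbhs_singleton wE.
have /nd : forall z, w 0 (1, 0) z = 0 by move=> z; rewrite w0 h0 mul0r.
by move=> /(congr1 fst) /eqP; rewrite oner_eq0.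
Unshelve. all: by end_near. Qed.

End Forms.

(** * The normal form theorem *)

Section Assembly.
Variables (R : realType) (k : nat) (s : bool).
Hypothesis hk : (2 <= k)%N.
Let e : R := (-1) ^+ s.
Local Notation A := (ps (ps R)).
Local Notation f := (ff k e).
Implicit Types (c d : nat -> R -> R) (a b : nat -> ps R).

Let he : e * e = 1.
Proof. by rewrite -expr2 sqrr_sign. Qed.

Definition density c (p : R * R) : R := \sum_(i < k.-1) p.1 ^+ i * c i (model k s p).

Definition nf_series a c := forall i, (i < k.-1)%N -> germ1 (a i) (c i).

Lemma germ_model : germ f (model k s : R * R -> R).
Proof.
apply: germD; first exact: germX _ (@germ_snd R).
by apply: germM; [exact: germC | exact: germX _ (@germ_fst R)].
Qed.

Lemma germ_density a c : nf_series a c -> germ (hser k e a) (density c).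
Proof.
move=> h; apply: germ_sum => i; apply: germM; first exact: germX _ (@germ_fst R).
have he' : is_emap (fun p : R * R => (p.1, model k s p)) vx f.
  split; [exact: germ_fst | exact: germ_model | exact: ord_vx | exact: ord_ff].
have := germ_emap (h i (ltn_ord i)) he'.
by rewrite (subst2_psC _ (ord_vx R) (ord_ff e hk)).
Qed.

Lemma subst2_ff (u v : A) : ord 1 u -> ord 1 v -> subst2 u v f = v ^+ 2 + CC e * u ^+ k.
Proof.
move=> hu hv; have hs := subst2_hom hu hv.
rewrite /ff (rhD hs (vy ^+ 2)) (rhM hs (CC e)) (rhX hs vy 2) (rhX hs vx k).
by rewrite (subst2_CC hu hv) (subst2_vx hu hv) (subst2_vy hu hv).
Qed.

Lemma subst2_hser (u v : A) a : ord 1 u -> ord 1 v -> subst2 u v f = f ->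
  subst2 u v (hser k e a) = \sum_(i < k.-1) u ^+ i * series_at f (a i).
Proof.
move=> hu hv hf; have of_ := ord_ff e hk; have ox := ord_vx R.
rewrite hser_subst // (subst2_comp _ ox of_ hu hv) hf (subst2_vx hu hv).
have hs := subst2_hom hu of_; apply: etrans (rh_sum hs _ _ _) _.
apply: eq_bigr => i _.
by rewrite (rhM hs (vx ^+ i)) (rhX hs vx i) (subst2_vx hu of_) (subst2_psC _ hu of_).
Qed.

Lemma eq_hser a b : (forall i, (i < k.-1)%N -> b i = a i) -> hser k e b = hser k e a.
Proof. by move=> h; apply: eq_bigr => i _; rewrite h. Qed.

Lemma nf_data_series c : nf_data k c -> exists a, nf_series a c.
Proof.
move=> [an _].
have /choice [a ha] : forall i, exists x, (i < k.-1)%N -> germ1 x (c i).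
  move=> i; case: (ltnP i k.-1) => [/an/analytic1_germ [x hx]|_]; last by exists 0.
  by exists x.
by exists a.
Qed.

Lemma pred_gt0 : (0 < k.-1)%N.
Proof. by rewrite -ltnS prednK // ltnW. Qed.

(** An equivalence gives an identity between series to which [formal_unique] applies;
conversely the identity and [p -> - p] realise the two cases. *)
Theorem normal_pair_equivP a b c d : nf_series a c -> nf_series b d ->
  0 < c 0%N 0 * d 0%N 0 ->
  pair_equiv (normal_pair k s c) (normal_pair k s d) <->
  (forall i, (i < k.-1)%N -> b i = a i) \/
  (~~ odd k /\ forall i, (i < k.-1)%N -> b i = if odd i then - a i else a i).
Proof.
move=> ha hb hs; have ga := germ_density ha; have gb := germ_density hb.
have wE : \forall p \near (0 : R * R), forall x y,
    (normal_pair k s c).2 p x y = density c p * dxi_dx x y by near=> p.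
split=> [E|[E|[ok E]]].
- have [u [v [ou ov hf hw]]] := pair_equivE germ_model ga wE germ_model gb E.
  rewrite (subst2_hser _ ou ov hf) mulrC in hw; rewrite (subst2_ff ou ov) in hf.
  apply: (formal_unique hk he ou hf hw).
  by rewrite -(germ1_at0 (ha _ pred_gt0)) -(germ1_at0 (hb _ pred_gt0)).
- have [di ei] := diffeo_id R.
  apply: (pair_equivI germ_model ga wE di ei); rewrite subst2_id; first exact: germ_model.
  by rewrite pb_id mulr1 -(eq_hser E).
have [di ei] := diffeo_opp R; have [_ _ ou ov] := ei.
have hf : subst2 (- vx) (- vy) f = f.
  by rewrite (subst2_ff ou ov) sqrrN exprNn -signr_odd (negPf ok) expr0 mul1r.
apply: (pair_equivI germ_model ga wE di ei); first by rewrite hf; exact: germ_model.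
rewrite (subst2_hser _ ou ov hf).
have -> : pb (- vx) (- vy) = 1 :> A.
  rewrite /pb !(derN (@dxP R)) !(derN (@dyP R)) dxvx dyvx dxvy dyvy.
  by rewrite mulrNN mulr1 oppr0 mul0r subr0.
rewrite mulr1 (_ : \sum_(i < _) _ = hser k e b); first exact: gb.
apply: eq_bigr => i _; rewrite (E i (ltn_ord i)) exprNn -signr_odd.
by case: (odd i); rewrite ?expr1 ?expr0 ?mul1r // mulN1r (rhN (series_at_hom e hk)) mulrN mulNr.
Unshelve. all: by end_near. Qed.

(** By the chain rule the Jacobians at 0 of two inverse maps have product 1. *)
Lemma jacobian_neq0 (u v P Q : A) : ord 1 P -> ord 1 Q ->
  subst2 P Q u = vx -> subst2 P Q v = vy ->
  cf2 (pb u v) 0 0 != 0 /\ cf2 (pb P Q) 0 0 != 0.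
Proof.
move=> oP oQ hu hv; apply/andP; rewrite -negb_or -mulf_eq0.
have := pb_subst2 u v oP oQ; rewrite hu hv pb_id => /(congr1 (fun z => cf2 z 0 0)).
rewrite /= cf2_00M (cf2_00_subst2 _ oP oQ) -CC1 cf2_CC /= => <-.
exact: oner_neq0.
Qed.

(** In the coordinates given by the singularity the density is decomposed in the Brieskorn
module, and its trivial part is removed by [straighten]. *)
Theorem normal_form_exists (H : R * R -> R) (w : two_form R) :
  analytic2 H -> symplectic_germ w -> A_singularity k s H ->
  exists c, nf_data k c /\ pair_equiv (H, w) (normal_pair k s c).
Proof.
move=> /analytic2_germ [aH gH] /symplectic_density [h h0 [/analytic2_germ [ah gh] wE]].
move=> [chi [[chi0 anchi [phi [phi0 anphi inv1 inv2]]] HE]].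
have [u1 [v1 echi]] := analytic_emap anchi chi0.
have [P [Q ephi]] := analytic_emap anphi phi0.
have [_ _ ou1 ov1] := echi; have [_ _ oP oQ] := ephi.
have hP : subst2 P Q aH = f.
  apply: germ_inj (germ_emap gH ephi) germ_model _.
  have N := emap_near ephi HE; near=> p.
  have -> : H (phi p) = model k s (chi (phi p)) by near: p.
  by congr (model k s _); near: p.
have e12 := emap_comp ephi echi.
have [g1 g2 _ _] := e12.
have hu1 : subst2 P Q u1 = vx.
  apply: germ_inj g1 (@germ_fst R) _; near=> p.
  by congr (_ .1); near: p.
have hv1 : subst2 P Q v1 = vy.
  apply: germ_inj g2 (@germ_snd R) _; near=> p.
  by congr (_ .2); near: p.
have [_ J0] := jacobian_neq0 oP oQ hu1 hv1.
(* the density in the coordinates where the Hamiltonian is the model *)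
pose hh := subst2 P Q ah * pb P Q.
have ch : convergent hh.
  have [q gq _] := pullback_density gh wE ephi; exact: germ_convergent gq.
have hh0 : cf2 hh 0 0 != 0.
  by rewrite cf2_00M (cf2_00_subst2 _ oP oQ) -(germ_at0 gh) mulf_neq0.
have [a [G [ca cG hE]]] := brieskorn_generated hk he ch.
have [u [v [nid hf hw]]] := straighten e hk ch hh0 (convergentN cG).
have [psi [epsi dpsi]] := near_id_diffeo nid.
have [ou ov] := near_id_ord nid.
have hw' : pb u v * subst2 u v hh = hser k e a.
  rewrite hw hE /pb (derN (@dxP R)) (derN (@dyP R)); clear.
  by move: (hser k e a) (dx G) (dy G) (dx f) (dy f) => x1 x2 x3 x4 x5; ring.
pose c i := psfun (a i).
have hc : nf_series a c by move=> i _; exact: germ1_psfun.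
exists c; split.
  split=> [i hi|]; first exact: germ1_analytic (hc i hi).
  rewrite (germ1_at0 (hc _ pred_gt0)) -(cf2_hser00 e hk) -hw'.
  rewrite cf2_00M (cf2_00_subst2 _ ou ov) mulf_neq0 //.
  have [U [V [/near_id_ord [oU oV] eU eV _ _]]] := near_id_inverse nid.
  by have [] := jacobian_neq0 oU oV eU eV.
have dphi : diffeo_germ phi by split=> //; exists chi.
apply: (pair_equivI gH gh wE (diffeo_comp dpsi dphi) (emap_comp epsi ephi)).
  rewrite -(subst2_comp _ oP oQ ou ov) hP hf; exact: germ_model.
rewrite -(subst2_comp _ oP oQ ou ov) (pb_subst2 _ _ ou ov) mulrA.
rewrite -(rhM (subst2_hom ou ov)) mulrC hw'.
exact: germ_density hc.
Unshelve. all: by end_near. Qed.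

Lemma nf_flip c : nf_data k c -> nf_data k (flip_odd c).
Proof.
move=> hc; have [a ha] := nf_data_series hc; have [_ c0] := hc.
split; last by rewrite /flip_odd.
move=> i hi; rewrite /flip_odd; case: (odd i).
  exact: germ1_analytic (germ1N (ha i hi)).
exact: germ1_analytic (ha i hi).
Qed.

Lemma agree_eq c d : nf_data k c -> nf_data k d ->
  (agree_on (all_coefs k) c d <-> forall i, (i < k.-1)%N -> eq_germ (d i) (c i)).
Proof.
move=> /nf_data_series [a ha] /nf_data_series [b hb]; split=> h.
  move=> i hi; apply/(germ1_eq (hb i hi) (ha i hi)); apply: psP => n.
  by have := h (i, n) hi; rewrite /= (taylor_coefE _ (ha i hi)) (taylor_coefE _ (hb i hi)).
move=> [i n] /= hi; rewrite (taylor_coefE _ (ha i hi)) (taylor_coefE _ (hb i hi)).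
by have /(germ1_eq (hb i hi) (ha i hi)) -> := h i hi.
Qed.

Lemma same_sign c d : nf_data k c -> nf_data k d -> same_orientation c d ->
  0 < c 0%N 0 * d 0%N 0.
Proof.
move=> [_ c0] [_ d0] E; rewrite -sgr_gt0 sgrM -E -expr2.
by rewrite exprn_even_gt0 // sgr_eq0.
Qed.

Theorem uniqueness c d : nf_data k c -> nf_data k d -> same_orientation c d ->
  pair_equiv (normal_pair k s c) (normal_pair k s d) <->
  (forall i, (i < k.-1)%N -> eq_germ (d i) (c i)) \/
  (~~ odd k /\ forall i, (i < k.-1)%N -> eq_germ (d i) (flip_odd c i)).
Proof.
move=> hc hd E; have hs := same_sign hc hd E.
have [a ha] := nf_data_series hc; have [b hb] := nf_data_series hd.
have hfl i : (i < k.-1)%N -> germ1 (if odd i then - a i else a i) (flip_odd c i).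
  move=> hi; rewrite /flip_odd; case: (odd i); last exact: ha.
  exact: germ1N (ha i hi).
apply: iff_trans (normal_pair_equivP ha hb hs) _.
split=> [[h|[ok h]]|[h|[ok h]]]; [left|right; split=> //|left|right; split=> //] => i hi.
- by apply/(germ1_eq (hb i hi) (ha i hi)); exact: h.
- by apply/(germ1_eq (hb i hi) (hfl i hi)); exact: h.
- by have /(germ1_eq (hb i hi) (ha i hi)) := h i hi.
- by have /(germ1_eq (hb i hi) (hfl i hi)) := h i hi.
Qed.

Theorem complete_all : odd k -> complete_invariants R k s (all_coefs k).
Proof.
move=> ok c d hc hd E; apply: iff_trans (uniqueness hc hd E) _.
apply: iff_trans (iff_sym (agree_eq hc hd)).
by split=> [[//|[]]|]; [rewrite ok | left].
Qed.

Lemma cfXn (n m : nat) : cf (psX ^+ n : ps R) m = (m == n)%:R.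
Proof.
rewrite -[psX ^+ n]mulr1 cfXnM -(rmorph1 (@psC R)) cfC.
by case: (ltngtP m n) => // [h|->]; rewrite ?subnn // subn_eq0 leqNgt h.
Qed.

(** Two normal forms can be made to differ in any single prescribed Taylor coefficient
without changing the orientation, so no coefficient can be omitted. *)
Theorem minimal_all : odd k -> forall S : set (nat * nat), S `<=` all_coefs k ->
  complete_invariants R k s S -> S = all_coefs k.
Proof.
move=> ok S hS cS; apply/seteqP; split=> // -[i n] /= hi.
apply: contrapT => nS.
(* the densities [1] and [1 + x^i f^n] *)
pose a j : ps R := if j == 0%N then 1 else 0.
pose b j : ps R := a j + if j == i then psX ^+ n else 0.
have mono m : germ1 (psX ^+ m : ps R) (fun t => t ^+ m).
  by have := germX m (@germ_snd R); rewrite /germ1 vyE -rmorphXn.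
have ga j : germ1 (a j) (fun=> (j == 0%N)%:R).
  rewrite /germ1 /a; case: (j == 0%N).
    by rewrite rmorph1 -CC1; exact: germC.
  by rewrite rmorph0 -CC0; exact: germC.
have gb j : germ1 (b j) (fun t => (j == 0%N)%:R + if j == i then t ^+ n else 0).
  rewrite /germ1 rmorphD; apply: germD; first exact: ga.
  case: (j == i); first exact: mono.
  by rewrite rmorph0 -CC0; exact: germC.
pose c j (t : R) : R := (j == 0%N)%:R.
pose d j (t : R) : R := (j == 0%N)%:R + if j == i then t ^+ n else 0.
have d0 : 0 < d 0%N 0.
  by rewrite /d eqxx; case: ifP => _; rewrite ?addr0 ?ltr01 // ltr_pwDl ?ltr01 ?exprn_ge0.
have hc : nf_data k c by split=> [j _|]; [exact: germ1_analytic (ga j) | rewrite /c oner_neq0].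
have hd : nf_data k d by split=> [j _|]; [exact: germ1_analytic (gb j) | rewrite gt_eqF].
have E : same_orientation c d by rewrite /same_orientation (gtr0_sg d0) /c gtr0_sg ?ltr01.
have eqv : pair_equiv (normal_pair k s c) (normal_pair k s d).
  apply/(cS _ _ hc hd E) => -[j m] Sjm /=.
  rewrite (taylor_coefE _ (ga j)) (taylor_coefE _ (gb j)) /b cfD.
  case: eqP => [ji|_]; last by rewrite cf0 addr0.
  have mn : m <> n by move=> mn; apply: nS; rewrite -ji -mn.
  by rewrite cfXn; case: eqP mn => // _ _; rewrite addr0.
have /(_ (i, n) hi) := (complete_all ok hc hd E).1 eqv.
rewrite /= (taylor_coefE _ (ga i)) (taylor_coefE _ (gb i)) /b cfD eqxx cfXn eqxx.
by move/eqP; rewrite -{1}[cf (a i) n]addr0 (inj_eq (addrI _)) eq_sym oner_eq0.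
Qed.

Theorem complete_even : ~~ odd k -> forall c d,
  nf_data k c -> nf_data k d -> same_orientation c d ->
  pair_equiv (normal_pair k s c) (normal_pair k s d) <->
  agree_on (all_coefs k) c d \/ agree_on (all_coefs k) (flip_odd c) d.
Proof.
move=> ok c d hc hd E; apply: iff_trans (uniqueness hc hd E) _.
have h1 := agree_eq hc hd; have h2 := agree_eq (nf_flip hc) hd.
split=> [[/h1|[_ /h2]]|[/h1|/h2]]; by [left|right].
Qed.
End Assembly.

Theorem theorem3p5 (R : realType) (k : nat) (s : bool) (hk : (2 <= k)%N) :
  [/\
    forall (H : R * R -> R) (w : two_form R),
      analytic2 H -> symplectic_germ w -> A_singularity k s H ->
      exists c : nat -> R -> R,
        nf_data k c /\ pair_equiv (H, w) (normal_pair k s c),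
    forall c c' : nat -> R -> R,
      nf_data k c -> nf_data k c' -> same_orientation c c' ->
      pair_equiv (normal_pair k s c) (normal_pair k s c') <->
      (forall i, (i < k.-1)%N -> eq_germ (c' i) (c i)) \/
      (~~ odd k /\ forall i, (i < k.-1)%N -> eq_germ (c' i) (flip_odd c i)),
    odd k ->
      complete_invariants R k s (all_coefs k) /\
      (forall S : set (nat * nat), S `<=` all_coefs k ->
         complete_invariants R k s S -> S = all_coefs k) &
    ~~ odd k ->
      forall c c' : nat -> R -> R,
        nf_data k c -> nf_data k c' -> same_orientation c c' ->
        pair_equiv (normal_pair k s c) (normal_pair k s c') <->
        agree_on (all_coefs k) c c' \/
        agree_on (all_coefs k) (flip_odd c) c'].
Proof.
split; [exact: normal_form_exists | exact: uniqueness | | exact: complete_even].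
by move=> ok; split; [exact: complete_all | exact: minimal_all].
Qed.
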